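(* Let $p$ be a positive integer and $k,m$ integers; let $C\in\mathbb C\setminus\{0\}$ and $D,S,E\in\mathbb C$. There is a short exact sequence $$0\to \mathrm M_{k-p}(m)\xrightarrow{\ f\ }\mathrm M_k(m)\xrightarrow{\ g\ }\mathrm M_{k-1}(m)\to0$$ of $F(p)$-modules, with the morphisms uniquely determined by $f(v_{k-p,m})=a(-k+1)v_{k,m}$ and $g(v_{k,m})=v_{k-1,m}$. It may be seen as a grading-preserving exact sequence $$0\to \mathrm M_{k-p}(m;S+C,E+k-2+D)\to \mathrm M_k(m;S,E)\to \mathrm M_{k-1}(m;S,E)\to0$$ of bigraded $F(p;C,D)$-modules.
   Context: All vector spaces are over $\mathbb C$; vertex superalgebras are also called vertex algebras. For a positive integer $p$, $F(p)$ is the free vertex algebra generated by one element $a$ (even if $p$ is even, odd if $p$ is odd) with $(z-w)^{-p}Y(a,z)Y(a,w)=(w-z)^{-p}Y(a,w)Y(a,z)$, powers being expanded in non-negative powers of the second variable; it is the initial object among vertex algebras generated by such an $a$ (with the $\mathbb Z$-grading for which $a$ has degree $1$). Write $Y(a,z)=\sum_{n\in\mathbb Z}a(n)z^{-n-1}$. For an integer $k$, $F(k,p)$ is the quotient vertex algebra $F(k,p)=F(p)/\sum_{n\ge0}a(-k-n)F(p)$; the image of $a$ is again denoted $a$. For an integer $m$, $\mathrm M_k(m)$ is the free representation of order $-m$ over $F(k,p)$: the universal $F(k,p)$-module generated by a vector $v_{k,m}$ with $a(-m+n)v_{k,m}=0$ for all integers $n\ge0$. It is regarded as an $F(p)$-module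 via the surjection $F(p)\to F(k,p)$. Bigradings: $F(p;C,D)$ is $F(p)$ with $a(-n_r)\cdots a(-n_1)\mathbf 1$ in bidegree $(Cr,\ n_1+\cdots+n_r-r+rD)$; $\mathrm M_k(m;S,E)$ is $\mathrm M_k(m)$ with $a(-n_r)\cdots a(-n_1)v_{k,m}$ in bidegree $(S+Cr,\ E+n_1+\cdots+n_r-r+rD)$. Homomorphisms are understood up to identification of equivalent (shifted) charge/parity gradings.
   Formalization: Injectivity of f is claimed only for k ≥ max(m,0)+2, because for smaller k one has a(-k+1)v_{k,m}=0, so f=0 while M_{k-p}(m)≠0; all other claims (existence and uniqueness of f and g, im f = ker g, g onto, bigradings) hold for all k, m. *)

(* Defs.v *)
From HB Require Import structures.
From mathcomp Require Import all_boot all_order all_algebra.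
From mathcomp Require Import boolp classical_sets reals.
From mathcomp Require Export complex.

Set Implicit Arguments.
Unset Strict Implicit.
Unset Printing Implicit Defensive.

Import GRing.Theory.
Local Open Scope classical_set_scope.
Local Open Scope ring_scope.

Section Linear.
Variables (K : fieldType) (V : lmodType K).

Definition is_subspace (P : set V) : Prop :=
  P 0 /\ forall (c : K) (x y : V), P x -> P y -> P (c *: x + y).

Definition lspan (S : set V) : set V :=
  [set x | exists (n : nat) (c : 'I_n -> K) (y : 'I_n -> V),
     (forall i, S (y i)) /\ x = \sum_(i < n) c i *: y i].

Definition is_grading (I : eqType) (G : I -> set V) : Prop :=
  [/\ forall i, is_subspace (G i),
      forall x, exists (s : seq I) (y : I -> V),
        (forall i, G i (y i)) /\ x = \sum_(i <- s) y i
    & forall (s : seq I) (y : I -> V), uniq s -> (forall i, G i (y i)) ->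
        \sum_(i <- s) y i = 0 -> forall i, i \in s -> y i = 0].

End Linear.

(* The binomial coefficient m (m - 1) ... (m - j + 1) / j! for m in Z, using
   binom(-(n + 1), j) = (-1)^j binom(n + j, j) when m is negative. *)
Definition binz (m : int) (j : nat) : int :=
  match m with
  | Posz n => 'C(n, j)%:Z
  | Negz n => (-1) ^+ j * 'C(n + j, j)%:Z
  end.

Section Series.
Variables (K : fieldType) (V M : lmodType K).

(* An action is given by its modes: act n x u is x(n)u, where
   Y(x, z) = \sum_(n in Z) x(n) z^(-n-1). *)
Variable act : int -> V -> M -> M.

(* The coefficient of z^(-m-1) w^(-n-1) in (z - w)^l Y(x, z) Y(y, w) u, where
   (z - w)^l is expanded in non-negative powers of w.  The sum over j is
   truncated at N; its value stabilises as N grows since y(n + j)u = 0 for j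
   large. *)
Definition zwcoef (l : int) (x y : V) (m n : int) (u : M) (N : nat) : M :=
  \sum_(j < N)
    act (l + m - j%:Z) x (act (n + j%:Z) y u) *~ ((-1) ^+ j * binz l j).

(* The Borcherds identity
     \sum_j binom(m, j) (x(l+j)y)(m+n-j) u
       = \sum_j (-1)^j binom(l, j)
           (x(l+m-j)y(n+j)u - (-1)^(l + |x||y|) y(l+n-j)x(m+j)u)
   for homogeneous x and y of parities i and j (true means odd).  All sums
   have finitely many nonzero terms, so they are compared after truncation at
   every large enough N. *)
Definition borcherds (nprod : int -> V -> V -> V) (par : bool -> set V) : Prop :=
  forall (i j : bool) (x y : V), par i x -> par j y ->
  forall (u : M) (l m n : int), exists N0 : nat, forall N : nat, (N0 <= N)%N ->
    \sum_(h < N) act (m + n - h%:Z) (nprod (l + h%:Z) x y) u *~ binz m h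
    = zwcoef l x y m n u N
      - zwcoef l y x n m u N *~ ((-1) ^+ (`|l|%N + (i && j))).

(* act (-n_r) a (... (act (-n_1) a u)) for s = [:: n_r; ...; n_1]. *)
Definition monomial (a : V) (s : seq int) (u : M) : M :=
  foldr (fun n w => act (- n) a w) u s.

(* The bidegree (c, d) subspace when a(-n_r)...a(-n_1)u is put in bidegree
   (S + C r, E + n_1 + ... + n_r - r + r D). *)
Definition bideg (a : V) (u : M) (C D S E : K) (b : K * K) : set M :=
  lspan [set w | exists s : seq int,
    [/\ w = monomial a s u,
        b.1 = S + C *+ size s
      & b.2 = E + (\sum_(n <- s) n)%:~R - (size s)%:R + D *+ size s]].

End Series.

Structure vertexSuperalgebra (K : fieldType) := VertexSuperalgebra {
  va_sort :> lmodType K;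
  vac : va_sort;
  va_par : bool -> set va_sort;  (* false: even part, true: odd part *)
  nprod : int -> va_sort -> va_sort -> va_sort;
  _ : forall n x, linear (nprod n x);
  _ : forall n y, linear (fun x => nprod n x y);
  _ : forall x y, exists N : int, forall n, (N <= n)%R -> nprod n x y = 0;
  _ : is_grading va_par;
  _ : va_par false vac;
  _ : forall i j n x y, va_par i x -> va_par j y ->
        va_par (i (+) j) (nprod n x y);
  _ : forall n x, nprod n vac x = if n == -1 then x else 0;
  _ : forall x, nprod (-1) x vac = x;
  _ : forall (n : nat) x, nprod n%:Z x vac = 0;
  _ : borcherds nprod nprod va_par }.

Structure vmodule (K : fieldType) (V : vertexSuperalgebra K) := VModule {
  vm_sort :> lmodType K;
  vm_par : bool -> set vm_sort;
  vact : int -> V -> vm_sort -> vm_sort;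
  _ : forall n x, linear (vact n x);
  _ : forall n u, linear (fun x => vact n x u);
  _ : forall x u, exists N : int, forall n, (N <= n)%R -> vact n x u = 0;
  _ : is_grading vm_par;
  _ : forall i j n x u, va_par i x -> vm_par j u ->
        vm_par (i (+) j) (vact n x u);
  _ : forall n u, vact n (vac V) u = if n == -1 then u else 0;
  _ : borcherds vact (@nprod K V) (@va_par K V) }.

Structure vaHom (K : fieldType) (V W : vertexSuperalgebra K) := VaHom {
  va_fun :> {linear V -> W};
  _ : va_fun (vac V) = vac W;
  _ : forall n x y, va_fun (nprod n x y) = nprod n (va_fun x) (va_fun y);
  _ : forall i x, va_par i x -> va_par i (va_fun x) }.

(* Homomorphisms up to shift of the parity grading: they commute with the
   action and either preserve or exchange the parities. *)
Structure vmodHom (K : fieldType) (V : vertexSuperalgebra K)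
    (M N : vmodule V) := VmodHom {
  vm_fun :> {linear M -> N};
  _ : forall n x u, vm_fun (vact n x u) = vact n x (vm_fun u);
  _ : exists s : bool, forall i u, vm_par i u -> vm_par (i (+) s) (vm_fun u) }.

Section Pullback.
Variables (K : fieldType) (V W : vertexSuperalgebra K) (phi : vaHom V W).
Variable M : vmodule W.

Let pact (n : int) (x : V) (u : M) : M := vact n (phi x) u.

Fact pullback_linear_r n x : linear (pact n x).
Proof. by case: M @pact => ? ? ? lr ? ? ? ? ? ? ? /=; apply: lr. Qed.

Fact pullback_linear_l n u : linear (fun x => pact n x u).
Proof.
rewrite /pact; case: M u => ? ? ? ? ll ? ? ? ? ? /= u c x y.
by rewrite linearP ll.
Qed.

Fact pullback_trunc x u :
  exists N : int, forall n, (N <= n)%R -> pact n x u = 0.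
Proof. by rewrite /pact; case: M u => ? ? ? ? ? tr ? ? ? ? /= u; apply: tr. Qed.

Fact pullback_grading : is_grading (@vm_par K W M).
Proof. by case: M. Qed.

Fact pullback_par i j n x u : va_par i x -> vm_par j u ->
  vm_par (i (+) j) (pact n x u).
Proof.
rewrite /pact; case: phi => f ? ? fpar; case: M u => ? ? ? ? ? ? ? mpar ? ? /= u.
by move=> /fpar xi uj; apply: mpar.
Qed.

Fact pullback_vac n u : pact n (vac V) u = if n == -1 then u else 0.
Proof.
rewrite /pact; case: phi => f /= -> _ _.
by case: M u => ? ? ? ? ? ? ? ? mvac ? /= u; apply: mvac.
Qed.

Fact pullback_borcherds : borcherds pact (@nprod K V) (@va_par K V).
Proof.
move=> i j x y xi yj u l m n; rewrite /zwcoef /pact.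
case: phi => f _ fM fpar /=.
case: M u => ? ? ? ? ? ? ? ? ? bor /= u.
have [N0 bN] := bor _ _ _ _ (fpar _ _ xi) (fpar _ _ yj) u l m n.
exists N0 => N /bN; rewrite /zwcoef => <-.
by apply: eq_bigr => h _; rewrite fM.
Qed.

Definition pullback : vmodule V :=
  VModule pullback_linear_r pullback_linear_l pullback_trunc pullback_grading
    pullback_par pullback_vac pullback_borcherds.

End Pullback.

Section Free.
Variable K : fieldType.

Definition va_generated (V : vertexSuperalgebra K) (a : V) : Prop :=
  forall P : set V, is_subspace P -> P (vac V) -> P a ->
    (forall n x y, P x -> P y -> P (nprod n x y)) -> forall x, P x.

(* (z - w)^(-p) Y(a, z) Y(a, w) = (w - z)^(-p) Y(a, w) Y(a, z), coefficientwise
   on every vector. *)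
Definition self_local (p : nat) (V : vertexSuperalgebra K) (a : V) : Prop :=
  forall (x : V) (m n : int), exists N0 : nat, forall N : nat, (N0 <= N)%N ->
    zwcoef (@nprod K V) (- p%:Z) a a m n x N
    = zwcoef (@nprod K V) (- p%:Z) a a n m x N.

Definition admissible (p : nat) (V : vertexSuperalgebra K) (a : V) : Prop :=
  [/\ va_par (odd p) a, self_local p a & va_generated a].

(* F(p), up to isomorphism: the initial pair (V, a). *)
Structure freeVA (p : nat) := FreeVA {
  fva :> vertexSuperalgebra K;
  fgen : fva;
  _ : admissible p fgen;
  _ : forall (W : vertexSuperalgebra K) (b : W), admissible p b ->
        exists h : vaHom fva W, h fgen = b /\
          forall h' : vaHom fva W, h' fgen = b -> h' =1 h }.

Definition vm_generated (V : vertexSuperalgebra K) (M : vmodule V) (v : M) :=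
  forall P : set M, is_subspace P -> P v ->
    (forall n (x : V) u, P u -> P (vact n x u)) -> forall u, P u.

Definition vm_homogeneous (V : vertexSuperalgebra K) (M : vmodule V) (v : M) :=
  exists i : bool, vm_par i v.

Section Quotient.
Variables (p : nat) (F : freeVA p).

(* F(k, p), up to isomorphism: the target of a surjective homomorphism from
   F(p) with kernel \sum_(n >= 0) a(-k-n) F(p). *)
Structure quotVA (k : int) := QuotVA {
  qva :> vertexSuperalgebra K;
  qproj : vaHom F qva;
  _ : forall y : qva, exists x : F, qproj x = y;
  _ : forall x : F, qproj x = 0 <->
        lspan [set y : F | exists (n : nat) (z : F),
                 y = nprod (- k - n%:Z) (fgen F) z] x }.

(* M_k(m), up to isomorphism: the universal F(k, p)-module generated by a
   (parity homogeneous) vector v with a(-m+n)v = 0 for n >= 0. *)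
Structure freeRep (k m : int) := FreeRep {
  fr_alg : quotVA k;
  fr_mod : vmodule fr_alg;
  fr_gen : fr_mod;
  _ : vm_homogeneous fr_gen;
  _ : vm_generated fr_gen;
  _ : forall n : nat, vact (- m + n%:Z) (qproj fr_alg (fgen F)) fr_gen = 0;
  _ : forall (N : vmodule fr_alg) (w : N), vm_homogeneous w ->
        (forall n : nat, vact (- m + n%:Z) (qproj fr_alg (fgen F)) w = 0) ->
        exists h : vmodHom fr_mod N, h fr_gen = w /\
          forall h' : vmodHom fr_mod N, h' fr_gen = w -> h' =1 h }.

(* M_k(m), regarded as an F(p)-module via F(p) -> F(k, p). *)
Definition fr_res (k m : int) (M : freeRep k m) : vmodule F :=
  pullback (qproj (fr_alg M)) (fr_mod M).

Definition fr_vec (k m : int) (M : freeRep k m) : fr_res M := fr_gen M.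

(* The bidegree subspaces of F(p; C, D) and of M_k(m; S, E). *)
Definition F_bideg (C D : K) : K * K -> set F :=
  bideg (@nprod K F) (fgen F) (vac F) C D 0 0.

Definition M_bideg (k m : int) (M : freeRep k m) (C D S E : K) :
    K * K -> set (fr_res M) :=
  bideg (@vact K F (fr_res M)) (fgen F) (fr_vec M) C D S E.

End Quotient.
End Free.

Arguments F_bideg {K p} F C D _ _.
Arguments M_bideg {K p F k m} M C D S E _ _.

(* The first degree is additive and x(n) shifts the second one by the second
   degree of x minus n + 1. *)
Definition is_bigraded_va (K : fieldType) (V : vertexSuperalgebra K)
    (G : K * K -> set V) : Prop :=
  [/\ is_grading G, G (0, 0) (vac V)
    & forall (b b' : K * K) (n : int) (x y : V), G b x -> G b' y ->
        G (b.1 + b'.1, b.2 + b'.2 - n%:~R - 1) (nprod n x y)].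

Definition is_bigraded_vmodule (K : fieldType) (V : vertexSuperalgebra K)
    (G : K * K -> set V) (M : vmodule V) (H : K * K -> set M) : Prop :=
  is_grading H /\
  forall (b b' : K * K) (n : int) (x : V) (u : M), G b x -> H b' u ->
    H (b.1 + b'.1, b.2 + b'.2 - n%:~R - 1) (vact n x u).

Definition unique_hom (K : fieldType) (V : vertexSuperalgebra K)
    (M N : vmodule V) (f : vmodHom M N) (v : M) (w : N) : Prop :=
  f v = w /\ forall f' : vmodHom M N, f' v = w -> f' =1 f.

Definition grading_preserving (K : fieldType) (M N : lmodType K)
    (G : K * K -> set M) (H : K * K -> set N) (f : M -> N) : Prop :=
  forall b u, G b u -> H b (f u).

(* Main.v *)
Require Import Defs.
From HB Require Import structures.
From mathcomp Require Import all_boot all_order all_algebra perm.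
From mathcomp Require Import boolp classical_sets reals.
From mathcomp Require Import functions.
From mathcomp Require Import zify ring.

Set Implicit Arguments.
Unset Strict Implicit.
Unset Printing Implicit Defensive.

Import Order.TTheory GRing.Theory Num.Theory.
Local Open Scope ring_scope.

(** Applied to the vacuum, the defining relation of F(p) says that a(n)a = 0 for
    n >= -p.  In every module the Borcherds identity then gives two things: the
    modes of a supercommute, and (z - w)^(-p) Y(a, z) Y(a, w) is symmetric, so
    that Y(a, z) Y(a, w) is divisible by (z - w)^p.  An F(k, p)-module is the same
    as an F(p)-module on which Y(a, z) is a polynomial in z of degree at most
    k - 2, which means Y(a, z) = 0 when k < 2, because a(-k)1 is a multiple of T^(k-1) a
    (pullback_bounded, bounded_ker, fr_universal).

    Write A(z) = Y(a, z) on M_k(m), and B = a(-k+1) for the coefficient of z^(k-2).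
    In X(z, w) = (z - w)^(-p) A(z) A(w) the exponent of z is at most k - 2 - p, and
    by symmetry so is that of w.  The coefficient of w^(k-2) in
    A(z) A(w) = (z - w)^p X(z, w) is therefore, up to sign, that of w^(k-2-p) in X,
    so that A(z) B has degree at most k - 2 - p in z: the submodule B M_k(m) is a
    module over F(k-p, p) (top_module_bounded), and the universal property of
    M_(k-p)(m) produces f, with image B M_k(m).  The map g comes from the universal
    property of M_k(m), and it kills B M_k(m).

    What remains is that nothing else is lost, and this is a statement about
    bases.  The words a(-i_r-1) ... a(-i_1-1) v whose exponents grow by at least p
    and lie between max(m, 0) and k - 2 span M_k(m): the relations
    a(-n) B = 0 for n >= k - p rewrite all other words (word_standard).  They are also
    independent (standard_independent).  For this one needs a large module, and it
    is built from the dual point of view: a linear form on words of length r is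
    the coefficient function of a polynomial in r variables, and the relations of
    F(p) say that this polynomial is \prod_(i < j) (z_i - z_j)^p times a symmetric
    one.  The operators prescribing a letter act on all such functions, and the
    vertex algebra of fields that they generate turns this space into an
    F(p)-module by initiality (fields_F_module).  The product of an antisymmetrised
    monomial with the (p - 1)-st power of the Vandermonde determinant separates a
    given standard word from the others (led_exists).  Exactness in the middle
    compares M_k(m) modulo B M_k(m) with the basis of M_(k-1)(m), and f is
    injective because it sends the basis of M_(k-p)(m) to the words of the basis
    of M_k(m) with largest exponent k - 2, up to signs.

    Because all fields involved are regular, the vertex algebra they generate is a
    supercommutative algebra with a derivation, whose Borcherds identity is the
    Chu-Vandermonde formula (regular_borcherds).

    The bigradings are direct because rescaling modes, x(n) -> t^(-n-1) x(n), and
    a -> s a preserves all the universal properties; the resulting operators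
    multiply a monomial by a scalar that determines its bidegree
    (scaling_exists, fr_scaling_exists, bideg_grading). *)

(** * Subspaces and spans *)
Section Subspaces.
Variables (K : fieldType) (V : lmodType K).

Lemma subspace0 (P : set V) : is_subspace P -> P 0.
Proof. by case. Qed.

Lemma subspaceD (P : set V) x y : is_subspace P -> P x -> P y -> P (x + y).
Proof. by case=> _ Pl Px Py; rewrite -[x]scale1r; apply: Pl. Qed.

Lemma subspaceZ (P : set V) c x : is_subspace P -> P x -> P (c *: x).
Proof. by case=> P0 Pl Px; rewrite -[_ *: _]addr0; apply: Pl. Qed.

Lemma subspaceN (P : set V) x : is_subspace P -> P x -> P (- x).
Proof. by move=> Ps Px; rewrite -scaleN1r; apply: subspaceZ. Qed.

Lemma subspaceB (P : set V) x y : is_subspace P -> P x -> P y -> P (x - y).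
Proof. by move=> Ps Px Py; apply: subspaceD => //; apply: subspaceN. Qed.

Lemma subspaceMz (P : set V) (c : int) x : is_subspace P -> P x -> P (x *~ c).
Proof. by move=> Ps Px; rewrite -scaler_int; apply: subspaceZ. Qed.

Lemma subspace_sum (P : set V) I (r : seq I) (Q : pred I) (G : I -> V) :
  is_subspace P -> (forall i, Q i -> P (G i)) -> P (\sum_(i <- r | Q i) G i).
Proof.
move=> Ps PG; elim/big_ind: _ => //; first exact: subspace0.
by move=> x y; apply: subspaceD.
Qed.

Lemma subspace_pair (P : set V) : P 0 -> (forall x y, P x -> P y -> P (x + y)) ->
  (forall c x, P x -> P (c *: x)) -> is_subspace P.
Proof. by move=> P0 PD PZ; split=> // c x y Px Py; apply: PD => //; apply: PZ. Qed.

Lemma lspan_subspace (S : set V) : is_subspace (lspan S).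
Proof.
split; first by exists 0%N, (fun=> 0), (fun=> 0); split; [case | rewrite big_ord0].
move=> c x y [n [d [u [Su ->]]]] [n' [d' [u' [Su' ->]]]].
exists (n + n')%N,
  (fun i : 'I_(n + n') => match fintype.split i with inl j => c * d j | inr j => d' j end),
  (fun i : 'I_(n + n') => match fintype.split i with inl j => u j | inr j => u' j end).
split=> [i|]; first by case: (fintype.split i).
rewrite big_split_ord scaler_sumr /=; congr (_ + _); apply: eq_bigr => i _.
  by rewrite -[lshift _ _]/(unsplit (inl i)) unsplitK scalerA.
by rewrite -[rshift _ _]/(unsplit (inr i)) unsplitK.
Qed.

Lemma lspan_in (S : set V) x : S x -> lspan S x.
Proof.
by move=> Sx; exists 1%N, (fun=> 1), (fun=> x); rewrite big_ord1 scale1r.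
Qed.

Lemma lspan_min (S P : set V) : is_subspace P -> (forall x, S x -> P x) ->
  forall x, lspan S x -> P x.
Proof.
move=> Ps SP _ [n [c [y [Sy ->]]]]; apply: subspace_sum => // i _.
by apply: subspaceZ => //; apply: SP.
Qed.

(** Collecting equal vectors lets a linear combination be indexed by distinct
    labels, the form in which linear independence can be applied. *)
Lemma lspan_uniq (I : eqType) (S : set I) (G : I -> V) x :
  lspan [set y | exists2 i, S i & y = G i]%classic x ->
  exists (r : seq I) (c : I -> K),
    [/\ uniq r, forall i, i \in r -> S i & x = \sum_(i <- r) c i *: G i].
Proof.
case=> n [c [y [Sy ->]]].
have /choice[h hP] : forall i, exists j, S j /\ y i = G j.
  by move=> i; have [j] := Sy i; exists j.
pose r := undup (codom h).
exists r, (fun j => \sum_(i < n | h i == j) c i); split.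
- exact: undup_uniq.
- by move=> j; rewrite mem_undup => /codomP[i ->]; case: (hP i).
under [RHS]eq_bigr => j _ do rewrite scaler_suml big_mkcond /=.
rewrite exchange_big /=; apply: eq_bigr => i _.
rewrite (bigD1_seq (h i)) ?undup_uniq ?mem_undup ?codom_f //=.
rewrite eqxx (hP i).2 big1 ?addr0 // => j; by rewrite eq_sym => /negPf ->.
Qed.

End Subspaces.

Section SubLmod.
Variables (K : fieldType) (V : lmodType K) (P : set V) (hP : is_subspace P).

Definition in_subsp (_ : is_subspace P) : {pred V} := fun x => `[< P x >].

Fact in_subsp_closed : GRing.submod_closed (in_subsp hP).
Proof.
split=> [|c x y /asboolP Px /asboolP Py]; apply/asboolP; first exact: hP.1.
exact: hP.2.
Qed.

HB.instance Definition _ :=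
  GRing.isSubmodClosed.Build K V (in_subsp hP) in_subsp_closed.

Record subsp := SubSp { subval : V; subvalP : subval \in in_subsp hP }.

HB.instance Definition _ := [isSub for subval].
HB.instance Definition _ := [Choice of subsp by <:].
HB.instance Definition _ := [SubChoice_isSubLmodule of subsp by <:].

Lemma subval_in (x : subsp) : P (subval x).
Proof. by apply/asboolP; case: x. Qed.

Definition subin x (Px : P x) : subsp := SubSp (asboolT Px : x \in in_subsp hP).

Lemma subval_inj : injective subval.
Proof. exact: val_inj. Qed.

Lemma subval_linear : linear subval.
Proof. by move=> c x y. Qed.

HB.instance Definition _ :=
  GRing.isLinear.Build K subsp V *:%R subval subval_linear.

End SubLmod.

(** * Modes of vertex algebras and of their modules *)
Section VaAxioms.
Variables (K : fieldType) (V : vertexSuperalgebra K).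

Lemma nprod_linr n x : linear (@nprod K V n x).
Proof. by move: n x; case: V. Qed.
Lemma nprod_linl n y : linear (fun x => @nprod K V n x y).
Proof. by move: n y; case: V. Qed.
Lemma nprod_trunc x y : exists N : int, forall n, (N <= n)%R -> @nprod K V n x y = 0.
Proof. by move: x y; case: V. Qed.
Lemma va_par_grading : is_grading (@va_par K V).
Proof. by case: V. Qed.
Lemma vac_even : va_par false (vac V).
Proof. by case: V. Qed.
Lemma nprod_par i j n x y : va_par i x -> va_par j y ->
  va_par (i (+) j) (@nprod K V n x y).
Proof. by move: i j n x y; case: V. Qed.
Lemma nprod_vacl n x : @nprod K V n (vac V) x = if n == -1 then x else 0.
Proof. by move: n x; case: V. Qed.
Lemma nprod_vacr x : @nprod K V (-1) x (vac V) = x.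
Proof. by move: x; case: V. Qed.
Lemma nprod_vacr_ge0 (n : nat) x : @nprod K V n%:Z x (vac V) = 0.
Proof. by move: n x; case: V. Qed.
Lemma nprod_borcherds : borcherds (@nprod K V) (@nprod K V) (@va_par K V).
Proof. by case: V. Qed.

End VaAxioms.

Section ModAxioms.
Variables (K : fieldType) (V : vertexSuperalgebra K) (M : vmodule V).

Lemma vact_linr n x : linear (@vact K V M n x).
Proof. by move: n x; case: M. Qed.
Lemma vact_linl n u : linear (fun x => @vact K V M n x u).
Proof. by move: n u; case: M. Qed.
Lemma vact_trunc x u : exists N : int, forall n, (N <= n)%R -> @vact K V M n x u = 0.
Proof. by move: x u; case: M. Qed.
Lemma vm_par_grading : is_grading (@vm_par K V M).
Proof. by case: M. Qed.
Lemma vact_par i j n x u : va_par i x -> vm_par j u ->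
  vm_par (i (+) j) (@vact K V M n x u).
Proof. by move: i j n x u; case: M. Qed.
Lemma vact_vac n u : @vact K V M n (vac V) u = if n == -1 then u else 0.
Proof. by move: n u; case: M. Qed.
Lemma vact_borcherds : borcherds (@vact K V M) (@nprod K V) (@va_par K V).
Proof. by case: M. Qed.

HB.instance Definition _ n x :=
  GRing.isLinear.Build K M M *:%R (@vact K V M n x) (vact_linr n x).

Definition vactl n (u : M) x : M := vact n x u.

Lemma vactl_linear n u : linear (vactl n u).
Proof. exact: vact_linl. Qed.

HB.instance Definition _ n u :=
  GRing.isLinear.Build K V M *:%R (vactl n u) (vactl_linear n u).

Lemma vact0l n u : vact n (0 : V) u = 0 :> M.
Proof. exact: (linear0 (vactl n u)). Qed.
Lemma vactDl n x y u : vact n (x + y : V) u = vact n x u + vact n y u :> M.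
Proof. exact: (linearD (vactl n u)). Qed.
Lemma vactZl n c x u : vact n (c *: x : V) u = c *: vact n x u :> M.
Proof. exact: (linearZ_LR (vactl n u)). Qed.
End ModAxioms.

Section Adjoint.
Variables (K : fieldType) (V : vertexSuperalgebra K).

(** A vertex algebra as a module over itself, so that statements about modules
    specialise to it. *)
Definition adjoint : vmodule V :=
  VModule (@nprod_linr K V) (@nprod_linl K V) (@nprod_trunc K V)
    (va_par_grading V) (@nprod_par K V) (@nprod_vacl K V) (@nprod_borcherds K V).

Lemma nprodDl n x y z : nprod n (x + y : V) z = nprod n x z + nprod n y z.
Proof. exact: (vactDl n x y (z : adjoint)). Qed.
Lemma nprodDr n x y z : nprod n (x : V) (y + z) = nprod n x y + nprod n x z.
Proof. exact: (raddfD (vact (v := adjoint) n x)). Qed.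
Lemma nprodZl n c x y : nprod n (c *: x : V) y = c *: nprod n x y.
Proof. exact: (vactZl n c x (y : adjoint)). Qed.
Lemma nprodZr n c x y : nprod n (x : V) (c *: y) = c *: nprod n x y.
Proof. exact: (linearZ_LR (vact (v := adjoint) n x)). Qed.

End Adjoint.

Section Grading.
Variables (K : fieldType) (V : lmodType K) (G : bool -> set V).
Hypothesis hG : is_grading G.

Lemma grading_sub i : is_subspace (G i).
Proof. by case: hG => + _ _; apply. Qed.

Lemma grading_split x : exists x0 x1, [/\ G false x0, G true x1 & x = x0 + x1].
Proof.
have [Gs Gx _] := hG; have [s [y [Gy ->]]] := Gx x.
exists (\sum_(i <- s | i == false) y i), (\sum_(i <- s | i == true) y i); split.
- by apply: subspace_sum => // i /eqP ->.
- by apply: subspace_sum => // i /eqP ->.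
- rewrite (bigID (fun i => i == false)) /=; congr (_ + _).
  by apply: eq_bigl => -[].
Qed.

Lemma grading_disj i x : G i x -> G (~~ i) x -> x = 0.
Proof.
move=> Gi Gni; have [Gs _ Gu] := hG.
pose y j := if j == i then x else - x.
have Gy j : G j (y j).
  rewrite /y; case: eqP => [->//|/eqP ji]; apply: subspaceN => //.
  by have -> : j = ~~ i by clear -ji; case: j i ji => -[].
have u2 : uniq [:: i; ~~ i] by case: (i).
have s0 : \sum_(j <- [:: i; ~~ i]) y j = 0.
  by rewrite big_cons big_seq1 /y eqxx; case: (i); rewrite ?subrr.
by have := Gu _ _ u2 Gy s0 i; rewrite inE eqxx /= /y eqxx; apply.
Qed.

End Grading.

Lemma is_grading_bool (K : fieldType) (V : lmodType K) (G : bool -> set V) :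
  (forall i, is_subspace (G i)) ->
  (forall x, exists x0 x1, [/\ G false x0, G true x1 & x = x0 + x1]) ->
  (forall x, G false x -> G true x -> x = 0) -> is_grading G.
Proof.
move=> Gs Gx G0; split=> //.
  move=> x; have [x0 [x1 [G0x G1x ->]]] := Gx x.
  exists [:: false; true], (fun i => if i then x1 else x0).
  by split; [case | rewrite big_cons big_seq1].
move=> s y us Gy s0.
have y01 : (if false \in s then y false else 0) + (if true \in s then y true else 0) = 0.
  rewrite -[RHS]s0; have -> : \sum_(i <- s) y i = \sum_(i | i \in s) y i.
    by rewrite big_uniq.
  by rewrite big_mkcond big_bool /= addrC.
have P0 i : G i (if i \in s then y i else 0).
  by case: ifP => _ //; apply: subspace0.
have z i : (if i \in s then y i else 0) = 0.
  have y1 : (if true \in s then y true else 0) = 0.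
    apply: G0; last exact: (P0 true).
    have -> : (if true \in s then y true else 0) = - (if false \in s then y false else 0).
      by apply/eqP; rewrite -addr_eq0 addrC y01.
    by apply: subspaceN => //; exact: (P0 false).
  by move: y01; rewrite y1 addr0; case: i.
by move=> i ii; have := z i; rewrite ii.
Qed.

Section Generation.
Variables (K : fieldType) (V : vertexSuperalgebra K) (a : V) (e : bool).
Hypotheses (pa : va_par e a) (ga : va_generated a).

(** The Borcherds identity only speaks of homogeneous vectors: this is the
    induction along the generator for which closure under n-th products need
    only be checked on homogeneous vectors. *)
Lemma va_generated_ind (P : set V) : is_subspace P -> P (vac V) -> P a ->
  (forall i j n x y, va_par i x -> va_par j y -> P x -> P y -> P (nprod n x y)) ->
  forall x, P x.
Proof.
move=> Ps P1 Pa Pn x.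
pose T x := exists x0 x1,
  [/\ va_par false x0, va_par true x1, P x0, P x1 & x = x0 + x1].
have gV := va_par_grading V; have sV := grading_sub gV.
suff TP : forall x, T x -> P x.
  suff Tx : T x by apply: TP.
  apply: (ga (P := T)).
  - apply: subspace_pair.
    + by exists 0, 0; rewrite addr0; split=> //; apply: subspace0.
    + move=> _ _ [x0 [x1 [? ? ? ? ->]]] [y0 [y1 [? ? ? ? ->]]].
      by exists (x0 + y0), (x1 + y1); rewrite addrACA; split=> //; apply: subspaceD.
    + move=> c _ [x0 [x1 [? ? ? ? ->]]]; exists (c *: x0), (c *: x1).
      by rewrite scalerDr; split=> //; apply: subspaceZ.
  - exists (vac V), 0; rewrite addr0; split=> //; try exact: subspace0.
    exact: vac_even.
  - case: e pa => pa'; [exists 0, a | exists a, 0]; rewrite ?addr0 ?add0r.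
      by split=> //; apply: subspace0.
    by split=> //; apply: subspace0.
  - move=> n _ _ [x0 [x1 [hx0 hx1 Px0 Px1 ->]]] [y0 [y1 [hy0 hy1 Py0 Py1 ->]]].
    exists (nprod n x0 y0 + nprod n x1 y1), (nprod n x0 y1 + nprod n x1 y0).
    split.
    + apply: subspaceD => //; first exact: (nprod_par _ hx0 hy0).
      exact: (nprod_par _ hx1 hy1).
    + apply: subspaceD => //; first exact: (nprod_par _ hx0 hy1).
      exact: (nprod_par _ hx1 hy0).
    + by apply: subspaceD => //; apply: Pn; eassumption.
    + by apply: subspaceD => //; apply: Pn; eassumption.
    + rewrite nprodDl !nprodDr.
      by rewrite [RHS]addrACA [X in _ = _ + X]addrC.
by move=> _ [x0 [x1 [_ _ P0 P1' ->]]]; apply: subspaceD.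
Qed.

End Generation.

(** * Relations between the modes of the generator *)
Section Modes.
Variables (K : fieldType) (V : vertexSuperalgebra K) (M : vmodule V).

Lemma big_ord_first (W : zmodType) (N : nat) (G : nat -> W) :
  (0 < N)%N -> (forall h, (0 < h)%N -> G h = 0) -> \sum_(h < N) G h = G 0%N.
Proof.
by case: N => // N _ G0; rewrite big_ord_recl big1 ?addr0 // => h _; apply: G0.
Qed.

Lemma binz0 (j : nat) : (0 < j)%N -> binz 0 j = 0.
Proof. by case: j => // j _; rewrite /binz bin0n. Qed.

Lemma binzn0 (m : int) : binz m 0 = 1.
Proof. by case: m => n; rewrite /binz bin0 ?expr0 ?mul1r. Qed.

(** The Borcherds identity at m = 0: the modes of x(l)y are combinations of
    products of a mode of x and a mode of y. *)
Lemma mode_of_nprod i j x y (l n : int) (u : M) : va_par i x -> va_par j y ->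
  exists N0 : nat, forall N, (N0 <= N)%N ->
  vact n (nprod l x y) u = zwcoef (@vact K V M) l x y 0 n u N
    - zwcoef (@vact K V M) l y x n 0 u N *~ ((-1) ^+ (`|l|%N + (i && j))).
Proof.
move=> xi yj; have [N0 bN] := vact_borcherds xi yj u l 0 n.
exists N0.+1 => N ltN; rewrite -bN ?(ltnW ltN) //.
rewrite (@big_ord_first _ _ (fun h => vact (0 + n - h%:Z) (nprod (l + h%:Z) x y) u *~ binz 0 h)).
- by rewrite binzn0 mulr1z add0r subr0 addr0.
- exact: leq_ltn_trans ltN.
- by move=> h h0; rewrite binz0 // mulr0z.
Qed.

Variables (a : V) (e : bool).
Hypotheses (pa : va_par e a).

Lemma stable_under_modes (P : set M) : va_generated a -> is_subspace P ->
  (forall n u, P u -> P (vact n a u)) -> forall n x u, P u -> P (vact n x u).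
Proof.
move=> ga Ps Pa n x u Pu; move: x n u Pu.
apply: (va_generated_ind pa ga (P := fun x => forall n u, P u -> P (vact n x u))).
- apply: subspace_pair.
  + by move=> n u Pu; rewrite vact0l; apply: subspace0.
  + by move=> x y Px Py n u Pu; rewrite vactDl; apply: subspaceD => //; auto.
  + by move=> c x Px n u Pu; rewrite vactZl; apply: subspaceZ => //; auto.
- move=> n u Pu; rewrite vact_vac; case: ifP => // _; exact: subspace0.
- exact: Pa.
- move=> i j l x y xi yj Px Py n u Pu.
  have [N0 /(_ _ (leqnn _)) ->] := mode_of_nprod l n u xi yj.
  apply: subspaceB => //; last apply: subspaceMz => //.
    by apply: subspace_sum => // h _; apply: subspaceMz => //; auto.
  by apply: subspace_sum => // h _; apply: subspaceMz => //; auto.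
Qed.

(** Skew-commutation is the Borcherds identity at l = 0. *)
Lemma mode_commute (m n : int) (u : M) :
  (forall h : nat, nprod h%:Z a a = 0) ->
  vact m a (vact n a u) = vact n a (vact m a u) *~ ((-1) ^+ e).
Proof.
move=> aa; have [N0 bN] := vact_borcherds pa pa u 0 m n.
have := bN N0.+1 (leqnSn _); rewrite big1 => [|h _]; last first.
  by rewrite add0r aa vact0l mul0rz.
rewrite /zwcoef => /esym/eqP; rewrite subr_eq0.
rewrite (@big_ord_first _ _ (fun j => vact (0 + m - j%:Z) a
          (vact (n + j%:Z) a u) *~ ((-1) ^+ j * binz 0 j))) //; last first.
  by move=> h h0; rewrite binz0 // mulr0 mulr0z.
rewrite (@big_ord_first _ _ (fun j => vact (0 + n - j%:Z) a
          (vact (m + j%:Z) a u) *~ ((-1) ^+ j * binz 0 j))) //; last first.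
  by move=> h h0; rewrite binz0 // mulr0 mulr0z.
by rewrite !add0r !subr0 ?addr0 binzn0 mulr1 !mulr1z andbb => /eqP.
Qed.

(** With l = -p the left-hand side of the Borcherds identity vanishes, which
    makes (z - w)^(-p) Y(a, z) Y(a, w) symmetric on every module. *)
Lemma mode_symmetric (p : nat) (m n : int) (u : M) : e = odd p ->
  (forall h : nat, nprod (- p%:Z + h%:Z) a a = 0) ->
  exists N0 : nat, forall N, (N0 <= N)%N ->
  zwcoef (@vact K V M) (- p%:Z) a a m n u N
  = zwcoef (@vact K V M) (- p%:Z) a a n m u N.
Proof.
move=> ep aa; have [N0 bN] := vact_borcherds pa pa u (- p%:Z) m n.
exists N0 => N /bN; rewrite big1 => [|h _]; last by rewrite aa vact0l mul0rz.
move=> /esym/eqP; rewrite subr_eq0 => /eqP ->.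
have -> : (-1) ^+ (`|- p%:Z|%N + (e && e)) = 1 :> int; last by rewrite mulr1z.
rewrite abszN absz_nat andbb ep -signr_odd oddD.
by case: (odd p).
Qed.

(** The coefficient of the symmetric series above that starts with the top mode:
    if all modes below a(-n0) land in Z, then so does a(-n0) after any
    a(-j) with j > n0 - p. *)
Lemma top_mode_lead (p : nat) (Z : set M) (n0 j : int) (u : M) : e = odd p ->
  (forall h : nat, nprod (- p%:Z + h%:Z) a a = 0) ->
  is_subspace Z -> n0 - p%:Z < j ->
  (forall n i, n0 < i -> Z (vact (- i) a (vact n a u))) ->
  Z (vact (- n0) a (vact (- j) a u)).
Proof.
move=> ep aa Zs jp hZ.
have [N0 bN] := mode_symmetric (p%:Z - n0) (- j) u ep aa.
have := bN N0.+1 (leqnSn _); rewrite /zwcoef big_ord_recl /=.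
rewrite binzn0 mulr1 mulr1z addrA addNr sub0r subr0 addr0 => /(canRL (addrK _)) ->.
apply: subspaceB => //; apply: subspace_sum => // h _; apply: subspaceMz => //.
  have -> : - p%:Z - j - h%:Z = - (p%:Z + j + h%:Z) by lia.
  by apply: hZ; lia.
have -> : - n0 - (bump 0 h)%:Z = - (n0 + (bump 0 h)%:Z) by lia.
by apply: hZ; rewrite /bump; lia.
Qed.

End Modes.

(** Apply the relation to the vacuum, where the modes a(n) with n >= 0 disappear and
    a(-1) returns a. *)
Lemma self_local_square (K : fieldType) (p : nat) (V : vertexSuperalgebra K) (a : V) :
  self_local p a -> forall h : nat, nprod (- p%:Z + h%:Z) a a = 0.
Proof.
move=> sl h; have [N0 bN] := sl (vac V) h%:Z (-1).
have nv (n : nat) x : nprod n%:Z x (vac V) = 0 by exact: nprod_vacr_ge0.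
have n0 n (x : V) : nprod n x 0 = 0 by exact: (linear0 (vact (v := adjoint V) n x)).
have := bN N0.+1 (leqnSn _); rewrite /zwcoef.
rewrite (@big_ord_first _ _ (fun j => nprod (- p%:Z + h%:Z - j%:Z) a
  (nprod (- 1 + j%:Z) a (vac V)) *~ ((-1) ^+ j * binz (- p%:Z) j))) //; last first.
  move=> j j0; have -> : -1 + j%:Z = (j.-1)%:Z by lia.
  by rewrite nv n0 mul0rz.
rewrite binzn0 mulr1 mulr1z subr0 addr0 nprod_vacr => ->.
rewrite big1 // => j _; by rewrite -PoszD nv n0 mul0rz.
Qed.

(** * Modules over F(k, p) as bounded modules over F(p) *)
Section Homs.
Variables (K : fieldType).

Lemma vaHom_vac (V W : vertexSuperalgebra K) (h : vaHom V W) : h (vac V) = vac W.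
Proof. by case: h. Qed.
Lemma vaHom_nprod (V W : vertexSuperalgebra K) (h : vaHom V W) n x y :
  h (nprod n x y) = nprod n (h x) (h y).
Proof. by move: n x y; case: h. Qed.
Lemma vaHom_par (V W : vertexSuperalgebra K) (h : vaHom V W) i x :
  va_par i x -> va_par i (h x).
Proof. by move: i x; case: h. Qed.
Lemma vmodHom_vact (V : vertexSuperalgebra K) (M N : vmodule V) (h : vmodHom M N)
  n x u : h (vact n x u) = vact n x (h u).
Proof. by move: n x u; case: h. Qed.
Lemma vmodHom_par (V : vertexSuperalgebra K) (M N : vmodule V) (h : vmodHom M N) :
  exists s : bool, forall i u, vm_par i u -> vm_par (i (+) s) (h u).
Proof. by case: h. Qed.

Lemma big_ord_single (W : zmodType) (N : nat) (G : nat -> W) (j : nat) :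
  (j < N)%N -> (forall h, h != j -> G h = 0) -> \sum_(h < N) G h = G j.
Proof.
move=> jN G0; rewrite (bigD1 (Ordinal jN)) //= big1 ?addr0 // => h hj.
exact: G0.
Qed.

End Homs.

Section FreeModules.
Variables (K : fieldType) (p : nat) (F : freeVA K p).
Hypothesis char0 : forall n : nat, n.+1%:R != 0 :> K.

Local Notation a := (fgen F).

Lemma fgen_admissible : admissible p a.
Proof. by case: F. Qed.
Lemma fgen_par : va_par (odd p) a.
Proof. by case: fgen_admissible. Qed.
Lemma fgen_gen : va_generated a.
Proof. by case: fgen_admissible. Qed.
Lemma fgen_square (h : nat) : nprod (- p%:Z + h%:Z) a a = 0.
Proof. by apply: self_local_square; case: fgen_admissible. Qed.
Lemma fgen_square_ge0 (h : nat) : nprod h%:Z a a = 0.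
Proof. by have := fgen_square (p + h); rewrite PoszD addKr. Qed.

Lemma amode_commute (N : vmodule F) m n (u : N) :
  vact m a (vact n a u) = vact n a (vact m a u) *~ ((-1) ^+ odd p).
Proof. exact: (mode_commute fgen_par m n u fgen_square_ge0). Qed.

Lemma amode_stable (N : vmodule F) (P : set N) : is_subspace P ->
  (forall n u, P u -> P (vact n a u)) -> forall n x u, P u -> P (vact n x u).
Proof. exact: (stable_under_modes fgen_par fgen_gen). Qed.

Lemma amode_lead (N : vmodule F) (Z : set N) (n0 j : int) (u : N) :
  is_subspace Z -> n0 - p%:Z < j ->
  (forall n i, n0 < i -> Z (vact (- i) a (vact n a u))) ->
  Z (vact (- n0) a (vact (- j) a u)).
Proof. exact: (top_mode_lead fgen_par erefl fgen_square). Qed.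

(** On a bounded module Y(a, z) is a polynomial in z of degree at most k - 2. *)
Definition bounded (k : int) (N : vmodule F) : Prop :=
  forall (n : nat) (u : N), vact (- k - n%:Z) a u = 0 /\ vact n%:Z a u = 0.

Section Quotients.
Variable k : int.

Lemma quot_surj (Q : quotVA F k) (y : Q) : exists x : F, qproj Q x = y.
Proof. by move: y; case: Q. Qed.
Lemma quot_ker (Q : quotVA F k) (x : F) : qproj Q x = 0 <->
  lspan [set y : F | exists (n : nat) (z : F), y = nprod (- k - n%:Z) a z]%classic x.
Proof. by move: x; case: Q. Qed.

Lemma int_scale_eq0 (W : lmodType K) (u : W) (n : nat) : u *+ n.+1 = 0 -> u = 0.
Proof.
move/eqP; rewrite -scaler_nat scaler_eq0 (negPf (char0 n)) /=.
by move/eqP.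
Qed.

(** The vector a(-k)1 = T^(k-1)a/(k-1)! vanishes in F(k, p), so on a module the
    (k-1)-st derivative of Y(a, z) does: the coefficients of the negative powers
    of z and those of z^(k-1), z^k, ... are multiplied by nonzero integers. *)
Lemma pullback_bounded (Q : quotVA F k) (N : vmodule Q) :
  bounded k (pullback (qproj Q) N).
Proof.
set M := pullback _ N.
(* k1 + 1 = max(k, 1): for k <= 0 the kernel contains a(-1)1 = a. *)
pose k1 := absz (Num.max (k - 1) 0).
have kk : k <= k1.+1%:Z by rewrite /k1; lia.
pose y : F := nprod (Negz k1) a (vac F).
have y0 : qproj Q y = 0.
  apply/quot_ker; apply: lspan_in => /=.
  exists (absz (k1.+1%:Z - k)); exists (vac F).
  by rewrite /y; congr nprod; lia.
have My n (u : M) : vact n y u = 0.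
  by rewrite /M /pullback /= y0 vact0l.
have Mvac n (u : M) : n != -1 -> vact n (vac F) u = 0.
  by rewrite vact_vac => /negPf ->.
have C j : (-1) ^+ j * binz (Negz k1) j = 'C(k1 + j, j)%:Z.
  by rewrite /binz mulrA -exprD addnn -signr_odd odd_double expr0 mul1r.
have Cnz j : exists c : nat, 'C(k1 + j, j) = c.+1.
  by exists 'C(k1 + j, j).-1; rewrite prednK // bin_gt0 leq_addl.
have neg (j : nat) (u : M) : vact (Negz k1 - j%:Z) a u = 0.
  have [N0 /(_ (N0 + j).+1 (leqW (leq_addr _ _)))] :=
    mode_of_nprod (Negz k1) (- 1 - j%:Z) u fgen_par (vac_even F).
  rewrite My /zwcoef [X in _ - X *~ _]big1 => [|h _]; last first.
    by rewrite Mvac ?mul0rz //; lia.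
  rewrite mul0rz subr0.
  rewrite (@big_ord_single _ _ (fun h => vact (Negz k1 + 0 - h%:Z) a
    (vact (- 1 - j%:Z + h%:Z) (vac F) u) *~ ((-1) ^+ h * binz (Negz k1) h)) j);
    first last.
  - by move=> h hj; rewrite Mvac ?raddf0 ?mul0rz //; lia.
  - by rewrite ltnS leq_addl.
  rewrite C addr0 subrK vact_vac eqxx; have [c ->] := Cnz j.
  by rewrite -pmulrn => /esym/int_scale_eq0.
have pos (j : nat) (u : M) : vact j%:Z a u = 0.
  have [N0 /(_ (N0 + j).+1 (leqW (leq_addr _ _)))] :=
    mode_of_nprod (Negz k1) (j%:Z + k1%:Z) u fgen_par (vac_even F).
  rewrite My /zwcoef [X in X - _]big1 => [|h _]; last first.
    by rewrite Mvac ?raddf0 ?mul0rz //; lia.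
  rewrite (@big_ord_single _ _ (fun h => vact (Negz k1 + (j%:Z + k1%:Z) - h%:Z) (vac F)
    (vact (0 + h%:Z) a u) *~ ((-1) ^+ h * binz (Negz k1) h)) j);
    first last.
  - by move=> h hj; rewrite Mvac ?raddf0 ?mul0rz //; lia.
  - by rewrite ltnS leq_addl.
  have -> : Negz k1 + (j%:Z + k1%:Z) - j%:Z = -1 by lia.
  rewrite C add0r vact_vac eqxx; have [c ->] := Cnz j.
  move=> /esym/eqP; rewrite ?sub0r oppr_eq0 -signr_odd.
  case: (odd _); rewrite ?expr1 ?expr0 ?mulrN1z ?mulr1z ?oppr_eq0 -pmulrn;
  by move=> /eqP/int_scale_eq0.
move=> n u; split; last exact: pos.
case: (lerP 0 (- k - n%:Z)) => kn; first by rewrite -(gez0_abs kn).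
have -> : - k - n%:Z = Negz k1 - (absz (Negz k1 - (- k - n%:Z) : int))%:Z by rewrite /k1; lia.
exact: neg.
Qed.

(** By the Borcherds identity a mode of a(-k-q)z is a combination of products
    containing some a(-k-n) or some a(n) with n >= 0. *)
Lemma bounded_ker (Q : quotVA F k) (N : vmodule F) : bounded k N ->
  forall x, qproj Q x = 0 -> forall n (u : N), vact n x u = 0.
Proof.
move=> bN x /quot_ker.
apply: (lspan_min (P := fun x => forall n (u : N), vact n x u = 0)).
  apply: subspace_pair => [n u|y z y0 z0 n u|c y y0 n u]; first exact: vact0l.
    by rewrite vactDl y0 z0 addr0.
  by rewrite vactZl y0 scaler0.
move=> _ [q [z ->]] n u.
have hom i z' : va_par i z' -> vact n (nprod (- k - q%:Z) a z') u = 0.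
  move=> pz; have [N0 /(_ _ (leqnn _)) ->] := mode_of_nprod (- k - q%:Z) n u fgen_par pz.
  rewrite /zwcoef !big1 ?mul0rz ?subr0 // => h _.
    by rewrite add0r (bN _ _).2 raddf0 mul0rz.
  have -> : - k - q%:Z - (h : nat)%:Z = - k - (q + h)%:Z by lia.
  by rewrite (bN _ _).1 mul0rz.
have [z0 [z1 [p0 p1 ->]]] := grading_split (va_par_grading F) z.
by rewrite nprodDr vactDl !(hom _ _ p0, hom _ _ p1) addr0.
Qed.

End Quotients.

(** Restriction of scalars along F(p) -> F(k, p) has an inverse on the modules
    on which the kernel acts by zero. *)
Section Descent.
Variables (k : int) (Q : quotVA F k) (N : vmodule F).
Hypothesis hN : forall x, qproj Q x = 0 -> forall n (u : N), vact n x u = 0.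

Definition qlift (y : Q) : F := sval (cid (quot_surj y)).

Lemma qliftK y : qproj Q (qlift y) = y.
Proof. by rewrite /qlift; case: cid. Qed.

Definition dact n (y : Q) (u : N) : N := vact n (qlift y) u.

Lemma dact_proj n y x u : qproj Q x = y -> dact n y u = vact n x u.
Proof.
move=> xy; apply/eqP; rewrite -subr_eq0; apply/eqP.
rewrite -[LHS](_ : vact n (qlift y - x) u = _).
  by apply: hN; rewrite linearB /= qliftK xy subrr.
exact: (linearB (vactl n u)).
Qed.

(** The component of the wrong parity of a lift of a homogeneous vector projects
    to 0. *)
Lemma qproj_par i y : va_par i y -> exists2 x, va_par i x & qproj Q x = y.
Proof.
move=> yi; have [x xy] := quot_surj y.
have [x0 [x1 [p0 p1 xE]]] := grading_split (va_par_grading F) x.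
have gQ := va_par_grading Q; have sQ j := grading_sub gQ j.
have {}xy : y = qproj Q x0 + qproj Q x1 by rewrite -xy xE linearD.
case: i yi => yi; [exists x1 => //| exists x0 => //]; apply/esym/eqP; rewrite -subr_eq0.
  have d : y - qproj Q x1 = qproj Q x0 by rewrite xy addrK.
  apply/eqP; apply: (grading_disj gQ (i := true)); last by rewrite d; exact: vaHom_par.
  by apply: subspaceB => //; exact: vaHom_par.
have d : y - qproj Q x0 = qproj Q x1 by rewrite xy addrC addKr.
apply/eqP; apply: (grading_disj gQ (i := false)); last by rewrite d; exact: vaHom_par.
by apply: subspaceB => //; exact: vaHom_par.
Qed.

Fact dact_linr n y : linear (dact n y).
Proof. exact: vact_linr. Qed.
Fact dact_linl n u : linear (fun y => dact n y u).
Proof.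
move=> c y z; rewrite (@dact_proj _ _ (c *: qlift y + qlift z)).
  by rewrite vactDl vactZl.
by rewrite linearP /= !qliftK.
Qed.
Fact dact_trunc y u : exists n0 : int, forall n, (n0 <= n)%R -> dact n y u = 0.
Proof. exact: vact_trunc. Qed.
Fact dact_par i j n y u : va_par i y -> vm_par j u -> vm_par (i (+) j) (dact n y u).
Proof.
by move=> /qproj_par[x xi xy] uj; rewrite (dact_proj _ _ xy); apply: vact_par.
Qed.
Fact dact_vac n u : dact n (vac Q) u = if n == -1 then u else 0.
Proof. by rewrite (dact_proj _ _ (vaHom_vac (qproj Q))) vact_vac. Qed.
Fact dact_borcherds : borcherds dact (@nprod K Q) (@va_par K Q).
Proof.
move=> i j _ _ /qproj_par[x xi <-] /qproj_par[y yj <-] u l m n.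
have [N0 bN] := vact_borcherds xi yj u l m n; exists N0 => n' /bN.
have E q z w : dact q (qproj Q z) w = vact q z w by exact: dact_proj.
rewrite /zwcoef => bE.
under eq_bigr => h _ do rewrite -vaHom_nprod E.
rewrite bE; congr (_ - _ *~ _).
  by apply: eq_bigr => h _; rewrite !E.
by apply: eq_bigr => h _; rewrite !E.
Qed.

Definition descent : vmodule Q :=
  VModule dact_linr dact_linl dact_trunc (vm_par_grading N) dact_par dact_vac
    dact_borcherds.

End Descent.

Section Universal.
Variables (k m : int) (M : freeRep F k m).

Lemma fr_bounded : bounded k (fr_res M).
Proof. exact: pullback_bounded. Qed.

Lemma fr_hom : vm_homogeneous (fr_vec M).
Proof. by rewrite /fr_vec; case: M. Qed.

Lemma fr_ann (n : nat) : vact (- m + n%:Z) a (fr_vec M) = 0.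
Proof. by move: n; rewrite /fr_vec; case: M. Qed.

Lemma fr_generated (P : set (fr_res M)) : is_subspace P -> P (fr_vec M) ->
  (forall n u, P u -> P (vact n a u)) -> forall u, P u.
Proof.
move=> Ps Pv Pa.
have gM : vm_generated (fr_gen M) by case: M.
apply: gM => // n y u Pu; have [x <-] := quot_surj y.
exact: (amode_stable (N := fr_res M) Ps Pa n x Pu).
Qed.

(** The universal property of M_k(m), in terms of bounded F(p)-modules. *)
Lemma fr_universal (N : vmodule F) (w : N) : bounded k N -> vm_homogeneous w ->
  (forall n : nat, vact (- m + n%:Z) a w = 0) ->
  exists h : vmodHom (fr_res M) N, h (fr_vec M) = w.
Proof.
move=> bN hw aw; have kN := bounded_ker bN (Q := fr_alg M).
have [h [hw' _]] : exists h : vmodHom (fr_mod M) (descent kN), h (fr_gen M) = w /\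
    forall h' : vmodHom (fr_mod M) (descent kN), h' (fr_gen M) = w -> h' =1 h.
  have U : forall (N : vmodule (fr_alg M)) (w : N), vm_homogeneous w ->
      (forall n : nat, vact (- m + n%:Z) (qproj (fr_alg M) a) w = 0) ->
      exists h : vmodHom (fr_mod M) N, h (fr_gen M) = w /\
      forall h' : vmodHom (fr_mod M) N, h' (fr_gen M) = w -> h' =1 h.
    by case: M.
  apply: U => // n; rewrite /descent /=; exact: etrans (dact_proj kN _ _ erefl) (aw n).
have hact n x (u : fr_res M) : (h : {linear _ -> _}) (vact n x u) = vact n x (h u : N).
  exact: etrans (vmodHom_vact h n (qproj (fr_alg M) x) u) (dact_proj kN _ _ erefl).
exists (@VmodHom _ _ (fr_res M) N (h : {linear _ -> _}) hact (vmodHom_par h)).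
exact: hw'.
Qed.

Lemma fr_hom_unique (N : vmodule F) (h h' : vmodHom (fr_res M) N) :
  h (fr_vec M) = h' (fr_vec M) -> h =1 h'.
Proof.
move=> hh; apply: (fr_generated (P := fun u => h u = h' u)) => //.
  apply: subspace_pair => [|u w uE wE|c u uE]; first by rewrite !linear0.
    by rewrite !linearD uE wE.
  by rewrite !linearZ uE.
by move=> n u uE; rewrite !vmodHom_vact uE.
Qed.

End Universal.
End FreeModules.

(** * Submodules *)
Section Submodule.
Variables (K : fieldType) (V : vertexSuperalgebra K) (M : vmodule V).
Variables (P : set M) (hP : is_subspace P).
Hypothesis stableP : forall n x u, P u -> P (vact n x u).
Hypothesis gradedP : forall u, P u -> exists u0 u1,
  [/\ vm_par false u0, vm_par true u1, P u0, P u1 & u = u0 + u1].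

Definition subact n (x : V) (u : subsp hP) : subsp hP :=
  subin hP (stableP n x (subval_in u)).
Definition subpar i (u : subsp hP) := vm_par i (subval u).

Fact subact_linr n x : linear (subact n x).
Proof. by move=> c u w; apply: subval_inj; exact: vact_linr. Qed.
Fact subact_linl n u : linear (fun x => subact n x u).
Proof. by move=> c x y; apply: subval_inj; exact: vact_linl. Qed.
Fact subact_trunc x u : exists N : int, forall n, (N <= n)%R -> subact n x u = 0.
Proof.
have [N hN] := vact_trunc x (subval u); exists N => n /hN h.
exact: subval_inj.
Qed.
Fact subpar_grading : is_grading subpar.
Proof.
have gM := vm_par_grading M; have sM i := grading_sub gM i.
apply: is_grading_bool => [i|u|u u0 u1].
- apply: subspace_pair; rewrite /subpar; first exact: subspace0.
    by move=> x y; apply: subspaceD.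
  by move=> c x; apply: subspaceZ.
- have [u0 [u1 [p0 p1 P0 P1 E]]] := gradedP (subval_in u).
  by exists (subin hP P0), (subin hP P1); split=> //; apply: subval_inj.
- by apply: subval_inj; apply: (grading_disj gM (i := false)).
Qed.
Fact subact_par i j n x u : va_par i x -> subpar j u -> subpar (i (+) j) (subact n x u).
Proof. exact: vact_par. Qed.
Fact subact_vac n u : subact n (vac V) u = if n == -1 then u else 0.
Proof. by apply: subval_inj; rewrite /= vact_vac; case: ifP. Qed.
Fact subval_zwcoef l x y m n u N :
  subval (zwcoef subact l x y m n u N) = zwcoef (@vact K V M) l x y m n (subval u) N.
Proof.
by rewrite /zwcoef raddf_sum; apply: eq_bigr => j _; rewrite raddfMz.
Qed.
Fact subact_borcherds : borcherds subact (@nprod K V) (@va_par K V).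
Proof.
move=> i j x y xi yj u l m n.
have [N0 bN] := vact_borcherds xi yj (subval u) l m n; exists N0 => N /bN E.
apply: subval_inj; rewrite raddfB raddfMz /= !subval_zwcoef -E raddf_sum.
by apply: eq_bigr => h _; rewrite raddfMz.
Qed.

Definition submodule : vmodule V :=
  VModule subact_linr subact_linl subact_trunc subpar_grading subact_par
    subact_vac subact_borcherds.

End Submodule.

(** * Standard monomials span *)
Section Spanning.
Variables (K : fieldType) (p : nat) (F : freeVA K p).
Hypothesis p_gt0 : (0 < p)%N.

Local Notation a := (fgen F).

(** Words in the coefficients of Y(a, z): the letter i stands for a(-i-1), the
    coefficient of z^i. *)
Definition word (N : vmodule F) (s : seq nat) (u : N) : N :=
  foldr (fun i w => vact (Negz i) a w) u s.

Lemma word_linear (N : vmodule F) s : linear (@word N s).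
Proof. by elim: s => [|i s IH] c u w //=; rewrite IH linearP. Qed.

HB.instance Definition _ (N : vmodule F) s :=
  GRing.isLinear.Build K N N *:%R (@word N s) (@word_linear N s).

Lemma word_commute (N : vmodule F) s m (u : N) :
  word s (vact m a u) = vact m a (word s u) *~ ((-1) ^+ (odd p * size s)).
Proof.
elim: s => [|i s IH] /=; first by rewrite muln0 mulr1z.
rewrite IH raddfMz /= amode_commute mulnS exprD.
by rewrite -mulrzA.
Qed.

Lemma commute_word (N : vmodule F) s m (u : N) :
  vact m a (word s u) = word s (vact m a u) *~ ((-1) ^+ (odd p * size s)).
Proof.
by rewrite word_commute -mulrzA -exprD addnn -signr_odd odd_double mulr1z.
Qed.

Lemma word_stable (N : vmodule F) (Z : set N) s u :
  (forall n u, Z u -> Z (vact n a u)) -> Z u -> Z (word s u).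
Proof. by move=> Zs Zu; elim: s => //= i s; apply: Zs. Qed.

(** The exponents, in decreasing order, of the leading monomials of the products of
    all (z_i - z_j)^p with a symmetric polynomial. *)
Definition standard (mu n : nat) (s : seq nat) : bool :=
  sorted (fun x y => y + p <= x)%N s && all (fun i => mu <= i < n)%N s.

Lemma standard_cons mu n s : (mu <= n)%N -> standard mu (n.+1 - p) s ->
  standard mu n.+1 (n :: s).
Proof.
move=> mun /andP[ss sa]; apply/andP; split; last first.
  rewrite /= mun ltnSn; apply: sub_all sa => i /andP[-> /=]; lia.
by case: s ss sa => //= x s -> /andP[/andP[_ xn] _]; rewrite andbT; lia.
Qed.

Lemma standard_widen mu n n' s : (n <= n')%N -> standard mu n s -> standard mu n' s.
Proof.
move=> nn' /andP[ss sa]; rewrite /standard ss; apply: sub_all sa => i /andP[-> /=] /leq_trans; exact.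
Qed.

Definition standard_span (N : vmodule F) mu n (v : N) : set N :=
  lspan [set w | exists2 t, standard mu n t & w = word t v]%classic.

Definition word_span (N : vmodule F) (v : N) : set N :=
  lspan [set w | exists s, w = word s v]%classic.

Definition sum_set (V : lmodType K) (P Q : set V) : set V :=
  [set x | exists y z, [/\ P y, Q z & x = y + z]]%classic.

Lemma sum_set_subspace (V : lmodType K) (P Q : set V) :
  is_subspace P -> is_subspace Q -> is_subspace (sum_set P Q).
Proof.
move=> Ps Qs; apply: subspace_pair.
- by exists 0, 0; rewrite addr0; split=> //; apply: subspace0.
- move=> _ _ [y [z [Py Qz ->]]] [y' [z' [Py' Qz' ->]]].
  by exists (y + y'), (z + z'); rewrite addrACA; split=> //; apply: subspaceD.
- move=> c _ [y [z [Py Qz ->]]]; exists (c *: y), (c *: z).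
  by rewrite scalerDr; split=> //; apply: subspaceZ.
Qed.

Lemma sum_setl (V : lmodType K) (P Q : set V) x : is_subspace Q -> P x -> sum_set P Q x.
Proof. by move=> Qs Px; exists x, 0; rewrite addr0; split=> //; apply: subspace0. Qed.

Lemma sum_setr (V : lmodType K) (P Q : set V) x : is_subspace P -> Q x -> sum_set P Q x.
Proof. by move=> Ps Qx; exists 0, x; rewrite add0r; split=> //; apply: subspace0. Qed.

(** If the largest letter is n, work first modulo the words containing the letter n;
    on those, the leading relation kills every letter > n - p, so they are handled
    by the case n + 1 - p of the same statement, with A_n v as generator.  The
    subspace Z stands for the submodule by which one divides. *)
Lemma word_standard (N : vmodule F) (mu n : nat) (v : N) (Z : set N) :
  (forall (j : nat) (u : N), vact j%:Z a u = 0) ->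
  is_subspace Z -> (forall n u, Z u -> Z (vact n a u)) ->
  (forall j s, (n <= j)%N -> Z (vact (Negz j) a (word s v))) ->
  (forall j, (j < mu)%N -> Z (vact (Negz j) a v)) ->
  forall s, sum_set (standard_span mu n v) Z (word s v).
Proof.
move=> pos; elim/ltn_ind: n v Z => -[_|n IH] v Z Zs Zst top low s.
  case: s => [|i s]; last first.
    by apply: sum_setr; [exact: lspan_subspace | exact: top].
  by apply: sum_setl => //; apply: lspan_in; exists [::].
have As : is_subspace (word_span v) by exact: lspan_subspace.
have Ss : is_subspace (standard_span mu n.+1 v) by exact: lspan_subspace.
pose AnA : set N := [set x | exists2 u, word_span v u & x = vact (Negz n) a u]%classic.
have AnAs : is_subspace AnA.
  apply: subspace_pair; first by exists 0; [exact: subspace0 | rewrite linear0].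
    by move=> _ _ [u Au ->] [w Aw ->]; exists (u + w); rewrite ?linearD //; exact: subspaceD.
  by move=> c _ [u Au ->]; exists (c *: u); rewrite ?linearZ //; exact: subspaceZ.
have Ast m u : word_span v u -> word_span v (vact m a u).
  move: u; apply: lspan_min.
    apply: subspace_pair; first by rewrite linear0; exact: subspace0.
      by move=> x y ? ?; rewrite linearD; exact: subspaceD.
    by move=> c x ?; rewrite linearZ; exact: subspaceZ.
  move=> _ [t ->]; case: m => m; first by rewrite pos; exact: subspace0.
  by apply: lspan_in; exists (m :: t).
have letter_n u : word_span v u ->
    sum_set (standard_span mu n.+1 v) Z (vact (Negz n) a u).
  have SZs := sum_set_subspace Ss Zs.
  move: u; apply: lspan_min.
    apply: subspace_pair; first by rewrite linear0; exact: subspace0.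
      by move=> x y ? ?; rewrite linearD; exact: subspaceD.
    by move=> c x ?; rewrite linearZ; exact: subspaceZ.
  move=> _ [t ->].
  case: (ltnP n mu) => nmu.
    apply: sum_setr => //; rewrite commute_word; apply: subspaceMz => //.
    by apply: word_stable => //; apply: low.
  rewrite commute_word; apply: subspaceMz => //.
  have step : sum_set (standard_span mu (n.+1 - p) (vact (Negz n) a v)) Z
      (word t (vact (Negz n) a v)).
    apply: IH => //; first by lia.
      move=> j r pj; rewrite commute_word; apply: subspaceMz => //.
      apply: word_stable => //.
      rewrite amode_commute; apply: subspaceMz => //.
      apply: (amode_lead (n0 := n.+1%:Z) (j := j.+1%:Z)) => //; first by lia.
      move=> [q|q] i ni; first by rewrite pos linear0; exact: subspace0.
      have -> : - i = Negz (absz i).-1 by lia.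
      by apply: (top _ [:: q]); lia.
    move=> j jmu; rewrite amode_commute; apply: subspaceMz => //.
    by apply: Zst; apply: low.
  have [y [z [Sy Zz ->]]] := step.
  apply: subspaceD => //; last exact: sum_setr.
  apply: sum_setl => //; move: y Sy; apply: lspan_min => // _ [r rs ->].
  rewrite word_commute; apply: subspaceMz => //; apply: lspan_in.
  by exists (n :: r); first exact: standard_cons.
have [] : sum_set (standard_span mu n v) (sum_set AnA Z) (word s v).
  apply: IH => //; first exact: sum_set_subspace.
  - move=> m _ [_ [z [[u Au ->] Zz ->]]]; rewrite linearD.
    exists (vact m a (vact (Negz n) a u)), (vact m a z); split=> //; last exact: Zst.
    rewrite amode_commute; exists (vact m a u *~ ((-1) ^+ odd p)); last by rewrite raddfMz.
    by apply: subspaceMz => //; apply: Ast.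
  - move=> j t; rewrite leq_eqVlt => /orP[/eqP <-|nj]; last first.
      by apply: sum_setr => //; exact: top.
    by apply: sum_setl => //; exists (word t v) => //; apply: lspan_in; exists t.
  - by move=> j jmu; apply: sum_setr => //; exact: low.
move=> y [_ [Sy [_ [z [[u Au ->] Zz ->]]] ->]].
apply: subspaceD; first exact: sum_set_subspace.
  apply: sum_setl => //; move: y Sy; apply: lspan_min => // _ [r rs ->].
  by apply: lspan_in; exists r => //; apply: standard_widen rs.
apply: subspaceD; [exact: sum_set_subspace | exact: letter_n | exact: sum_setr].
Qed.

End Spanning.

(** * The Borcherds identity for supercommuting regular fields *)
Section Binomials.

Lemma binz_pascal (m : int) (j : nat) : binz (m + 1) j.+1 = binz m j.+1 + binz m j.
Proof.
case: m => [n|[|n]].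
- by rewrite -[Posz n + 1]/(Posz (n + 1)) addn1 /binz binS PoszD.
- rewrite -[Negz 0 + 1]/(Posz 0) /binz !add0n bin0n !binn /= !mulr1 exprS mulN1r.
  by rewrite addNr.
- have -> : Negz n.+1 + 1 = Negz n by lia.
  have E : 'C(n.+1 + j.+1, j.+1) = ('C(n + j.+1, j.+1) + 'C(n.+1 + j, j))%N.
    by rewrite addnS binS addSnnS.
  by rewrite /binz E PoszD exprS; ring.
Qed.

Lemma binz_vandermonde (m : int) (s L : nat) :
  \sum_(h < L.+1) binz m h * 'C(s, L - h)%:Z = binz (m + s%:Z) L.
Proof.
elim: s L => [|s IH] L.
  rewrite addr0 big_ord_recr /= subnn bin0 mulr1 big1 ?add0r // => h _.
  by rewrite bin0n subn_eq0 leqNgt ltn_ord mulr0.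
case: L => [|L]; first by rewrite big_ord1 /= bin0 !binzn0.
have -> : m + s.+1%:Z = m + s%:Z + 1 by lia.
rewrite binz_pascal -!IH big_ord_recr [in RHS]big_ord_recr /= subnn !bin0 addrAC.
congr (_ + _); rewrite -big_split; apply: eq_bigr => h _ /=.
have hL : (h <= L)%N by rewrite -ltnS.
by rewrite subSn // binS PoszD mulrDr.
Qed.

(** The factor by which x(-s-1) enters the modes of the z-th product of x with y: for
    z = -q-1 that product is the q-th divided derivative of x times y, and for
    z >= 0 it vanishes. *)
Definition binmode (z : int) (s : nat) : int :=
  match z with Posz _ => 0 | Negz q => 'C(s, q)%:Z end.

Lemma pick_sum (c : nat -> int) (f : nat -> bool) (z : int) (N : nat) :
  (forall j, f j = (j%:Z == z)) -> z < N%:Z ->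
  \sum_(j < N) (f j)%:Z * c j = match z with Posz j => c j | Negz _ => 0 end.
Proof.
move=> fE zN; case: z fE zN => j fE zN; last first.
  by rewrite big1 // => h _; rewrite fE mul0r.
rewrite (@big_ord_single _ _ (fun h => (f h)%:Z * c h) j) //.
  by rewrite fE eqxx mul1r.
by move=> h /negPf hj; rewrite fE eqz_nat hj mul0r.
Qed.

Lemma borcherds_coef (l m n : int) (d s N : nat) :
  l + m + n = - (d.+2)%:Z -> (s <= d)%N -> ((`|l| + `|m| + `|n|).*2 + 10 <= N)%N ->
  \sum_(h < N) binz m h * binmode (l + h%:Z) s =
  \sum_(j < N) (l + m - j%:Z == Negz s)%:Z * ((-1) ^+ j * binz l j)
  - (\sum_(j < N) (m + j%:Z == Negz s)%:Z * ((-1) ^+ j * binz l j)) * (-1) ^+ `|l|%N.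
Proof.
move=> lmn sd hN.
have sgn j : (-1) ^+ j * (-1) ^+ j = 1 :> int.
  by rewrite -exprD addnn -signr_odd odd_double.
rewrite (@pick_sum (fun j => (-1) ^+ j * binz l j) (fun j => l + m - j%:Z == Negz s) (l + m + s.+1%:Z)); last by lia.
  2: by move=> j; lia.
rewrite (@pick_sum (fun j => (-1) ^+ j * binz l j) (fun j => m + j%:Z == Negz s) (- m - s.+1%:Z)); last by lia.
  2: by move=> j; lia.
case: l lmn hN => L lmn hN.
  rewrite big1 => [|h _]; last by rewrite -PoszD mulr0.
  case E1 : (Posz L + m + s.+1%:Z) => [j1|j1]; case E2 : (- m - s.+1%:Z) => [j2|j2].
  - have E : L = (j1 + j2)%N by lia.
    have C : 'C(j1 + j2, j2) = 'C(j1 + j2, j1).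
      by rewrite -bin_sub ?leq_addl // addnK.
    rewrite /binz absz_nat E C exprD -[LHS](subrr ((-1) ^+ j1 * 'C(j1 + j2, j1)%:Z)).
    congr (_ - _); rewrite mulrAC [X in _ = X * _]mulrCA sgn mulr1.
    by rewrite mulrC.
  - by rewrite mul0r subr0 /binz bin_small ?mulr0 //; lia.
  - by rewrite /binz bin_small ?mulr0 ?mul0r ?subr0 //; lia.
  - by rewrite mul0r subr0.
have -> : \sum_(h < N) binz m h * binmode (Negz L + h%:Z) s =
    \sum_(h < L.+1) binz m h * 'C(s, L - h)%:Z.
  rewrite (big_ord_widen N (fun h => binz m h * 'C(s, L - h)%:Z)); last by lia.
  rewrite [RHS]big_mkcond; apply: eq_bigr => h _; case: ltnP => hL.
    by have -> : Negz L + h%:Z = Negz (L - h) by lia.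
  have -> : Negz L + h%:Z = Posz (h - L.+1) by lia.
  by rewrite mulr0.
rewrite binz_vandermonde.
have absL : `|Negz L|%N = L.+1 by [].
rewrite absL.
case E : (m + s%:Z) => [M|M].
  have -> : - m - s.+1%:Z = Negz M by lia.
  rewrite mul0r subr0.
  case: (leqP L M) => LM.
    have -> : Negz L + m + s.+1%:Z = Posz (M - L) by lia.
    rewrite /binz mulrA sgn mul1r subnKC //. by rewrite bin_sub.
  have -> : Negz L + m + s.+1%:Z = Negz (L - M.+1) by lia.
  by rewrite /binz bin_small.
have -> : - m - s.+1%:Z = Posz M by lia.
have -> : Negz L + m + s.+1%:Z = Negz (L + M) by lia.
rewrite sub0r /binz mulrA sgn mul1r exprS mulN1r mulrN opprK mulrC.
by rewrite -[in RHS]bin_sub ?leq_addl // addnK addnC.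
Qed.

End Binomials.

Section RegularBorcherds.
Variables (K : fieldType) (V M : lmodType K) (np : int -> V -> V -> V).
Variables (par : bool -> set V) (act : int -> V -> M -> M).
Hypothesis act_lin : forall n x, linear (act n x).
Hypothesis act_0l : forall n u, act n 0 u = 0.
Hypothesis act_pos : forall (n : nat) x u, act n%:Z x u = 0.
Hypothesis np_pos : forall (n : nat) x y, np n%:Z x y = 0.
Hypothesis act_np : forall (q e : nat) x y u, act (Negz e) (np (Negz q) x y) u =
  \sum_(i < e.+1) act (Negz (i + q)) x (act (Negz (e - i)) y u) *+ 'C(i + q, q).
Hypothesis act_comm : forall i j x y s t u, par i x -> par j y ->
  act (Negz s) x (act (Negz t) y u) =
  act (Negz t) y (act (Negz s) x u) *~ (-1) ^+ (i && j).

Let act0 n x : act n x 0 = 0.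
Proof.
have h := act_lin n x; exact: (linear0 (HB.pack (act n x) (GRing.isLinear.Build _ _ _ _ _ h) : {linear M -> M})).
Qed.

Let g x y u (s t : nat) := act (Negz s) x (act (Negz t) y u).

Let g_expand x y u (i j : int) (d : nat) : i + j = - (d.+2)%:Z ->
  act i x (act j y u) = \sum_(s < d.+1) g x y u s (d - s) *~ (i == Negz s)%:Z.
Proof.
move=> ijd; case: i ijd => i ijd.
  by rewrite act_pos big1.
case: (leqP i d) => id.
  rewrite (@big_ord_single _ _ (fun s => g x y u s (d - s) *~ (Negz i == Negz s)%:Z) i) //.
    by rewrite eqxx mulr1z; have -> : j = Negz (d - i) by lia.
  by move=> h hi; have -> : (Negz i == Negz h) = false by lia.
rewrite big1 => [|h _]; last by have -> : (Negz i == Negz h) = false by move: (ltn_ord h); lia.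
have -> : j = Posz (i - d.+1) by lia.
by rewrite act_pos act0.
Qed.

(** For regular supercommuting fields, both sides of the Borcherds identity
    are combinations of the products x_s y_t with s + t fixed, and the identity is
    the Chu-Vandermonde formula for each coefficient. *)
Lemma regular_borcherds : borcherds act np par.
Proof.
(* The bound only has to exceed every index at which a term can be nonzero. *)
move=> i j x y xi yj u l m n; exists ((`|l| + `|m| + `|n|).*2 + 10)%N => N hN.
case: (lerP (- 1) (l + m + n)) => lmn.
  rewrite /zwcoef !big1 ?mul0rz ?subr0 // => h _.
  - case E : (l + n - h%:Z) => [q|q]; first by rewrite act_pos mul0rz.
    have -> : m + h%:Z = Posz (absz (m + h%:Z)%R) by lia.
    by rewrite act_pos act0 mul0rz.
  - case E : (l + m - h%:Z) => [q|q]; first by rewrite act_pos mul0rz.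
    have -> : n + h%:Z = Posz (absz (n + h%:Z)%R) by lia.
    by rewrite act_pos act0 mul0rz.
  - case E : (l + h%:Z) => [q|q]; first by rewrite np_pos act_0l mul0rz.
    have -> : m + n - h%:Z = Posz (absz (m + n - h%:Z)%R) by lia.
    by rewrite act_pos mul0rz.
pose d := (absz (l + m + n)%R).-2.
have dE : l + m + n = - (d.+2)%:Z by rewrite /d; lia.
have -> : zwcoef act l x y m n u N = \sum_(s < d.+1) g x y u s (d - s) *~
    \sum_(j < N) (l + m - j%:Z == Negz s)%:Z * ((-1) ^+ j * binz l j).
  under [RHS]eq_bigr => s _ do rewrite mulrz_sumr.
  rewrite exchange_big /=; apply: eq_bigr => h _.
  rewrite (@g_expand x y u _ _ d); last by lia.
  by rewrite mulrz_suml; apply: eq_bigr => s _; rewrite mulrzA.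
have -> : zwcoef act l y x n m u N = (\sum_(s < d.+1) g x y u s (d - s) *~
    \sum_(j < N) (m + j%:Z == Negz s)%:Z * ((-1) ^+ j * binz l j)) *~ (-1) ^+ (i && j).
  rewrite mulrz_suml /zwcoef.
  have swap z w : act z y (act w x u) = act w x (act z y u) *~ (-1) ^+ (i && j).
    case: z w => z [] w; rewrite ?act_pos ?act0 ?mul0rz //.
    by rewrite (act_comm _ _ _ xi yj) -mulrzA -exprD addnn -signr_odd odd_double mulr1z.
  under [RHS]eq_bigr => s _ do rewrite mulrz_sumr mulrz_suml.
  rewrite exchange_big /=; apply: eq_bigr => h _; rewrite swap.
  rewrite (@g_expand x y u _ _ d); last by lia.
  rewrite !mulrz_suml; apply: eq_bigr => s _; rewrite -!mulrzA; congr (_ *~ _).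
  by rewrite [RHS]mulrAC mulrA.
have -> : \sum_(h < N) act (m + n - h%:Z) (np (l + h%:Z) x y) u *~ binz m h =
    \sum_(s < d.+1) g x y u s (d - s) *~ \sum_(h < N) binz m h * binmode (l + h%:Z) s.
  under [RHS]eq_bigr => s _ do rewrite mulrz_sumr.
  rewrite exchange_big /=; apply: eq_bigr => h _.
  case E : (l + h%:Z) => [q|q].
    by rewrite np_pos act_0l mul0rz big1 // => s _; rewrite mulr0.
  case E' : (m + n - h%:Z) => [e|e].
    rewrite act_pos mul0rz big1 // => s _; rewrite /binmode bin_small ?mulr0 //.
    by have := ltn_ord s; lia.
  have eqd : d = (q + e)%N by lia.
  rewrite act_np mulrz_suml -(big_mkord xpredT (fun i => (act (Negz (i + q)) x (act (Negz (e - i)) y u)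
     *+ 'C(i + q, q)) *~ binz m h)).
  rewrite -(big_mkord xpredT (fun s => g x y u s (d - s) *~ (binz m h * binmode (Negz q) s))).
  rewrite [in RHS](@big_cat_nat _ _ _ q) //=; last by lia.
  rewrite [X in _ = X + _]big_nat [X in _ = X + _]big1 ?add0r => [|s /andP[_ sq]]; last first.
    by rewrite bin_small // mulr0.
  have shift (G : nat -> M) : \sum_(q <= s < d.+1) G s = \sum_(0 <= s < e.+1) G (s + q)%N.
    by rewrite -{1}[q]add0n big_addn; have -> : (d.+1 - q = e.+1)%N by lia.
  rewrite shift; apply: eq_bigr => s _; rewrite /g mulrC mulrzA pmulrn; congr (_ *~ _ *~ _).
  by congr (act _ _ (act _ _ _)); lia.
rewrite -mulrzA -exprD addnC mulrz_suml -sumrB.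
apply: eq_bigr => s _; rewrite (borcherds_coef dE) //; last by rewrite -ltnS.
rewrite mulrzBr -!mulrzA exprD; congr (_ - _ *~ _).
by rewrite exprD -(mulrA (_ ^+ `|l|%N)); case: (i && j); rewrite ?mulrNN ?mulr1.
Qed.

End RegularBorcherds.

(** * The vertex algebra generated by a regular field *)
Section Series.
Variables (K : fieldType) (U : lmodType K).
Hypothesis char0 : forall n : nat, n.+1%:R != 0 :> K.

Local Notation series := (nat -> U).
Local Notation oper := (series -> series).

Implicit Types (f g : series) (x y : oper).

Definition zmul f : series := fun n => if n is n'.+1 then f n' else 0.
Definition der f : series := fun n => f n.+1 *+ n.+1.
Definition cst (u : U) : series := fun n => if n is 0%N then u else 0.

(** Fields without singular part, as K[[z]]-linear operators on U[[z]]: products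
    of fields are then compositions, and d/dz acts on them by commutator. *)
Definition zlinear x := linear x /\ forall f, x (zmul f) = zmul (x f).

Definition coef x (n : nat) (u : U) : U := x (cst u) n.

Lemma zlinD x f g : zlinear x -> x (f + g) = x f + x g.
Proof. by case=> xl _; rewrite -{1}[f]scale1r xl scale1r. Qed.
Lemma zlin0 x : zlinear x -> x 0 = 0.
Proof. by move=> xz; apply: (addrI (x 0)); rewrite -zlinD // !addr0. Qed.
Lemma zlinZ x c f : zlinear x -> x (c *: f) = c *: x f.
Proof. by move=> xz; rewrite -[c *: f]addr0 xz.1 zlin0 // addr0. Qed.
Lemma zlinN x f : zlinear x -> x (- f) = - x f.
Proof. by move=> xz; rewrite -scaleN1r zlinZ // scaleN1r. Qed.

Lemma cstD u v c : cst (c *: u + v) = c *: cst u + cst v.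
Proof.
by apply/funext => -[|n]; rewrite !fctE //= scaler0 addr0.
Qed.

Lemma coef_linear x n : zlinear x -> linear (coef x n).
Proof. by move=> [xl _] c u v; rewrite /coef cstD xl. Qed.

Lemma coef0r x n : zlinear x -> coef x n 0 = 0.
Proof.
move=> xz; have := coef_linear n xz (- 1) 0 0; rewrite scaler0 addr0 scaleN1r.
by rewrite addNr.
Qed.

Lemma coefDr x n u v : zlinear x -> coef x n (u + v) = coef x n u + coef x n v.
Proof. by move=> xz; have := coef_linear n xz 1 u v; rewrite !scale1r. Qed.

Lemma coefZr x n c u : zlinear x -> coef x n (c *: u) = c *: coef x n u.
Proof.
by move=> xz; have := coef_linear n xz c u 0; rewrite coef0r // !addr0.
Qed.

Lemma coefMzr x n (c : int) u : zlinear x -> coef x n (u *~ c) = coef x n u *~ c.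
Proof. by move=> xz; rewrite -!scaler_int coefZr. Qed.

(** A K[[z]]-linear operator is determined by its values on U, as multiplication
    by a series of operators. *)
Lemma zlinear_expand x f n : zlinear x ->
  x f n = \sum_(t < n.+1) coef x (n - t) (f t).
Proof.
move=> xz; elim: n f => [|n IH] f.
all: have fE : f = cst (f 0%N) + zmul (fun t => f t.+1).
1,3: by apply/funext => -[|t]; rewrite !fctE /= ?addr0 ?add0r.
all: rewrite {1}fE zlinD // xz.2 fctE big_ord_recl subn0 /=.
  by rewrite big_ord0.
by rewrite IH.
Qed.

Lemma zlinear_ext x y : zlinear x -> zlinear y ->
  (forall n u, coef x n u = coef y n u) -> x = y.
Proof.
move=> xz yz xy; apply/funext => f; apply/funext => n; rewrite !zlinear_expand //.
by apply: eq_bigr => t _.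
Qed.

Lemma coef_comp x y n u : zlinear x ->
  coef (x \o y) n u = \sum_(t < n.+1) coef x (n - t) (coef y t u).
Proof. by move=> xz; rewrite /coef /= zlinear_expand. Qed.

Lemma zlinear_comp x y : zlinear x -> zlinear y -> zlinear (x \o y).
Proof.
move=> xz yz; split=> [c f g|f] /=; first by rewrite yz.1 xz.1.
by rewrite yz.2 xz.2.
Qed.

Lemma zlinear_id : zlinear id.
Proof. by split. Qed.

Lemma zmulD c f g : zmul (c *: f + g) = c *: zmul f + zmul g.
Proof. by apply/funext => -[|n]; rewrite !fctE /= ?scaler0 ?addr0. Qed.

Lemma zlinear_subspace : is_subspace zlinear.
Proof.
have z0 : zmul 0 = 0 by apply/funext => -[|n].
apply: subspace_pair.
- split=> [c f g|f]; last by rewrite -[RHS]/(zmul 0) z0.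
  by rewrite -[LHS]/(0 : series) -[RHS]/(c *: (0 : series) + 0) scaler0 addr0.
- move=> x y xz yz; have E f : (x + y) f = x f + y f by [].
  split=> [c f g|f]; rewrite !E.
    by rewrite xz.1 yz.1 scalerDr addrACA.
  by rewrite xz.2 yz.2 -[zmul (x f)]scale1r -zmulD scale1r.
- move=> c x xz; have E f : (c *: x) f = c *: x f by [].
  split=> [d f g|f]; rewrite !E.
    by rewrite xz.1 scalerDr !scalerA mulrC.
  by have := zmulD c (x f) 0; rewrite z0 !addr0 xz.2 => ->.
Qed.

Lemma der_linear : linear der.
Proof.
by move=> c f g; apply/funext => n; rewrite /der !fctE mulrnDl scalerMnr.
Qed.
HB.instance Definition _ := GRing.isLinear.Build K series series *:%R der der_linear.

Definition dz x : oper := fun f => der (x f) - x (der f).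

Lemma dzE x f : dz x f = der (x f) - x (der f). Proof. by []. Qed.

Lemma dz_linear : linear dz.
Proof.
move=> c x y; apply/funext => f.
rewrite fctE dzE; rewrite -[(c *: x + y) f]/(c *: x f + y f).
rewrite -[(c *: x + y) (der f)]/(c *: x (der f) + y (der f)).
by rewrite linearP opprD addrACA -scalerBr.
Qed.
HB.instance Definition _ := GRing.isLinear.Build K oper oper *:%R dz dz_linear.

Lemma zlinear_dz x : zlinear x -> zlinear (dz x).
Proof.
move=> xz; split=> [c f g|f].
  rewrite !dzE xz.1 !linearP /= xz.1 opprD addrACA; congr (_ + _).
  by rewrite -scalerBr.
have dz g : der (zmul g) = zmul (der g) + g.
  by apply/funext => -[|n]; rewrite /der fctE /= ?add0r ?mulr1n // mulrS addrC.
rewrite !dzE xz.2 !dz zlinD // xz.2 opprD addrACA subrr addr0.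
rewrite addrC -scaleN1r [RHS](_ : _ = zmul (- 1 *: x (der f) + der (x f))).
  by rewrite zmulD.
by rewrite scaleN1r addrC.
Qed.

Lemma dz_comp x y : zlinear x -> dz (x \o y) = (dz x \o y) + (x \o dz y).
Proof.
move=> xz; apply/funext => f.
rewrite -[RHS]/(dz x (y f) + x (der (y f) - y (der f))) zlinD // zlinN //.
by rewrite !dzE /= addrA subrK.
Qed.

Lemma coef_dz x n u : zlinear x -> coef (dz x) n u = coef x n.+1 u *+ n.+1.
Proof.
move=> xz; rewrite /coef dzE.
have -> : der (cst u) = 0 by apply/funext => m; rewrite /der /= mul0rn.
by rewrite zlin0 // subr0.
Qed.

(** Divided powers of the derivation, so that Y(x, w) = \sum_q ddop q x w^q. *)
Definition ddop (q : nat) x : oper := (q`!%:R)^-1 *: iter q dz x.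

Lemma nat_unit n : (0 < n)%N -> n%:R != 0 :> K.
Proof. by case: n. Qed.

Lemma ddop0 x : ddop 0 x = x.
Proof. by rewrite /ddop fact0 invr1 scale1r. Qed.

Lemma ddopS q x : dz (ddop q x) = ddop q.+1 x *+ q.+1.
Proof.
rewrite /ddop linearZ /= -scaler_nat scalerA factS natrM invfM mulrA.
by rewrite divff ?mul1r // nat_unit.
Qed.

Lemma ddop_linear q : linear (ddop q).
Proof.
move=> c x y; rewrite /ddop; have -> : iter q dz (c *: x + y) =
  c *: iter q dz x + iter q dz y by elim: q => //= q ->; rewrite linearP.
by rewrite scalerDr !scalerA mulrC.
Qed.
HB.instance Definition _ q := GRing.isLinear.Build K oper oper *:%R (ddop q) (ddop_linear q).

Lemma zlinear_ddop q x : zlinear x -> zlinear (ddop q x).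
Proof.
move=> xz; apply: (subspaceZ _ zlinear_subspace).
by elim: q => //= q; apply: zlinear_dz.
Qed.

Lemma mulrn_inj (W : lmodType K) (u v : W) n : u *+ n.+1 = v *+ n.+1 -> u = v.
Proof.
by rewrite -!scaler_nat => /(scalerI (char0 n)).
Qed.

Lemma coef_ddop q x n u : zlinear x ->
  coef (ddop q x) n u = coef x (n + q) u *+ 'C(n + q, q).
Proof.
move=> xz; elim: q n => [|q IH] n; first by rewrite ddop0 addn0 bin0.
apply: (@mulrn_inj _ _ _ q).
have -> : coef (ddop q.+1 x) n u *+ q.+1 = coef (dz (ddop q x)) n u.
  by rewrite ddopS /coef -!scaler_nat.
rewrite coef_dz; last exact: zlinear_ddop.
rewrite IH addSnnS -!mulrnA; congr (_ *+ _).
by rewrite [RHS]mulnC mul_bin_left addnS subSn ?leq_addl // addnK mulnC.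
Qed.

Lemma ddop_ddop i q x : ddop i (ddop q x) = ddop (i + q) x *+ 'C(i + q, q).
Proof.
elim: i => [|i IH]; first by rewrite ddop0 add0n binn.
apply: (@mulrn_inj _ _ _ i); rewrite -ddopS IH raddfMn /= ddopS -!mulrnA.
congr (_ *+ _); rewrite addSn.
have := mul_bin_down (i + q).+1 q; rewrite subSn ?leq_addl // addnK /= => ->.
exact: mulnC.
Qed.

Lemma ddop_comp e x y : zlinear x -> zlinear y ->
  ddop e (x \o y) = \sum_(i < e.+1) (ddop i x \o ddop (e - i) y).
Proof.
move=> xz yz; elim: e => [|e IH]; first by rewrite big_ord1 !ddop0.
have compMn (x' y' : oper) k l : zlinear x' -> (x' *+ k) \o (y' *+ l) = (x' \o y') *+ (k * l).
  move=> xz'; apply/funext => f; rewrite -!scaler_nat.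
  rewrite -[LHS]/(k%:R *: x' (l%:R *: y' f)) -[RHS]/((k * l)%:R *: x' (y' f)).
  by rewrite zlinZ // scalerA natrM.
apply: (@mulrn_inj _ _ _ e); rewrite -ddopS IH raddf_sum /=.
under eq_bigr => i _.
  rewrite dz_comp; last exact: zlinear_ddop.
  rewrite !ddopS -[ddop (e - i) y]mulr1n compMn; last exact: zlinear_ddop.
  rewrite -[X in _ + (X \o _)]mulr1n compMn; last exact: zlinear_ddop.
  rewrite muln1 mul1n; over.
rewrite big_split /= -sumrMnl.
pose H i := ddop i x \o ddop (e.+1 - i) y.
have -> : \sum_(i < e.+1) (ddop i.+1 x \o ddop (e - i) y) *+ i.+1 =
    \sum_(i < e.+2) H i *+ i.
  by rewrite [RHS]big_ord_recl mulr0n add0r.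
have -> : \sum_(i < e.+1) (ddop i x \o ddop (e - i).+1 y) *+ (e - i).+1 =
    \sum_(i < e.+2) H i *+ (e.+1 - i).
  rewrite [RHS]big_ord_recr /= subnn mulr0n addr0; apply: eq_bigr => i _.
  by rewrite /H subSn // -ltnS.
rewrite -big_split; apply: eq_bigr => i _ /=.
by rewrite -mulrnDr subnKC // -ltnS.
Qed.

(** The n-th product of regular fields. *)
Definition oper_prod (n : int) x y : oper :=
  match n with Posz _ => 0 | Negz q => ddop q x \o y end.

Lemma oper_prod_linl n y : linear (fun x => oper_prod n x y).
Proof.
move=> c x x'; case: n => q; first by rewrite scaler0 addr0.
by rewrite /oper_prod linearP.
Qed.

Lemma oper_prod_linr n x : zlinear x -> forall c y y',
  oper_prod n x (c *: y + y') = c *: oper_prod n x y + oper_prod n x y'.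
Proof.
move=> xz c y y'; case: n => q; first by rewrite scaler0 addr0.
apply/funext => f; have [xl _] := zlinear_ddop q xz.
exact: xl c (y f) (y' f).
Qed.

Lemma oper_prodDD n x x' y y' : zlinear x -> zlinear x' ->
  oper_prod n (x + x') (y + y') =
  (oper_prod n x y + oper_prod n x' y') + (oper_prod n x y' + oper_prod n x' y).
Proof.
move=> xz xz'.
have Dl z : oper_prod n (x + x') z = oper_prod n x z + oper_prod n x' z.
  by have := oper_prod_linl n z 1 x x'; rewrite !scale1r.
have Dr z : zlinear z -> oper_prod n z (y + y') = oper_prod n z y + oper_prod n z y'.
  by move=> zz; have := oper_prod_linr n zz 1 y y'; rewrite !scale1r.
by rewrite Dl (Dr x) // (Dr x') // [X in _ + X]addrC addrACA.
Qed.

End Series.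

Section FieldAlgebra.
Variables (K : fieldType) (U : lmodType K).
Hypothesis char0 : forall n : nat, n.+1%:R != 0 :> K.
Variables (Upar : bool -> set U) (p : nat) (A : nat -> U -> U).
Hypothesis gU : is_grading Upar.
Hypothesis A_lin : forall i, linear (A i).
Hypothesis A_par : forall i j u, Upar j u -> Upar (odd p (+) j) (A i u).
Hypothesis A_comm : forall s t u, A s (A t u) = A t (A s u) *~ (-1) ^+ odd p.
(** The coefficients of A(z)A(w) have a zero of order p at z = w: the i-th divided
    z-derivative of A(z)A(w) vanishes on the diagonal for i < p. *)
Hypothesis A_rel : forall i d u, (i < p)%N ->
  \sum_(s < d.+1) A s (A (d - s) u) *+ 'C(s, i) = 0.

Local Notation series := (nat -> U).
Local Notation oper := (series -> series).

Let A0 i : A i 0 = 0.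
Proof.
have := A_lin i (- 1) 0 0; rewrite scaler0 addr0 scaleN1r => ->.
by rewrite addNr.
Qed.
Let AD i u v : A i (u + v) = A i u + A i v.
Proof. by have := A_lin i 1 u v; rewrite !scale1r. Qed.
Let AZ i c u : A i (c *: u) = c *: A i u.
Proof. by have := A_lin i c u 0; rewrite A0 !addr0. Qed.
(** Multiplication by A(z) = \sum_i A_i z^i. *)
Definition gen_field : oper := fun f n => \sum_(i < n.+1) A i (f (n - i)%N).

Lemma gen_field_zlinear : zlinear gen_field.
Proof.
split=> [c f g|f]; apply/funext.
  move=> n; rewrite -[RHS]/(c *: gen_field f n + gen_field g n) /gen_field scaler_sumr -big_split.
  by apply: eq_bigr => i _ /=; rewrite -AZ -AD.
case=> [|n]; first by rewrite /gen_field big_ord1 A0.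
rewrite -[RHS]/(gen_field f n) /gen_field big_ord_recr /= subnn A0 addr0; apply: eq_bigr => i _ /=.
by rewrite subSn // -ltnS.
Qed.

Lemma coef_gen_field n u : coef gen_field n u = A n u.
Proof.
rewrite /coef /gen_field big_ord_recr subnn big1 /= => [|i _]; first by rewrite add0r.
have -> : (n - i)%N = (n - i.+1).+1 by have := ltn_ord i; lia.
exact: A0.
Qed.

(** The fields obtained from A(z) and the identity by linear combinations and n-th
    products; being an intersection, it is generated by A(z) by construction. *)
Definition generated (x : oper) : Prop := forall P : set oper,
  is_subspace P -> P id -> P gen_field ->
  (forall n x y, P x -> P y -> P (oper_prod n x y)) -> P x.

Lemma generated_subspace : is_subspace generated.
Proof.
apply: subspace_pair => [P Ps _ _ _|x y Wx Wy P Ps P1 Pf Pn|c x Wx P Ps P1 Pf Pn].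
- exact: subspace0.
- by apply: subspaceD => //; [apply: Wx | apply: Wy].
- by apply: subspaceZ => //; apply: Wx.
Qed.
Lemma generated_id : generated id.
Proof. by move=> P _ P1. Qed.
Lemma generated_field : generated gen_field.
Proof. by move=> P _ _ Pf. Qed.
Lemma generated_prod n x y : generated x -> generated y -> generated (oper_prod n x y).
Proof.
by move=> Wx Wy P Ps P1 Pf Pn; apply: (Pn); [exact: Wx | exact: Wy].
Qed.

Definition oper_par (i : bool) (x : oper) : Prop :=
  zlinear x /\ forall n j u, Upar j u -> Upar (i (+) j) (coef x n u).

Let sU i : is_subspace (Upar i) := grading_sub gU i.

Lemma oper_par_subspace i : is_subspace (oper_par i).
Proof.
have zs := @zlinear_subspace K U; apply: subspace_pair.
- split; first exact: subspace0.
  by move=> n j u _; apply: subspace0.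
- move=> x y [xz xp] [yz yp]; split; first exact: subspaceD.
  by move=> n j u pu; apply: subspaceD => //; [apply: xp | apply: yp].
- move=> c x [xz xp]; split; first exact: subspaceZ.
  by move=> n j u pu; apply: subspaceZ => //; apply: xp.
Qed.

Lemma oper_par_id : oper_par false id.
Proof.
split; first exact: zlinear_id.
by move=> [|n] j u pu //=; apply: subspace0.
Qed.

Lemma oper_par_field : oper_par (odd p) gen_field.
Proof.
by split; [exact: gen_field_zlinear | move=> n j u pu; rewrite coef_gen_field; exact: A_par].
Qed.

Lemma zlinear_prod n (x y : oper) : zlinear x -> zlinear y -> zlinear (oper_prod n x y).
Proof.
case: n => n xz yz; first exact: subspace0 (@zlinear_subspace K U).
by apply: zlinear_comp => //; apply: zlinear_ddop.
Qed.

Lemma coef_prod q n (x y : oper) u : zlinear x -> zlinear y ->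
  coef (oper_prod (Negz q) x y) n u =
  \sum_(i < n.+1) coef x (i + q) (coef y (n - i) u) *+ 'C(i + q, q).
Proof.
move=> xz yz; rewrite /= coef_comp; last exact: zlinear_ddop.
rewrite (reindex_inj rev_ord_inj); apply: eq_bigr => i _ /=.
have iN : (i <= n)%N by rewrite -ltnS.
by rewrite subSS subKn // coef_ddop.
Qed.

Lemma oper_par_prod n i j x y : oper_par i x -> oper_par j y -> oper_par (i (+) j) (oper_prod n x y).
Proof.
case: n => q px py; first exact: subspace0 (oper_par_subspace _).
split; first by apply: zlinear_prod; [case: px | case: py].
move=> n k u pu; rewrite coef_prod; [|by case: px|by case: py].
apply: subspace_sum => // l _; rewrite -scaler_nat; apply: subspaceZ => //.
by rewrite -addbA; apply: px.2; apply: py.2.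
Qed.

Lemma oper_par_disj i x : oper_par i x -> oper_par (~~ i) x -> x = 0.
Proof.
move=> [xz xp] [_ xp']; apply: zlinear_ext => // [|n u].
  exact: subspace0 (@zlinear_subspace K U).
have par0 j v : Upar j v -> coef x n v = 0.
  move=> pv; apply: (grading_disj gU (i := i (+) j)); first exact: xp.
  by rewrite -addNb; apply: xp'.
have [u0 [u1 [p0 p1 ->]]] := grading_split gU u.
by rewrite coefDr // (par0 _ _ p0) (par0 _ _ p1) addr0.
Qed.

Lemma generated_split x : generated x -> exists x0 x1,
  [/\ generated x0 /\ oper_par false x0, generated x1 /\ oper_par true x1 & x = x0 + x1].
Proof.
have Ws := generated_subspace; have ps := oper_par_subspace.
move=> Wx; apply: (Wx (fun x => exists x0 x1,
  [/\ generated x0 /\ oper_par false x0, generated x1 /\ oper_par true x1 & x = x0 + x1])).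
- apply: subspace_pair.
  + by exists 0, 0; rewrite addr0; split=> //; split; [exact: subspace0 Ws|exact: subspace0 (ps _)|exact: subspace0 Ws|exact: subspace0 (ps _)].
  + move=> _ _ [x0 [x1 [[? ?] [? ?] ->]]] [y0 [y1 [[? ?] [? ?] ->]]].
    exists (x0 + y0), (x1 + y1); rewrite addrACA.
    by split=> //; split; [exact: (subspaceD Ws)|exact: (subspaceD (ps _))|exact: (subspaceD Ws)|exact: (subspaceD (ps _))].
  + move=> c _ [x0 [x1 [[? ?] [? ?] ->]]]; exists (c *: x0), (c *: x1).
    by rewrite scalerDr; split=> //; split; [exact: (subspaceZ _ Ws)|exact: (subspaceZ _ (ps _))|exact: (subspaceZ _ Ws)|exact: (subspaceZ _ (ps _))].
- exists id, 0; rewrite addr0; split=> //; split;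
    [exact: generated_id | exact: oper_par_id | exact: subspace0 Ws | exact: subspace0 (ps _)].
- have Wf := generated_field; have := oper_par_field; case: (odd p) => pf.
    by exists 0, gen_field; rewrite add0r; split=> //; split=> //; [exact: subspace0 Ws | exact: subspace0 (ps _)].
  by exists gen_field, 0; rewrite addr0; split=> //; split=> //; [exact: subspace0 Ws | exact: subspace0 (ps _)].
- move=> n _ _ [x0 [x1 [[Wx0 px0] [Wx1 px1] ->]]] [y0 [y1 [[Wy0 py0] [Wy1 py1] ->]]].
  exists (oper_prod n x0 y0 + oper_prod n x1 y1), (oper_prod n x0 y1 + oper_prod n x1 y0); split.
  + split; first by apply: (subspaceD Ws); exact: generated_prod.
    exact: (subspaceD (ps _) (oper_par_prod n px0 py0) (oper_par_prod n px1 py1)).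
  + split; first by apply: (subspaceD Ws); exact: generated_prod.
    exact: (subspaceD (ps _) (oper_par_prod n px0 py1) (oper_par_prod n px1 py0)).
  + by apply: oper_prodDD; [case: px0 | case: px1].
Qed.

Definition sgn (b : bool) : int := (-1) ^+ b.

Lemma sgn_sq b : sgn b * sgn b = 1.
Proof. by case: b. Qed.

(** Induction along the generation of the fields: supercommutation passes to n-th
    products because the parities add up. *)
Lemma generated_commute (i : bool) (B : nat -> U -> U) : (forall s, linear (B s)) ->
  (forall s t u, B s (A t u) = A t (B s u) *~ sgn (i && odd p)) ->
  forall j y, generated y -> oper_par j y ->
  forall s t u, B s (coef y t u) = coef y t (B s u) *~ sgn (i && j).
Proof.
move=> Bl BA.
have B0 s : B s 0 = 0.
  have := Bl s (- 1) 0 0; rewrite scaler0 addr0 scaleN1r => ->; by rewrite addNr.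
have BD s u v : B s (u + v) = B s u + B s v by have := Bl s 1 u v; rewrite !scale1r.
have BZ s c u : B s (c *: u) = c *: B s u by have := Bl s c u 0; rewrite B0 !addr0.
have Bsum s n (G : 'I_n -> U) : B s (\sum_(t < n) G t) = \sum_(t < n) B s (G t).
  by elim/big_rec2: _ => [|t u v _ <-]; [exact: B0 | exact: BD].
pose C j y := oper_par j y /\
  forall s t u, B s (coef y t u) = coef y t (B s u) *~ sgn (i && j).
have Cs j : is_subspace (C j).
  have ps := oper_par_subspace j; apply: subspace_pair.
  - by split=> [|s t u]; [exact: subspace0 | rewrite B0 mul0rz].
  - move=> x y [px Cx] [py Cy]; split=> [|s t u]; first exact: subspaceD.
    by rewrite -[coef (x + y) t u]/(coef x t u + coef y t u) BD Cx Cy -mulrzDl.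
  - move=> c x [px Cx]; split=> [|s t u]; first exact: subspaceZ.
    by rewrite -[coef (c *: x) t u]/(c *: coef x t u) BZ Cx scalerMzr.
have Cprod n j k x y : C j x -> C k y -> C (j (+) k) (oper_prod n x y).
  move=> [px Cx] [py Cy]; case: n => q; first exact: subspace0.
  split=> [|s t u]; first exact: oper_par_prod.
  have [[xz _] [yz _]] := (px, py).
  rewrite !coef_prod // Bsum mulrz_suml; apply: eq_bigr => l _.
  rewrite -!scaler_nat BZ Cx Cy coefMzr // -!scaler_int !scalerA.
  congr (_ *: _); rewrite -mulrA -intrM mulrC; congr (_%:~R * _).
  by case: (i); case: (j); case: (k).
have key : forall y, generated y -> exists y0 y1, [/\ C false y0, C true y1 & y = y0 + y1].
  move=> y Wy; apply: (Wy (fun y => exists y0 y1,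
    [/\ C false y0, C true y1 & y = y0 + y1])).
  - apply: subspace_pair.
    + by exists 0, 0; rewrite addr0; split=> //; apply: subspace0.
    + move=> _ _ [x0 [x1 [? ? ->]]] [y0 [y1 [? ? ->]]].
      by exists (x0 + y0), (x1 + y1); rewrite addrACA; split=> //; apply: subspaceD.
    + move=> c _ [x0 [x1 [? ? ->]]]; exists (c *: x0), (c *: x1).
      by rewrite scalerDr; split=> //; apply: subspaceZ.
  - exists id, 0; rewrite addr0; split=> //; last exact: subspace0.
    split=> [|s [|t] u]; first exact: oper_par_id.
      by rewrite /coef /= andbF mulr1z.
    by rewrite /coef /= B0 mul0rz.
  - have Cf : C (odd p) gen_field.
      by split=> [|s t u]; [exact: oper_par_field | rewrite !coef_gen_field BA].
    case: (odd p) Cf => Cf; [exists 0, gen_field | exists gen_field, 0].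
      by rewrite add0r; split=> //; apply: subspace0.
    by rewrite addr0; split=> //; apply: subspace0.
  - move=> n _ _ [x0 [x1 [Cx0 Cx1 ->]]] [y0 [y1 [Cy0 Cy1 ->]]].
    exists (oper_prod n x0 y0 + oper_prod n x1 y1), (oper_prod n x0 y1 + oper_prod n x1 y0); split.
    + apply: subspaceD => //; first exact: (Cprod _ _ _ _ _ Cx0 Cy0).
      exact: (Cprod _ _ _ _ _ Cx1 Cy1).
    + apply: subspaceD => //; first exact: (Cprod _ _ _ _ _ Cx0 Cy1).
      exact: (Cprod _ _ _ _ _ Cx1 Cy0).
    + by apply: oper_prodDD; [case: Cx0 => -[] | case: Cx1 => -[]].
move=> j y /key[y0 [y1 [C0 C1 yE]]] py.
suff [] : C j y by [].
have ps i' := oper_par_subspace i'.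
case: j py => py; rewrite yE.
  have -> : y0 = 0.
    apply: (@oper_par_disj false); first by case: C0.
    have -> : y0 = y - y1 by rewrite yE addrK.
    by apply: (subspaceB (ps _) py); case: C1.
  by rewrite add0r.
have -> : y1 = 0.
  apply: (@oper_par_disj true); first by case: C1.
  have -> : y1 = y - y0 by rewrite yE addrC addKr.
  by apply: (subspaceB (ps _) py); case: C0.
by rewrite addr0.
Qed.

Lemma generated_zlinear x : generated x -> zlinear x.
Proof.
move=> /generated_split[x0 [x1 [[_ [z0 _]] [_ [z1 _]] ->]]].
exact: subspaceD (@zlinear_subspace K U) z0 z1.
Qed.

Lemma coef_commute i j x y : generated x -> oper_par i x -> generated y -> oper_par j y ->
  forall s t u, coef x s (coef y t u) = coef y t (coef x s u) *~ sgn (i && j).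
Proof.
move=> Wx px Wy py.
apply: generated_commute => // [s|s t u]; first by apply: coef_linear; case: px.
rewrite (generated_commute (i := odd p) (B := A) _ _ Wx px) //; last first.
  by move=> *; rewrite andbb A_comm.
by rewrite andbC -mulrzA sgn_sq mulr1z.
Qed.

Lemma fields_commute i j x y : generated x -> oper_par i x -> generated y -> oper_par j y ->
  forall f, x (y f) = y (x f) *~ sgn (i && j).
Proof.
move=> Wx px Wy py f; have [[xz _] [yz _]] := (px, py).
suff /(congr1 (fun h => h f)) : x \o y = (sgn (i && j))%:~R *: (y \o x).
  by rewrite fctE /= => ->; rewrite -scaler_int.
apply: zlinear_ext; first exact: zlinear_comp.
  by apply: subspaceZ (@zlinear_subspace K U) _; apply: zlinear_comp.
move=> n u; rewrite -[RHS]/(_ *: coef (y \o x) n u) !coef_comp // scaler_sumr.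
rewrite [RHS](reindex_inj rev_ord_inj); apply: eq_bigr => t _ /=.
have tn : (t <= n)%N by rewrite -ltnS.
by rewrite subSS subKn // (coef_commute Wx px Wy py) scaler_int.
Qed.

Let genfields := subsp generated_subspace.

Definition fields_vac : genfields := subin generated_subspace generated_id.
Definition fields_gen : genfields := subin generated_subspace generated_field.
Definition fields_par (i : bool) (x : genfields) : Prop := oper_par i (subval x).
Definition fields_nprod n (x y : genfields) : genfields :=
  subin generated_subspace (generated_prod n (subval_in x) (subval_in y)).

Let Wz (x : genfields) : zlinear (subval x) := generated_zlinear (subval_in x).

Fact fields_linr n x : linear (fields_nprod n x).
Proof. 
move=> c y z; apply: subval_inj; rewrite linearP.
rewrite -[LHS]/(oper_prod n (subval x) (subval (c *: y + z))) linearP.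
by rewrite (oper_prod_linr n (Wz x)). Qed.
Fact fields_linl n y : linear (fun x => fields_nprod n x y).
Proof. 
move=> c x z; apply: subval_inj; rewrite linearP.
rewrite -[LHS]/(oper_prod n (subval (c *: x + z)) (subval y)) linearP.
by rewrite (oper_prod_linl n (subval y)). Qed.
Fact fields_pos (n : nat) x y : fields_nprod n%:Z x y = 0.
Proof. exact: subval_inj. Qed.
Fact fields_trunc x y : exists N : int, forall n, (N <= n)%R -> fields_nprod n x y = 0.
Proof. by exists 0 => -[n _|//]; exact: fields_pos. Qed.
Fact fields_grading : is_grading fields_par.
Proof.
apply: is_grading_bool => [i|x|x p0 p1].
- have ps := oper_par_subspace i; apply: subspace_pair; rewrite /fields_par.
  + exact: subspace0 ps.
  + by move=> x y; exact: subspaceD ps.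
  + by move=> c x; exact: subspaceZ ps.
- have [x0 [x1 [[W0 p0] [W1 p1] E]]] := generated_split (subval_in x).
  exists (subin _ W0), (subin _ W1); split=> //; exact: subval_inj.
- by apply: subval_inj; apply: (oper_par_disj (i := false)).
Qed.
Fact fields_vac_even : fields_par false fields_vac.
Proof. exact: oper_par_id. Qed.
Fact fields_nprod_par i j n x y : fields_par i x -> fields_par j y ->
  fields_par (i (+) j) (fields_nprod n x y).
Proof. exact: oper_par_prod. Qed.

Lemma ddop_id q : (0 < q)%N -> ddop q (id : oper) = 0.
Proof.
move=> q0; apply: zlinear_ext => [||n u].
- by apply: zlinear_ddop; exact: zlinear_id.
- exact: subspace0 (@zlinear_subspace K U).
- rewrite coef_ddop //.
  by case: q q0 => // q _; rewrite addnS /coef /= mul0rn.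
Qed.

Fact fields_vacl n x : fields_nprod n fields_vac x = if n == -1 then x else 0.
Proof.
apply: subval_inj; case: n => [n|[|q]] //=; first by rewrite ddop0.
by rewrite ddop_id.
Qed.
Fact fields_vacr x : fields_nprod (-1) x fields_vac = x.
Proof. by apply: subval_inj; rewrite /= ddop0. Qed.
Fact fields_vacr_ge0 (n : nat) x : fields_nprod n%:Z x fields_vac = 0.
Proof. exact: fields_pos. Qed.

Let ddop_generated q x : generated x -> generated (ddop q x).
Proof. by move=> Wx; have := generated_prod (Negz q) Wx generated_id. Qed.
Let ddop_oper_par q i x : oper_par i x -> oper_par i (ddop q x).
Proof.
by move=> px; have := oper_par_prod (Negz q) px oper_par_id; rewrite addbF.
Qed.

Fact fields_borcherds : borcherds fields_nprod fields_nprod fields_par.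
Proof.
apply: regular_borcherds.
- exact: fields_linr.
- case=> n u; apply: subval_inj; first by [].
  rewrite -[LHS]/(oper_prod (Negz n) 0 (subval u)).
  by have := oper_prod_linl (Negz n) (subval u) (- 1) 0 0; rewrite scaler0 addr0 scaleN1r addNr.
- exact: fields_pos.
- exact: fields_pos.
- move=> q e x y w; apply: subval_inj; rewrite raddf_sum /=.
  rewrite ddop_comp //; last by apply: zlinear_ddop; exact: Wz.
  apply/funext => f; rewrite /= fct_sumE [in RHS]fct_sumE; apply: eq_bigr => i _.
  have Mn (h : oper) k g : (h *+ k) g = h g *+ k by rewrite -!scaler_nat.
  by rewrite raddfMn /= ddop_ddop // !Mn.
- move=> i j x y s t w px py; apply: subval_inj; rewrite raddfMz /=.
  apply/funext => f; rewrite -scaler_int.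
  rewrite -[RHS]/(_ *: ddop t (subval y) (ddop s (subval x) (subval w f))) scaler_int.
  have Wx := subval_in x; have Wy := subval_in y.
  exact: (fields_commute (ddop_generated s Wx) (ddop_oper_par s px)
    (ddop_generated t Wy) (ddop_oper_par t py)).
Qed.

Definition fieldsVA : vertexSuperalgebra K :=
  VertexSuperalgebra fields_linr fields_linl fields_trunc fields_grading
    fields_vac_even fields_nprod_par fields_vacl fields_vacr fields_vacr_ge0
    fields_borcherds.

Lemma gen_field_square (h : nat) :
  nprod (- p%:Z + h%:Z) (fields_gen : fieldsVA) fields_gen = 0.
Proof.
case E : (- p%:Z + h%:Z) => [n|q]; first exact: fields_pos.
apply: subval_inj; apply: zlinear_ext => [||n u].
- by apply: (zlinear_prod (Negz q)); exact: gen_field_zlinear.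
- exact: subspace0 (@zlinear_subspace K U).
- rewrite -[LHS]/(coef (oper_prod (Negz q) gen_field gen_field) n u).
  rewrite coef_prod; [|exact: gen_field_zlinear|exact: gen_field_zlinear].
  have qp : (q < p)%N by lia.
  apply: etrans (A_rel (n + q) u qp).
  rewrite -(big_mkord xpredT (fun s => A s (A (n + q - s) u) *+ 'C(s, q))).
  rewrite (@big_cat_nat _ _ _ q) //=; last by lia.
  rewrite [X in _ = X + _]big_nat [X in _ = X + _]big1 ?add0r => [|s /andP[_ sq]]; last first.
    by rewrite bin_small.
  have shift (G : nat -> U) : \sum_(q <= s < (n + q).+1) G s = \sum_(s < n.+1) G (s + q)%N.
    rewrite -{1}[q]add0n big_addn; have -> : ((n + q).+1 - q = n.+1)%N by lia.
    exact: big_mkord.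
  rewrite shift; apply: eq_bigr => i _; rewrite !coef_gen_field.
  by congr (A _ (A _ _) *+ _); lia.
Qed.

Lemma fieldsVA_admissible : admissible p (fields_gen : fieldsVA).
Proof.
split.
- exact: oper_par_field.
- move=> x m n.
  have pf : va_par (odd p) (fields_gen : fieldsVA) by exact: oper_par_field.
  exact: (mode_symmetric (M := adjoint fieldsVA) pf m n x erefl gen_field_square).
- move=> P Ps P1 Pa Pn x.
  suff [h Px] : exists h : generated (subval x), P (subin generated_subspace h).
    by have -> : x = subin generated_subspace h by exact: subval_inj.
  have eqP' y (h h' : generated y) : P (subin generated_subspace h) -> P (subin generated_subspace h').
    by move=> Ph; have -> : subin generated_subspace h' = subin generated_subspace h
      by exact: subval_inj.
  apply: (subval_in x (fun y => exists h : generated y, P (subin generated_subspace h))).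
  + apply: subspace_pair.
    * exists (subspace0 generated_subspace); have -> : subin generated_subspace (subspace0 generated_subspace) = 0 by exact: subval_inj.
      exact: subspace0.
    * move=> y z [hy Py] [hz Pz]; exists (subspaceD generated_subspace hy hz).
      have -> : subin generated_subspace (subspaceD generated_subspace hy hz) = subin generated_subspace hy + subin generated_subspace hz
        by exact: subval_inj.
      exact: subspaceD.
    * move=> c y [hy Py]; exists (subspaceZ c generated_subspace hy).
      have -> : subin generated_subspace (subspaceZ c generated_subspace hy) = c *: subin generated_subspace hy by exact: subval_inj.
      exact: subspaceZ.
  + by exists generated_id.
  + by exists generated_field.
  + move=> n y z [hy Py] [hz Pz]; exists (generated_prod n hy hz).
    have -> : subin generated_subspace (generated_prod n hy hz) =
      nprod n (subin generated_subspace hy : fieldsVA) (subin generated_subspace hz)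
      by exact: subval_inj.
    exact: Pn.
Qed.

Definition fields_act n (x : fieldsVA) (u : U) : U :=
  match n with Posz _ => 0 | Negz q => coef (subval (x : genfields)) q u end.

Fact fields_act_linr n x : linear (fields_act n x).
Proof.
case: n => q; first by move=> c u v; rewrite scaler0 addr0.
exact: coef_linear.
Qed.
Fact fields_act_linl n u : linear (fun x => fields_act n x u).
Proof.
by case: n => q c x y /=; rewrite ?scaler0 ?addr0.
Qed.
Fact fields_act_trunc x u : exists N : int, forall n, (N <= n)%R -> fields_act n x u = 0.
Proof. by exists 0 => -[]. Qed.
Fact fields_act_par i j n x u : va_par i x -> Upar j u -> Upar (i (+) j) (fields_act n x u).
Proof.
case: n => q px pu /=; first exact: subspace0.
exact: px.2.
Qed.
Fact fields_act_vac n u : fields_act n (vac fieldsVA) u = if n == -1 then u else 0.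
Proof. by case: n => [n|[|n]]. Qed.
Fact fields_act_borcherds : borcherds fields_act (@nprod K fieldsVA) (@va_par K fieldsVA).
Proof.
apply: regular_borcherds => //.
- exact: fields_act_linr.
- by move=> [n|n] u.
- exact: fields_pos.
- by move=> q e x y u; exact: coef_prod.
- move=> i j x y s t u px py; apply: coef_commute => //; exact: subval_in.
Qed.

Definition fields_module : vmodule fieldsVA :=
  VModule fields_act_linr fields_act_linl fields_act_trunc gU fields_act_par fields_act_vac fields_act_borcherds.

(** F(p) maps to the algebra of fields by initiality.  The maps i and j identify the
    carrier of N with U. *)
Lemma fields_F_module (F : freeVA K p) : exists (N : vmodule F) (i : {linear N -> U}) (j : U -> N),
  [/\ cancel j i, cancel i j, forall b u, Upar b u -> vm_par b (j u),
      forall (n : nat) (w : N), vact n%:Z (fgen F) w = 0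
    & forall n (w : N), i (vact (Negz n) (fgen F) w) = A n (i w)].
Proof.
have [h [ha _]] : exists h : vaHom F fieldsVA, h (fgen F) = fields_gen /\
    forall h' : vaHom F fieldsVA, h' (fgen F) = fields_gen -> h' =1 h.
  have U1 : forall (W : vertexSuperalgebra K) (b : W), admissible p b ->
      exists h : vaHom F W, h (fgen F) = b /\
      forall h' : vaHom F W, h' (fgen F) = b -> h' =1 h by case: F.
  exact/U1/fieldsVA_admissible.
exists (pullback h fields_module), (idfun : {linear U -> U}), id; split=> //.
move=> n w; rewrite -[LHS]/(fields_act (Negz n) (h (fgen F)) w) ha.
exact: coef_gen_field.
Qed.

End FieldAlgebra.

(** * Polynomials divisible by the powers of the differences *)
Section WordFunctions.
Variables (K : fieldType).
Hypothesis char0 : forall n : nat, n.+1%:R != 0 :> K.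

Local Notation wfun := (seq nat -> K).

(** A function on words of length r is the coefficient function of a polynomial
    in r variables.  Here is the part of total degree d in the variables z, w of
    two adjacent letters, dehomogenised at w = 1. *)
Definition pairpoly (phi : wfun) (pre post : seq nat) (d : nat) : {poly K} :=
  \poly_(s < d.+1) phi (pre ++ [:: (d - s)%N, s & post]).

(** The coefficient functions of polynomials of the form
    \prod_(i < j) (z_i - z_j)^p S with S symmetric. *)
Definition vanishing (p : nat) (phi : wfun) : Prop :=
  (forall pre s t post, phi (pre ++ [:: s, t & post]) =
     (-1) ^+ p * phi (pre ++ [:: t, s & post]))
  /\ forall pre post d, ('X - 1%:P) ^+ p %| pairpoly phi pre post d.

(** Divisibility by (x - 1)^p read on Taylor coefficients at 1. *)
Lemma vanishing_taylor p phi pre post d i : vanishing p phi -> (i < p)%N ->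
  \sum_(s < d.+1) phi (pre ++ [:: (d - s)%N, s : nat & post]) *+ 'C(s, i) = 0.
Proof.
move=> [_ /(_ pre post d) /dvdpP[S E]] ip.
have : (pairpoly phi pre post d \Po ('X + 1%:P))`_i = 0.
  rewrite E comp_polyM rmorphXn /= comp_polyB comp_polyX comp_polyC addrK.
  by rewrite coefMXn ip.
rewrite /pairpoly poly_def linear_sum coef_sum /= => h; rewrite -[RHS]h.
apply: eq_bigr => s _; rewrite comp_polyZ rmorphXn /= comp_polyX coefZ.
rewrite -mulr_natr; congr (_ * _).
rewrite exprDn coef_sum (eq_bigr (fun k : 'I_s.+1 => ((s - k)%N == i)%:R *+ 'C(s, k))); last first.
  by move=> k _; rewrite polyC1 expr1n mulr1 coefMn coefXn eq_sym.
case: (leqP i s) => si; last first.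
  rewrite bin_small // big1 // => k _; have -> : (s - k == i)%N = false by lia.
  by rewrite mul0rn.
rewrite (@big_ord_single _ s.+1 (fun k => ((s - k)%N == i)%:R *+ 'C(s, k)) (s - i)).
- by rewrite subKn // eqxx bin_sub.
- by lia.
- move=> t ts; case: (leqP t s) => t2; last by rewrite bin_small.
  have -> : (s - t == i)%N = false by lia.
  exact: mul0rn.
Qed.

(** The sum over all decompositions of a word as a letterwise sum of two words. *)
Fixpoint splitsum (V : nmodType) (w : seq nat) (G : seq nat -> seq nat -> V) : V :=
  if w is i :: w' then
    \sum_(s < i.+1) splitsum w' (fun u v => G ((s : nat) :: u) ((i - s)%N :: v))
  else G [::] [::].

(** The coefficient function of a product of polynomials. *)
Definition wconv (f g : wfun) : wfun := fun w => splitsum w (fun u v => f u * g v).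

Lemma eq_splitsum (V : nmodType) w (G G' : seq nat -> seq nat -> V) : (forall u v, G u v = G' u v) -> splitsum w G = splitsum w G'.
Proof.
by elim: w G G' => [|i w IH] G G' E /=; [exact: E | apply: eq_bigr => s _; apply: IH].
Qed.

Lemma splitsum_cat (V : nmodType) w w' (G : seq nat -> seq nat -> V) : splitsum (w ++ w') G =
  splitsum w (fun u v => splitsum w' (fun u' v' => G (u ++ u') (v ++ v'))).
Proof.
by elim: w G => [|i w IH] G //=; apply: eq_bigr => s _; rewrite IH.
Qed.

Lemma splitsum_map (V W : nmodType) (h : {additive V -> W}) w G :
  h (splitsum w G) = splitsum w (fun u v => h (G u v)).
Proof.
by elim: w G => [|i w IH] G //=; rewrite raddf_sum; apply: eq_bigr => s _; rewrite IH.
Qed.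

Lemma splitsum_closed (V : nmodType) (P : V -> Prop) w (G : seq nat -> seq nat -> V) :
  P 0 -> (forall x y, P x -> P y -> P (x + y)) -> (forall u v, P (G u v)) ->
  P (splitsum w G).
Proof.
move=> P0 PD; elim: w G => [|i w IH] G PG //=.
by elim/big_ind: _ => // s _; apply: IH.
Qed.

Lemma splitsum_scale w c (G : seq nat -> seq nat -> K) :
  c * splitsum w G = splitsum w (fun u v => c * G u v).
Proof.
elim: w G => [|i w IH] G //=.
by rewrite mulr_sumr; apply: eq_bigr => s _; rewrite IH.
Qed.

Lemma splitsum_sum w n (G : nat -> seq nat -> seq nat -> K) :
  splitsum w (fun u v => \sum_(s < n) G s u v) = \sum_(s < n) splitsum w (G s).
Proof.
elim: w G => [|i w IH] G //=; rewrite exchange_big; apply: eq_bigr => s _ /=.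
exact: (IH (fun t u v => G t ((s : nat) :: u) ((i - s)%N :: v))).
Qed.

Lemma splitsum_neq0 w (G : seq nat -> seq nat -> K) : splitsum w G != 0 -> exists u v,
  [/\ size u = size w, size v = size w,
      forall a, nth 0%N w a = (nth 0%N u a + nth 0%N v a)%N & G u v != 0].
Proof.
elim: w G => [|i w IH] G /= => [G0|].
  by exists [::], [::]; split=> // a; rewrite nth_nil.
have [[s]|no] := pselect (exists s : 'I_i.+1,
    splitsum w (fun u v => G ((s : nat) :: u) ((i - s)%N :: v)) != 0).
  move=> /IH[u [v [su sv n0 G0]]] _; exists ((s : nat) :: u), ((i - s)%N :: v).
  split=> //=; rewrite ?su ?sv // => -[|a] //=.
  by rewrite subnKC // -ltnS.
rewrite big1 ?eqxx // => s _; apply/eqP/negP => /negP h; apply: no.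
by exists s.
Qed.

Lemma splitsum_single w (G : seq nat -> seq nat -> K) u0 v0 : size u0 = size w -> size v0 = size w ->
  (forall a, nth 0%N w a = (nth 0%N u0 a + nth 0%N v0 a)%N) ->
  (forall u v, size u = size w -> size v = size w ->
    (forall a, nth 0%N w a = (nth 0%N u a + nth 0%N v a)%N) -> G u v != 0 -> u = u0) ->
  splitsum w G = G u0 v0.
Proof.
elim: w G u0 v0 => [|i w IH] G [|s0 u0] [|t0 v0] //= [su] [sv] n0 uniq0.
have i0 : i = (s0 + t0)%N by exact: (n0 0%N).
have nw a := n0 a.+1; rewrite /= in nw.
have si : (s0 < i.+1)%N by lia.
rewrite (bigD1 (Ordinal si)) //= [X in _ + X]big1 ?addr0.
  rewrite (IH _ u0 v0) //; first by rewrite i0 addKn.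
  move=> u v su' sv' nuv G0.
  have /= := uniq0 (s0 :: u) ((i - s0)%N :: v); rewrite su' sv'.
  move=> /(_ erefl erefl) h; have [] // : s0 :: u = s0 :: u0.
  by apply: h => // -[|a] //=; lia.
move=> s ss; apply/eqP/negP => /negP /splitsum_neq0[u [v [su' sv' nuv G0]]].
have le_si : (s <= i)%N by rewrite -ltnS.
have /= := uniq0 ((s : nat) :: u) ((i - s)%N :: v); rewrite su' sv'.
move=> /(_ erefl erefl) h; move/eqP: ss; case; apply: val_inj => /=.
have [] // : (s : nat) :: u = s0 :: u0.
by apply: h => // -[|a] //=; lia.
Qed.

Lemma coef_pairpoly f pre post d s : (pairpoly f pre post d)`_s =
  if (s <= d)%N then f (pre ++ [:: (d - s)%N, s & post]) else 0.
Proof. by rewrite coef_poly ltnS. Qed.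

Lemma coef_pairpolyM f g u u' v v' d s :
  (\sum_(e < d.+1) pairpoly f u u' e * pairpoly g v v' (d - e))`_s =
  if (s <= d)%N then \sum_(t < (d - s).+1) \sum_(k < s.+1)
    f (u ++ [:: t : nat, k : nat & u']) * g (v ++ [:: (d - s - t)%N, (s - k)%N & v'])
  else 0.
Proof.
rewrite coef_sum; under eq_bigr => e _ do rewrite coefM.
rewrite exchange_big /=; case: leqP => sd; last first.
  rewrite big1 // => k _; rewrite big1 // => e _; rewrite !coef_pairpoly.
  case: leqP => ke; rewrite ?mul0r //; case: leqP => ske; rewrite ?mulr0 //.
  by have := ltn_ord k; have := ltn_ord e; lia.
rewrite [RHS]exchange_big /=; apply: eq_bigr => k _.
have ks : (k <= s)%N by rewrite -ltnS.
pose H e := (pairpoly f u u' e)`_k * (pairpoly g v v' (d - e))`_(s - k).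
transitivity (\sum_(0 <= e < d.+1) H e); first by rewrite big_mkord.
rewrite (@big_cat_nat _ _ _ k) //=; last by lia.
rewrite (@big_cat_nat _ _ _ (k + (d - s).+1) k) //=; [|lia|lia].
rewrite [X in X + _]big_nat [X in X + _]big1 ?add0r => [|e /andP[_ ek]]; last first.
  by rewrite /H coef_pairpoly leqNgt ek mul0r.
rewrite [X in _ + X]big_nat [X in _ + X]big1 ?addr0 => [|e /andP[ke ed]]; last first.
  rewrite /H [X in _ * X]coef_pairpoly; case: leqP => h; rewrite ?mulr0 //; lia.
have shift : \sum_(k <= e < k + (d - s).+1) H e = \sum_(t < (d - s).+1) H (t + k)%N.
  by rewrite -{1}[k : nat]add0n big_addn addKn big_mkord.
rewrite shift; apply: eq_bigr => t _; have tds : (t <= d - s)%N by rewrite -ltnS.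
rewrite /H !coef_pairpoly leq_addl addnK.
have -> : (s - k <= d - (t + k))%N by lia.
by have -> : (d - (t + k) - (s - k) = d - s - t)%N by lia.
Qed.

(** The homogeneous components of a product. *)
Lemma pairpoly_wconv f g pre post d : pairpoly (wconv f g) pre post d =
  splitsum pre (fun u v => splitsum post (fun u' v' =>
    \sum_(e < d.+1) pairpoly f u u' e * pairpoly g v v' (d - e))).
Proof.
apply/polyP => s; rewrite -[RHS]/(coefp s _) !splitsum_map.
under eq_splitsum => u v do rewrite splitsum_map.
rewrite coef_pairpoly; case: ifP => sd; last first.
  apply/esym; apply: (splitsum_closed (P := fun x => x = 0)) => // [x y -> ->|u v].
    by rewrite addr0.
  apply: (splitsum_closed (P := fun x => x = 0)) => // [x y -> ->|u' v'].
    by rewrite addr0.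
  by rewrite /= coef_pairpolyM sd.
rewrite /wconv splitsum_cat /=; apply: eq_splitsum => u v.
under [RHS]eq_splitsum => u' v' do rewrite coef_pairpolyM sd.
rewrite (@splitsum_sum _ _ (fun t u' v' => \sum_(k < s.+1)
  f (u ++ [:: t, k : nat & u']) * g (v ++ [:: (d - s - t)%N, (s - k)%N & v']))).
apply: eq_bigr => t _; rewrite (@splitsum_sum _ _ (fun k u' v' =>
  f (u ++ [:: t : nat, k & u']) * g (v ++ [:: (d - s - t)%N, (s - k)%N & v']))).
by apply: eq_bigr.
Qed.

(** In each pair of adjacent variables the powers of the difference add up. *)
Lemma vanishing_wconv p q f g : vanishing p f -> vanishing q g -> vanishing (p + q) (wconv f g).
Proof.
move=> [fs fd] [gs gd]; split=> [pre s t post|pre post d].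
  rewrite /wconv !splitsum_cat splitsum_scale; apply: eq_splitsum => u v /=.
  rewrite exchange_big mulr_sumr; apply: eq_bigr => t' _.
  rewrite mulr_sumr; apply: eq_bigr => s' _.
  rewrite splitsum_scale; apply: eq_splitsum => u' v' /=.
  by rewrite fs gs exprD mulrACA.
pose D (P : {poly K}) := is_true (('X - 1%:P) ^+ (p + q) %| P).
have D0 : D 0 by exact: dvdp0.
have DD x y : D x -> D y -> D (x + y) by exact: dvdp_add.
rewrite pairpoly_wconv; apply: (splitsum_closed (P := D)) => // u v.
apply: (splitsum_closed (P := D)) => // u' v'.
apply: (big_ind D) => // e _.
by rewrite /D exprD; apply: dvdp_mul.
Qed.

End WordFunctions.

(** * Functionals led by a standard word *)
Section Alternating.
Variables (K : fieldType).
Hypothesis char0 : forall n : nat, n.+1%:R != 0 :> K.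

(** The coefficient function of the antisymmetrisation of z^j. *)
Definition detword (j u : seq nat) : K :=
  if size u == size j then
    \det (\matrix_(a < size j, b < size j) (nth 0%N u a == nth 0%N j b)%:R)
  else 0.

Lemma detword_swap j pre s t post : detword j (pre ++ [:: s, t & post]) =
  - detword j (pre ++ [:: t, s & post]).
Proof.
rewrite /detword; have -> : size (pre ++ [:: s, t & post]) = size (pre ++ [:: t, s & post]).
  by rewrite !size_cat.
case: eqP => [sz|_]; last by rewrite oppr0.
have l0 : (size pre < size j)%N by rewrite -sz size_cat /=; lia.
have l1 : ((size pre).+1 < size j)%N by rewrite -sz size_cat /=; lia.
pose A := Ordinal l0; pose B := Ordinal l1.
have AB : A != B by rewrite -val_eqE /= neq_ltn ltnSn.
set M' := (X in - \det X).
transitivity (\det (xrow A B M')).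
  congr (\det _); apply/matrixP => a b; rewrite !mxE; congr (_ == _)%:R.
  rewrite permE /=; case: (eqVneq a A) => [->|aA].
    by rewrite !nth_cat ltnn subnn /= ltnNge leqnSn /= subSnn.
  case: (eqVneq a B) => [->|aB].
    by rewrite !nth_cat ltnn subnn /= ltnNge leqnSn /= subSnn.
  rewrite !nth_cat; case: ltnP => // ap.
  have {aA}aA : (a : nat) != size pre by [].
  have {aB}aB : (a : nat) != (size pre).+1 by [].
  by have -> : (a - size pre = (a - size pre - 2).+2)%N by lia.
by rewrite xrowE det_mulmx det_perm odd_tperm AB expr1 mulN1r.
Qed.

Lemma detword_vanishing j : vanishing 1 (detword j).
Proof.
split=> [pre s t post|pre post d]; first by rewrite expr1 mulN1r; exact: detword_swap.
rewrite expr1 dvdp_XsubCl /root; set P := pairpoly _ _ _ _.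
have PE : P.[1] = \sum_(s < d.+1) detword j (pre ++ [:: (d - s)%N, s : nat & post]).
  rewrite /P /pairpoly horner_poly; apply: eq_bigr => s _.
  by rewrite expr1n mulr1.
have : P.[1] = - P.[1].
  rewrite {1}PE (reindex_inj rev_ord_inj) PE -sumrN; apply: eq_bigr => s _ /=.
  have sd : (s <= d)%N by rewrite -ltnS.
  by rewrite subSS subKn // detword_swap.
move/eqP; rewrite -addr_eq0 -mulr2n -mulr_natr mulf_eq0.
by rewrite (negPf (char0 1)) orbF.
Qed.

Lemma detword_neq0 j u : detword j u != 0 -> size u = size j /\
  exists sg : 'S_(size j), forall a : 'I_(size j), nth 0%N u a = nth 0%N j (sg a).
Proof.
rewrite /detword; case: (size u =P size j) => [sz dn|_]; last by rewrite eqxx.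
split=> //; apply: contrapT => no; move/negP: dn; apply; apply/eqP.
rewrite /determinant big1 // => sg _; apply/eqP; rewrite mulf_eq0; apply/orP; right.
have [a ua] : exists a : 'I_(size j), nth 0%N u a != nth 0%N j (sg a).
  apply: contrapT => no'; apply: no; exists sg => a; apply/eqP/negP => /negP h.
  by apply: no'; exists a.
by rewrite (bigD1 a) //= mxE (negPf ua) mul0r.
Qed.

Definition psum (t : nat) (w : seq nat) : nat := \sum_(a < t) nth 0%N w a.

Lemma psum_eq u w : size u = size w -> (forall t, (t <= size u)%N -> psum t u = psum t w) -> u = w.
Proof.
move=> sz pu; apply: (@eq_from_nth _ 0%N) => // a au.
have := pu a.+1 au; have := pu a (ltnW au).
by rewrite /psum !big_ord_recr /= => -> /addnI.
Qed.

(** Compare both sums with the truncation x |-> c - x at the t-th entry c: summed over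
    all entries it is the same for a word and for its rearrangements, and in the
    nondecreasing word only the first t entries contribute to it. *)
Lemma psum_perm (j u : seq nat) (sg : 'S_(size j)) t : size u = size j ->
  {in [pred a | a < size j]%N &, {homo nth 0%N j : a b / (a <= b)%N}} ->
  (forall a : 'I_(size j), nth 0%N u a = nth 0%N j (sg a)) ->
  (psum t j <= psum t u)%N.
Proof.
move=> sz jm us.
have clip w : size w = size j -> psum t w = \sum_(a < size j | (a < t)%N) nth 0%N w a.
  move=> sw; rewrite /psum; case: (leqP t (size j)) => tj.
    by rewrite (big_ord_widen _ (fun a => nth 0%N w a) tj).
  rewrite -(big_mkord xpredT (fun a => nth 0%N w a)).
  rewrite (@big_cat_nat _ _ _ (size j)) //=; last exact: ltnW.
  rewrite [X in (_ + X)%N]big_nat [X in (_ + X)%N]big1 ?addn0 => [|a /andP[aj _]]; last first.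
    by rewrite nth_default // sw.
  by rewrite big_mkord; apply: eq_bigl => a; rewrite (leq_trans (ltn_ord a)) // ltnW.
rewrite !clip //; case: t clip => [|t] clip; first by rewrite !big_pred0.
case: (ltnP t (size j)) => tj; last first.
  have all_t (a : 'I_(size j)) : (a < t.+1)%N = xpredT a.
    by rewrite ltnS (leq_trans (ltnW (ltn_ord a))).
  rewrite !(eq_bigl _ _ all_t).
  rewrite (reindex_inj (@perm_inj _ sg)) /=.
  by rewrite leq_eqVlt; apply/orP; left; apply/eqP; apply: eq_bigr => a _; rewrite us.
pose c := nth 0%N j t.
pose S w := (\sum_(a < size j | (a < t.+1)%N) nth 0%N w a)%N.
pose T w := (\sum_(a < size j) (c - nth 0%N w a))%N.
pose C := (\sum_(a < size j | (a < t.+1)%N) c)%N.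
have Tu : T u = T j.
  rewrite /T [RHS](reindex_inj (@perm_inj _ sg)); apply: eq_bigr => a _.
  by rewrite us.
have Sj : (S j + T j = C)%N.
  rewrite /T (bigID (fun a : 'I_(size j) => (a < t.+1)%N)) /=.
  rewrite [X in (_ + (_ + X))%N]big1 ?addn0 => [|a ta]; last first.
    by apply/eqP; rewrite subn_eq0; apply: jm; rewrite ?inE //; lia.
  rewrite /S -big_split /=; apply: eq_bigr => a ta.
  by rewrite subnKC //; apply: jm; rewrite ?inE.
have Su : (C <= S u + T u)%N.
  rewrite /T (bigID (fun a : 'I_(size j) => (a < t.+1)%N)) /= addnA.
  apply: leq_trans (leq_addr _ _); rewrite /S /C -big_split /=.
  by apply: leq_sum => a _; lia.
by rewrite -[X in (X <= _)%N]/(S j) -[X in (_ <= X)%N]/(S u); lia.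
Qed.

(** Dominance of the support: products of antisymmetrised monomials are unitriangular
    with respect to the prefix sums of the exponents. *)
Definition led_by (lo hi : nat) (w0 : seq nat) (Q : seq nat -> K) : Prop :=
  Q w0 = 1 /\ forall w, Q w != 0 ->
    [/\ size w = size w0, forall t, (psum t w0 <= psum t w)%N
      & forall a, (a < size w0)%N -> (lo <= nth 0%N w a <= hi)%N].

Definition increasing (j : seq nat) : Prop :=
  forall a, (a.+1 < size j)%N -> (nth 0%N j a < nth 0%N j a.+1)%N.

Lemma increasing_homo j a b : increasing j -> (a < b < size j)%N ->
  (nth 0%N j a < nth 0%N j b)%N.
Proof.
move=> ji; elim: b => [|b IH] /andP[]; first by rewrite ltn0.
rewrite ltnS leq_eqVlt => /orP[/eqP ->|ab] bj; first exact: ji.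
by apply: ltn_trans (ji _ bj); apply: IH; rewrite ab ltnW.
Qed.

Lemma detword_led_by j : increasing j ->
  led_by (nth 0%N j 0) (nth 0%N j (size j).-1) j (detword j).
Proof.
move=> ji; have jm : {in [pred a | a < size j]%N &, {homo nth 0%N j : a b / (a <= b)%N}}.
  move=> a b _ bj; rewrite leq_eqVlt => /orP[/eqP -> //|ab].
  by apply/ltnW/increasing_homo => //; rewrite ab.
split=> [|w /detword_neq0[sz [sg us]]].
  rewrite /detword eqxx -[RHS](det1 _ (size j)); congr (\det _).
  apply/matrixP => a b; rewrite !mxE; congr (_%:R); congr nat_of_bool.
  apply/eqP/eqP => [E|->//]; apply: val_inj => /=.
  case: (ltngtP a b) => // h; have := increasing_homo ji (a := minn a b) (b := maxn a b);
    rewrite /minn /maxn ?h ?(ltnNge a b) ?(ltnW h) /= ?h ltn_ord => /(_ isT); by rewrite E ltnn.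
split=> // [t|a aj]; first exact: psum_perm us.
rewrite (us (Ordinal aj)).
have s0 := ltn_ord (sg (Ordinal aj)).
by apply/andP; split; apply: jm; rewrite ?inE //; lia.
Qed.

Lemma wconv_led_by lo hi lo' hi' f g u0 v0 w0 : size u0 = size v0 -> size w0 = size v0 ->
  (forall a, nth 0%N w0 a = (nth 0%N u0 a + nth 0%N v0 a)%N) ->
  led_by lo hi u0 f -> led_by lo' hi' v0 g -> led_by (lo + lo') (hi + hi') w0 (wconv f g).
Proof.
move=> su sw wE [f0 fl] [g0 gl].
have psumD t w u v : (forall a, nth 0%N w a = (nth 0%N u a + nth 0%N v a)%N) ->
    psum t w = (psum t u + psum t v)%N.
  by move=> h; rewrite /psum -big_split; apply: eq_bigr => a _.
split.
  rewrite /wconv (@splitsum_single _ _ _ u0 v0) ?f0 ?g0 ?mulr1 ?su ?sw //.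
  move=> u v szu szv wuv; rewrite mulf_eq0 negb_or => /andP[/fl[su' fp _] /gl[sv' gp _]].
  apply: psum_eq => // t _; have := psumD t _ _ _ wuv; rewrite (psumD t _ _ _ wE).
  by have := fp t; have := gp t; lia.
move=> w /splitsum_neq0[u [v [szu szv wuv]]].
rewrite mulf_eq0 negb_or => /andP[/fl[su' fp fr] /gl[sv' gp gr]]; split.
- by rewrite -szu su' su sw.
- by move=> t; rewrite (psumD t _ _ _ wE) (psumD t _ _ _ wuv) leq_add.
- move=> a; rewrite sw => av; rewrite wuv.
  by have := fr a; have := gr a av; rewrite su => h /(_ av); lia.
Qed.

(** Multiply the antisymmetrisation of z^j, where j_a = w_a - (p - 1) a, by the
    (p - 1)-st power of the Vandermonde determinant. *)
Lemma led_exists p (w : seq nat) : (0 < p)%N ->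
  (forall a, (a.+1 < size w)%N -> (nth 0%N w a + p <= nth 0%N w a.+1)%N) ->
  exists Q, vanishing p Q /\ led_by (nth 0%N w 0) (nth 0%N w (size w).-1) w Q.
Proof.
case: p => // p _; elim: p w => [|p IH] w wg.
  exists (detword w); split; first exact: detword_vanishing.
  by apply: detword_led_by => a /wg; rewrite addn1.
pose v := mkseq (fun a => nth 0%N w a - a)%N (size w).
have wa a : (a < size w)%N -> (a <= nth 0%N w a)%N.
  elim: a => // a IHa aw; have := wg a aw; have := IHa (ltnW aw); lia.
have szv : size v = size w by rewrite size_mkseq.
have [a /[!szv] aw|g [gv gl]] := IH v.
  rewrite !nth_mkseq ?(ltnW aw) //.
  by have := wg a aw; have := wa _ aw; have := wa _ (ltnW aw); lia.
pose rho := iota 0 (size w).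
have rho_inc : increasing rho.
  by move=> a; rewrite size_iota => aw; rewrite !nth_iota ?(ltnW aw).
exists (wconv (detword rho) g); split.
  by rewrite -[p.+2]/(1 + p.+1)%N; apply: vanishing_wconv => //; exact: detword_vanishing.
have wE a : nth 0%N w a = (nth 0%N rho a + nth 0%N v a)%N.
  case: (ltnP a (size w)) => aw; last by rewrite !nth_default ?size_iota ?szv.
  by rewrite nth_iota // nth_mkseq // add0n subnKC // wa.
have dl := detword_led_by rho_inc; rewrite size_iota in dl; rewrite szv in gl.
rewrite !wE; apply: (wconv_led_by _ _ wE dl gl); by rewrite ?size_iota szv.
Qed.

End Alternating.

(** * Independence of the standard monomials *)
Section Model.
Variables (K : fieldType) (p B : nat).
Hypothesis char0 : forall n : nat, n.+1%:R != 0 :> K.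

(** The dual of the algebra of the coefficients of a polynomial field of degree
    less than B; the i-th coefficient acts by prescribing a first letter. *)
Definition in_model (phi : seq nat -> K^o) : Prop :=
  vanishing p (phi : seq nat -> K) /\ forall w, ~~ all (fun i => i < B)%N w -> phi w = 0.

Lemma pairpolyZD c (phi psi : seq nat -> K^o) pre post d :
  pairpoly (c *: phi + psi : seq nat -> K^o) pre post d =
  c *: pairpoly (phi : seq nat -> K) pre post d + pairpoly (psi : seq nat -> K) pre post d.
Proof.
apply/polyP => s; rewrite coefD coefZ !coef_pairpoly.
by case: ifP => _; rewrite ?mulr0 ?addr0.
Qed.

Lemma in_model_subspace : is_subspace in_model.
Proof.
split.
  split=> //; split=> [*|pre post d]; first by rewrite mulr0.
  rewrite (_ : pairpoly _ _ _ _ = 0) ?dvdp0 //.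
  by apply/polyP => s; rewrite coef_pairpoly coef0; case: ifP.
move=> c phi psi [[s1 d1] b1] [[s2 d2] b2]; split; last first.
  move=> w wB; rewrite -[LHS]/(c *: phi w + psi w).
  by rewrite b1 // b2 // scaler0 addr0.
split=> [pre s t post|pre post d].
  rewrite -[LHS]/(c * phi (pre ++ [:: s, t & post]) + psi (pre ++ [:: s, t & post])).
  by rewrite s1 s2 mulrCA -mulrDr.
apply: (eq_ind_r (fun P : {poly K} => is_true (_ %| P)) _ (pairpolyZD c phi psi pre post d)).
by apply: dvdp_add; rewrite // -mul_polyC dvdp_mull.
Qed.

Definition model := subsp in_model_subspace.

Lemma in_model_letter i phi : in_model phi -> in_model (fun w => phi (i :: w)).
Proof.
move=> [[sp dp] bp]; split=> [|w wB]; last by apply: bp; rewrite /= negb_and wB orbT.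
split=> [pre s t post|pre post d]; first exact: (sp (i :: pre)).
exact: (dp (i :: pre)).
Qed.

Definition letter i (phi : model) : model :=
  subin in_model_subspace (in_model_letter i (subval_in phi)).

Definition model_par (b : bool) (phi : model) : Prop :=
  forall w, odd p && odd (size w) != b -> subval phi w = 0.

Lemma model_eq (phi psi : model) : subval phi =1 subval psi -> phi = psi.
Proof. by move=> E; apply: subval_inj; apply/funext. Qed.

Lemma letter_linear i : linear (letter i).
Proof. by move=> c phi psi; exact: model_eq. Qed.

Lemma in_model_scale (c : nat -> K) phi : in_model phi ->
  in_model (fun w => c (size w) * phi w).
Proof.
move=> [[sp dp] bp]; split=> [|w wB]; last by rewrite bp // mulr0.
split=> [pre s t post|pre post d].
  rewrite sp mulrCA; congr (_ * (c _ * _)); by rewrite !size_cat.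
suff -> : pairpoly (fun w => c (size w) * phi w) pre post d =
    c (size pre + (size post).+2)%N *: pairpoly (phi : seq nat -> K) pre post d.
  by rewrite -mul_polyC dvdp_mull.
apply/polyP => s; rewrite coefZ !coef_pairpoly; case: ifP => _; rewrite ?mulr0 //.
by rewrite size_cat.
Qed.

Lemma model_grading : is_grading model_par.
Proof.
apply: is_grading_bool => [b|phi|phi p0 p1].
- apply: subspace_pair => [w _|phi psi h1 h2 w wb|c phi h w wb] //.
    by rewrite -[LHS]/(subval phi w + subval psi w) h1 // h2 // addr0.
  by rewrite -[LHS]/(c *: subval phi w) h // scaler0.
- pose pick b := subin in_model_subspace
    (in_model_scale (fun n => ((odd p && odd n) == b)%:R) (subval_in phi)).
  exists (pick false), (pick true); split.
  + by move=> w wb; rewrite /= (negPf wb) mul0r.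
  + by move=> w wb; rewrite /= (negPf wb) mul0r.
  + apply: model_eq => w.
    rewrite -[RHS]/((_ == _)%:R * subval phi w + (_ == _)%:R * subval phi w).
    by case: (odd p && odd (size w)); rewrite /= mul0r mul1r ?addr0 ?add0r.
- apply: model_eq => w; case E : (odd p && odd (size w)).
    by rewrite p0 ?E.
  by rewrite p1 ?E.
Qed.

Lemma letter_par i b phi : model_par b phi -> model_par (odd p (+) b) (letter i phi).
Proof.
move=> h w wb; apply: h => /=; move: wb.
by case: (odd p); case: (odd (size w)); case: b.
Qed.

Lemma letter_comm s t phi :
  letter s (letter t phi) = letter t (letter s phi) *~ (-1) ^+ odd p.
Proof.
have [[sp _] _] := subval_in phi; apply: model_eq => w.
rewrite -scaler_int -[LHS]/(subval phi ([::] ++ [:: t, s & w])) sp.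
rewrite -[RHS]/(_ * subval phi [:: s, t & w]); congr (_ * _).
by rewrite -signr_odd; case: (odd p).
Qed.

Lemma letter_rel i d phi : (i < p)%N ->
  \sum_(s < d.+1) letter s (letter (d - s) phi) *+ 'C(s, i) = 0.
Proof.
move=> ip; have [vp _] := subval_in phi; apply: model_eq => w.
rewrite raddf_sum fct_sumE -[RHS](vanishing_taylor [::] w d vp ip).
have Mn (f : seq nat -> K^o) e v : (f *+ e) v = f v *+ e.
  by elim: e => // e IH; rewrite !mulrS -IH.
by apply: eq_bigr => s _; rewrite raddfMn Mn.
Qed.

Lemma letter_ge i phi : (B <= i)%N -> letter i phi = 0.
Proof.
have [_ bp] := subval_in phi; move=> Bi; apply: model_eq => w /=.
by apply: bp; rewrite /= ltnNge Bi.
Qed.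

Lemma foldr_letter s phi :
  subval (foldr letter phi s) [::] = subval phi (rev s).
Proof.
suff E w : subval (foldr letter phi s) w = subval phi (rev s ++ w) by rewrite E cats0.
by elim: s w => [|i s IH] w //=; rewrite IH rev_cons cat_rcons.
Qed.

End Model.

Section Independence.
Variables (K : fieldType) (p : nat) (F : freeVA K p).
Hypothesis char0 : forall n : nat, n.+1%:R != 0 :> K.
Hypothesis p_gt0 : (0 < p)%N.
Variables (k m : int) (M : freeRep F k m).

(** The exponents of z in Y(a, z)v run from max(m, 0), included, to max(k - 1, 0),
    excluded. *)
Definition low_letter : nat := absz (Num.max m 0).
Definition letter_bound (k : int) : nat := absz (Num.max (k - 1) 0).

Let mu := low_letter.
Let n := letter_bound k.

(** The functional led by s lies in the model, and the universal property of M_k(m)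
    maps v to it; the value at the empty word is the required linear form. *)
Lemma standard_functional s : standard p mu n s ->
  exists (Q : seq nat -> K) (phi : fr_res M -> K),
  [/\ led_by (nth 0%N (rev s) 0) (nth 0%N (rev s) (size s).-1) (rev s) Q,
      linear (phi : fr_res M -> K^o)
    & forall t, phi (word t (fr_vec M)) = Q (rev t)].
Proof.
move=> /andP[ss sa].
have sa' : all (fun i => mu <= i < n)%N (rev s) by rewrite all_rev.
have rng a : (a < size s)%N -> (mu <= nth 0%N (rev s) a < n)%N.
  by move=> as_; apply: (all_nthP 0%N sa'); rewrite size_rev.
have gap a : (a.+1 < size (rev s))%N -> (nth 0%N (rev s) a + p <= nth 0%N (rev s) a.+1)%N.
  by apply: (sortedP (e := fun x y => x + p <= y)%N); rewrite rev_sorted.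
have [Q [Qv Ql]] := led_exists char0 p_gt0 gap; rewrite size_rev in Ql.
have Qn0 w : Q w != 0 -> size w = size s /\ forall a, (a < size s)%N -> (mu <= nth 0%N w a < n)%N.
  move=> /Ql.2[]; rewrite size_rev => sw _ lh; split=> // a as_.
  have s0 : (0 < size s)%N by exact: leq_ltn_trans as_.
  have s1 : ((size s).-1 < size s)%N by rewrite prednK.
  by have := lh a as_; have := rng _ s0; have := rng _ s1; lia.
have Qm : in_model p n (Q : seq nat -> K^o).
  split=> // w; apply: contraNeq => /Qn0[sw wr].
  by apply/(all_nthP 0%N) => a; rewrite sw => /wr/andP[].
pose q : model K p n := subin (in_model_subspace K p n) Qm.
have [N [i [j [jK iK jpar Npos Nneg]]]] := fields_F_module char0 (model_grading K p n)
  (@letter_linear K p n) (@letter_par K p n) (@letter_comm K p n) (@letter_rel K p n) F.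
have Nb : bounded k N.
  move=> e u; split; last exact: Npos.
  case E : (- k - e%:Z) => [e'|e']; first exact: Npos.
  apply: (can_inj iK); rewrite Nneg letter_ge ?raddf0 //.
  by rewrite /n /letter_bound; lia.
have qh : vm_homogeneous (j q).
  exists (odd p && odd (size s)); apply: jpar => w wb /=.
  by apply/eqP; apply: contraTT wb => /Qn0[-> _]; rewrite negbK.
have qa (e : nat) : vact (- m + e%:Z) (fgen F) (j q) = 0.
  case E : (- m + e%:Z) => [e'|e']; first exact: Npos.
  apply: (can_inj iK); rewrite Nneg jK raddf0; apply: model_eq => w /=.
  apply/eqP; apply: contraT => /Qn0[sw /(_ 0%N)].
  rewrite -sw /= /mu /low_letter => /(_ isT); lia.
have [h hv] := fr_universal M Nb qh qa.
exists Q, (fun u => subval (i (h u)) [::]); split=> //.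
  by move=> c u v; rewrite !linearP.
move=> t; have E : i (h (word t (fr_vec M))) = foldr (@letter K p n) q t.
  by elim: t => [|x t IH] /=; [rewrite hv jK | rewrite vmodHom_vact Nneg IH].
by rewrite E foldr_letter.
Qed.

Theorem standard_independent (r : seq (seq nat)) (c : seq nat -> K) :
  uniq r -> {in r, forall s, standard p mu n s} ->
  \sum_(s <- r) c s *: word s (fr_vec M) = 0 -> {in r, forall s, c s = 0}.
Proof.
move=> ur rs r0.
(* Descending induction on a numerical function refining the dominance order. *)
pose h s := (\sum_(t < (size s).+1) psum t (rev s))%N.
pose T := (\sum_(s <- r) h s)%N.
have hT s : s \in r -> (h s <= T)%N by move=> sr; rewrite /T (big_rem s) //= leq_addr.
move=> s sr; have [N] := ubnP (T - h s)%N; elim: N s sr => // N IH s sr sN.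
have [Q [phi [[Q1 Ql] phil phiw]]] := standard_functional (rs s sr).
have phi0 : phi 0 = 0.
  have := phil (- 1) 0 0; rewrite scaler0 addr0 => ->.
  by rewrite scaleN1r addNr.
have phiD u v : phi (u + v) = phi u + phi v.
  by have := phil 1 u v; rewrite !scale1r.
have phiZ d u : phi (d *: u) = d * phi u.
  by have := phil d u 0; rewrite !addr0 phi0 addr0.
have : phi (\sum_(s <- r) c s *: word s (fr_vec M)) = 0 by rewrite r0.
have -> : phi (\sum_(s <- r) c s *: word s (fr_vec M)) = \sum_(s <- r) c s * Q (rev s).
  elim: (r) => [|t r' IH']; first by rewrite !big_nil.
  by rewrite !big_cons phiD phiZ phiw IH'.
rewrite (bigD1_seq s) //= Q1 mulr1 big_seq_cond big1 ?addr0 // => t /andP[tr ts].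
apply/eqP; rewrite mulf_eq0 -implyNb; apply/implyP => ct.
apply: contraT => /Ql[]; rewrite !size_rev => szt pst _.
have hst : (h s <= h t)%N.
  by rewrite /h szt; apply: leq_sum => e _; exact: pst.
have [hlt|hge] := ltnP (h s) (h t).
  by move: ct; rewrite IH ?eqxx //; have := hT t tr; lia.
have heq : h s = h t by lia.
case/negP: ts; apply/eqP; apply: (can_inj revK); apply/esym.
apply: psum_eq; rewrite ?size_rev // => e es.
apply/eqP; rewrite eqn_leq pst /=; apply: contraT; rewrite -ltnNge => lt_e.
suff : (h s < h t)%N by rewrite heq ltnn.
have es' : (e < (size s).+1)%N by [].
rewrite /h szt (bigD1 (Ordinal es')) //= [X in (_ < X)%N](bigD1 (Ordinal es')) //=.
by rewrite -addSn leq_add // leq_sum.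
Qed.

End Independence.

(** * The bigrading *)
Section Twist.
Variables (K : fieldType) (t : K).
Hypothesis t0 : t != 0.

Definition twist_factor (n : int) : K := t ^ (- n - 1).

(** Both sides of the Borcherds identity are homogeneous for the degree of modes,
    hence the identity survives rescaling x(n) by t^(-n-1). *)
Lemma borcherds_twist (V W M : lmodType K) (np : int -> V -> V -> V)
    (np' : int -> W -> W -> W) (par : bool -> set V) (par' : bool -> set W)
    (act : int -> V -> M -> M) (act' : int -> W -> M -> M) (phi : W -> V) :
  (forall n c x u, act n (c *: x) u = c *: act n x u) ->
  (forall n x c u, act n x (c *: u) = c *: act n x u) ->
  (forall n x u, act' n x u = twist_factor n *: act n (phi x) u) ->
  (forall n x y, phi (np' n x y) = twist_factor n *: np n (phi x) (phi y)) ->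
  (forall i x, par' i x -> par i (phi x)) ->
  borcherds act np par -> borcherds act' np' par'.
Proof.
move=> actZl actZr act'E np'E phip bor i j x y xi yj u l m n.
have [N0 bN] := bor i j _ _ (phip _ _ xi) (phip _ _ yj) u l m n; exists N0 => N /bN E.
have tw2 a b : a + b = l + m + n -> twist_factor a * twist_factor b = t ^ (- (l + m + n) - 2).
  move=> ab; rewrite /twist_factor -expfzDr //; congr (_ ^ _); lia.
have zE z w a b : a + b = m + n -> zwcoef act' l z w a b u N =
    t ^ (- (l + m + n) - 2) *: zwcoef act l (phi z) (phi w) a b u N.
  move=> ab; rewrite /zwcoef scaler_sumr; apply: eq_bigr => h _.
  by rewrite !act'E actZr scalerA tw2 ?scalerMzr //; lia.
rewrite !zE //; last by rewrite addrC.
rewrite scalerMzr -scalerBr -E scaler_sumr; apply: eq_bigr => h _.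
by rewrite act'E np'E actZl scalerA tw2 ?scalerMzr //; lia.
Qed.

Section TwistAlgebra.
Variables (V : vertexSuperalgebra K).

Definition tnprod n (x y : V) : V := twist_factor n *: nprod n x y.

Lemma twist_factor_neq0 n : twist_factor n != 0.
Proof. exact: expfz_neq0. Qed.

Fact tnprod_linr n x : linear (tnprod n x).
Proof.
by move=> c y z; rewrite /tnprod nprod_linr scalerDr !scalerA mulrC.
Qed.
Fact tnprod_linl n y : linear (fun x => tnprod n x y).
Proof.
by move=> c x z; rewrite /tnprod nprod_linl scalerDr !scalerA mulrC.
Qed.
Fact tnprod_trunc x y : exists N : int, forall n, (N <= n)%R -> tnprod n x y = 0.
Proof.
by have [N hN] := nprod_trunc x y; exists N => n /hN; rewrite /tnprod => ->; rewrite scaler0.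
Qed.
Fact tnprod_par i j n x y : va_par i x -> va_par j y -> va_par (i (+) j) (tnprod n x y).
Proof.
move=> xi yj; apply: subspaceZ; first exact: grading_sub (va_par_grading V) _.
exact: nprod_par.
Qed.
Fact tnprod_vacl n x : tnprod n (vac V) x = if n == -1 then x else 0.
Proof.
rewrite /tnprod nprod_vacl; case: eqP => [->|_]; last exact: scaler0.
by rewrite /twist_factor opprK subrr expr0z scale1r.
Qed.
Fact tnprod_vacr x : tnprod (-1) x (vac V) = x.
Proof. by rewrite /tnprod nprod_vacr /twist_factor opprK subrr expr0z scale1r. Qed.
Fact tnprod_vacr_ge0 (n : nat) x : tnprod n%:Z x (vac V) = 0.
Proof. by rewrite /tnprod nprod_vacr_ge0 scaler0. Qed.
Fact tnprod_borcherds : borcherds tnprod tnprod (@va_par K V).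
Proof.
apply: (@borcherds_twist _ _ _ (@nprod K V) _ (@va_par K V) _ (@nprod K V) _ id) => //.
- exact: nprodZl.
- by move=> n x c u; exact: nprodZr.
- exact: nprod_borcherds.
Qed.

(** The conjugate of V by t^L, for a degree operator L that need not exist
    on V. *)
Definition twistVA : vertexSuperalgebra K :=
  VertexSuperalgebra tnprod_linr tnprod_linl tnprod_trunc (va_par_grading V)
    (vac_even V) tnprod_par tnprod_vacl tnprod_vacr tnprod_vacr_ge0 tnprod_borcherds.

End TwistAlgebra.

Section ScalingAutomorphism.
Variables (p : nat) (F : freeVA K p) (s : K).
Hypothesis s0 : s != 0.
Local Notation a := (fgen F).

Lemma twist_admissible : admissible p (s *: a : twistVA F).
Proof.
have pa : va_par (odd p) (s *: a : twistVA F).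
  apply: subspaceZ; first exact: grading_sub (va_par_grading F) _.
  exact: fgen_par.
split=> //.
  move=> x m n; apply: (mode_symmetric (M := adjoint (twistVA F)) pa m n x erefl) => h.
  rewrite -[LHS]/(twist_factor _ *: nprod (- p%:Z + h%:Z) (s *: a) (s *: a)).
  by rewrite nprodZl nprodZr fgen_square !scaler0.
move=> P Ps P1 Pa Pn; apply: (fgen_gen (F := F)) => //.
  have -> : a = s^-1 *: (s *: a) by rewrite scalerA mulVf // scale1r.
  exact: subspaceZ.
move=> n x y Px Py; have -> : nprod n x y = (twist_factor n)^-1 *: tnprod n x y.
  by rewrite /tnprod scalerA mulVf ?scale1r // twist_factor_neq0.
by apply: subspaceZ => //; exact: (Pn n x y).
Qed.

(** By initiality there is an automorphism acting on a(-n_r)...a(-n_1)1 by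
    s^r t^(n_1 + ... + n_r - r). *)
Lemma scaling_exists : exists phi : {linear F -> F},
  [/\ phi a = s *: a, phi (vac F) = vac F,
      forall n x y, phi (nprod n x y) = twist_factor n *: nprod n (phi x) (phi y)
    & forall i x, va_par i x -> va_par i (phi x)].
Proof.
have [h [ha _]] : exists h : vaHom F (twistVA F), h a = s *: a /\
    forall h' : vaHom F (twistVA F), h' a = s *: a -> h' =1 h.
  have U1 : forall (W : vertexSuperalgebra K) (b : W), admissible p b ->
      exists h : vaHom F W, h a = b /\
      forall h' : vaHom F W, h' a = b -> h' =1 h by case: (F).
  exact/U1/twist_admissible.
exists (h : {linear F -> twistVA F}); split=> //.
- exact: (vaHom_vac h).
- exact: (vaHom_nprod h).
- exact: (vaHom_par h).
Qed.

Section TwistModule.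
Variables (phi : {linear F -> F}).
Hypothesis phi_vac : phi (vac F) = vac F.
Hypothesis phi_nprod : forall n x y, phi (nprod n x y) = twist_factor n *: nprod n (phi x) (phi y).
Hypothesis phi_par : forall i x, va_par i x -> va_par i (phi x).
Variable N : vmodule F.

Definition tvact n (x : F) (u : N) : N := twist_factor n *: vact n (phi x) u.

Fact tvact_linr n x : linear (tvact n x).
Proof.
by move=> c y z; rewrite /tvact vact_linr scalerDr !scalerA mulrC.
Qed.
Fact tvact_linl n u : linear (fun x => tvact n x u).
Proof.
by move=> c x z; rewrite /tvact linearP vact_linl scalerDr !scalerA mulrC.
Qed.
Fact tvact_trunc x u : exists n0 : int, forall n, (n0 <= n)%R -> tvact n x u = 0.
Proof.
by have [n0 h] := vact_trunc (phi x) u; exists n0 => n /h; rewrite /tvact => ->; rewrite scaler0.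
Qed.
Fact tvact_par i j n x u : va_par i x -> vm_par j u -> vm_par (i (+) j) (tvact n x u).
Proof.
move=> xi uj; apply: subspaceZ; first exact: grading_sub (vm_par_grading N) _.
by apply: vact_par => //; exact: phi_par.
Qed.
Fact tvact_vac n u : tvact n (vac F) u = if n == -1 then u else 0.
Proof.
rewrite /tvact phi_vac vact_vac; case: eqP => [->|_]; last exact: scaler0.
by rewrite /twist_factor opprK subrr expr0z scale1r.
Qed.
Fact tvact_borcherds : borcherds tvact (@nprod K F) (@va_par K F).
Proof.
apply: (@borcherds_twist _ _ _ (@nprod K F) _ (@va_par K F) _ (@vact K F N) _ phi) => //.
- exact: vactZl.
- by move=> n x c u; exact: linearZ_LR.
- exact: vact_borcherds.
Qed.

Definition twist_module : vmodule F :=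
  VModule tvact_linr tvact_linl tvact_trunc (vm_par_grading N) tvact_par
    tvact_vac tvact_borcherds.

End TwistModule.

Hypothesis char0 : forall n : nat, n.+1%:R != 0 :> K.

(** The rescaling of F(p) extends to M_k(m), since the twisted module is still bounded
    and the generator still satisfies the same relations in it. *)
Lemma fr_scaling_exists k m (M : freeRep F k m) : exists L : {linear fr_res M -> fr_res M},
  L (fr_vec M) = fr_vec M /\
  forall n u, L (vact n a u) = (s * twist_factor n) *: vact n a (L u).
Proof.
have [phi [pa pv pn pp]] := scaling_exists.
pose N : vmodule F := twist_module pv pn pp (fr_res M).
have Na n (u : N) : vact n a u = (s * twist_factor n) *: (vact n a (u : fr_res M) : fr_res M) :> fr_res M.
  by rewrite /= /tvact pa vactZl scalerA mulrC.
have bN : bounded k N.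
  move=> n u; have [b1 b2] := fr_bounded char0 n (u : fr_res M).
  by split; apply: etrans (Na _ _) _; rewrite ?b1 ?b2 scaler0.
have [h hv] : exists h : vmodHom (fr_res M) N, h (fr_vec M) = fr_vec M.
  apply: (fr_universal M bN (w := (fr_vec M : N))); first exact: fr_hom.
  by move=> n; apply: etrans (Na _ _) _; rewrite fr_ann scaler0.
exists (h : {linear fr_res M -> N}); split=> // n u.
exact: etrans (vmodHom_vact h n a u) (Na n (h u)).
Qed.

End ScalingAutomorphism.
End Twist.

Section Bigrading.
Variables (K : fieldType) (p : nat) (F : freeVA K p).
Hypothesis char0 : forall n : nat, n.+1%:R != 0 :> K.
Local Notation a := (fgen F).

Lemma natr_inj_char0 (n n' : nat) : n%:R = n'%:R :> K -> n = n'.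
Proof.
wlog le_nn : n n' / (n <= n')%N => [h|].
  by case: (leqP n n') => [/h//|/ltnW /h h' /esym /h' ->].
move=> E; have : (n' - n)%:R = 0 :> K by rewrite natrB // E subrr.
case: (n' - n)%N (subnKC le_nn) => [<-|d _]; first by rewrite addn0.
by move/eqP; rewrite (negPf (char0 d)).
Qed.

Lemma intr_inj_char0 (q q' : int) : q%:~R = q'%:~R :> K -> q = q'.
Proof.
move=> E; have : (q - q')%:~R = 0 :> K by rewrite intrB E subrr.
case D : (q - q') => [d|d].
  by rewrite -pmulrn => /(natr_inj_char0 (n' := 0)) d0; lia.
rewrite NegzE mulrNz -pmulrn => /eqP; rewrite oppr_eq0.
by rewrite (negPf (char0 d)).
Qed.

Lemma two_three_inj (r r' : nat) (q q' : int) :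
  2%:R ^+ r * 3%:R ^ q = 2%:R ^+ r' * 3%:R ^ q' :> K -> r = r' /\ q = q'.
Proof.
(* Multiplying by 3^e makes both exponents nonnegative. *)
pose e := (absz q + absz q')%N => E.
have three0 : 3%:R != 0 :> K := char0 2.
have pos (z : int) (c : nat) : (absz z <= e)%N ->
    2%:R ^+ c * 3%:R ^ z * 3%:R ^+ e = (2 ^ c * 3 ^ absz (z + e%:Z)%R)%N%:R :> K.
  move=> ze; rewrite -mulrA [3%:R ^+ e]exprnP -expfzDr //.
  have -> : z + e%:Z = Posz (absz (z + e%:Z)%R) by lia.
  by rewrite -exprnP absz_nat natrM !natrX.
have : (2 ^ r * 3 ^ absz (q + e%:Z)%R = 2 ^ r' * 3 ^ absz (q' + e%:Z)%R)%N.
  by apply: natr_inj_char0; rewrite -!pos ?E //; rewrite /e; lia.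
move=> E'; have := congr1 (logn 2) E'; have := congr1 (logn 3) E'.
rewrite !lognM ?expn_gt0 // !lognX !(logn_prime _ (_ : prime 2)) //.
rewrite !(logn_prime _ (_ : prime 3)) //= !muln0 !muln1 !addn0 !add0n => e3 e2.
split=> //; lia.
Qed.

Variables (N : vmodule F) (u0 : N) (C D S E : K).
Hypothesis C0 : C != 0.
Local Notation H := (bideg (@vact K F N) a u0 C D S E).

Lemma bideg_subspace b : is_subspace (H b).
Proof. exact: lspan_subspace. Qed.

Lemma bideg_amode b n u : H b u -> H (b.1 + C, b.2 + D - n%:~R - 1) (vact n a u).
Proof.
move: u; apply: lspan_min => [|_ [s [-> b1 b2]]].
  apply: subspace_pair => [|x y|c x].
  - by rewrite linear0; apply: subspace0; exact: bideg_subspace.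
  - by rewrite linearD; apply: subspaceD; exact: bideg_subspace.
  - by rewrite linearZ; apply: subspaceZ; exact: bideg_subspace.
apply: lspan_in; exists (- n :: s); split=> /=.
- by rewrite opprK.
- by rewrite b1 mulrS; ring.
- by rewrite b2 big_cons intrD !mulrS; ring.
Qed.

Lemma monomial_par s : exists i, va_par i (monomial (@nprod K F) a s (vac F)).
Proof.
elim: s => [|n s [i IH]]; first by exists false; exact: vac_even.
by exists (odd p (+) i); apply: nprod_par IH; exact: fgen_par.
Qed.

(** Induction on the monomial: by the Borcherds identity its modes are combinations of
    products of modes of its factors, and the degrees add up. *)
Lemma bideg_monomial s b n u : H b u ->
  H (b.1 + C *+ size s,
     b.2 + (\sum_(i <- s) i)%:~R - (size s)%:R + D *+ size s - n%:~R - 1)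
    (vact n (monomial (@nprod K F) a s (vac F)) u).
Proof.
elim: s b n u => [|n1 s IH] b n u Hu.
  rewrite /= vact_vac big_nil; case: eqP => [->|_].
    by case: b Hu => b1 b2; rewrite /= !mulr0n !addr0 subr0 mulrN1z opprK addrK.
  exact: subspace0 (bideg_subspace _).
have [i pi] := monomial_par s.
rewrite /= -/(monomial (@nprod K F) a s (vac F)); set x := monomial _ _ _ _ in pi IH *.
have [N0 /(_ _ (leqnn _)) ->] := mode_of_nprod (- n1) n u (fgen_par F) pi.
set b' := (_, _); have Hs := bideg_subspace b'.
have cast b2 w : H b2 w -> b2 = b' -> H b' w by move=> h <-.
apply: subspaceB => //; last apply: subspaceMz => //.
  apply: subspace_sum => // j _; apply: subspaceMz => //.
  apply: cast; first exact: bideg_amode (IH _ _ _ Hu).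
  congr (_, _) => /=; first by rewrite mulrS; ring.
  by rewrite big_cons !intrD !mulrS; ring.
apply: subspace_sum => // j _; apply: subspaceMz => //.
apply: cast; first exact: IH _ _ _ (bideg_amode _ Hu).
congr (_, _) => /=; first by rewrite mulrS; ring.
by rewrite big_cons !intrD !mulrS; ring.
Qed.

Lemma bideg_bigraded : is_grading H -> is_bigraded_vmodule (F_bideg F C D) H.
Proof.
move=> gH; split=> // b b' n x u Gx Hu.
move: x Gx; apply: lspan_min => [|_ [s [-> b1 b2]]].
  have Hs := bideg_subspace (b.1 + b'.1, b.2 + b'.2 - n%:~R - 1).
  apply: subspace_pair => [|x y|c x].
  - by rewrite vact0l; exact: subspace0.
  - by rewrite vactDl; exact: subspaceD.
  - by rewrite vactZl; exact: subspaceZ.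
have := bideg_monomial s n Hu; rewrite b1 b2 !add0r.
by congr (H (_, _) _); ring.
Qed.

Hypothesis gen : forall P : set N, is_subspace P -> P u0 ->
  (forall n u, P u -> P (vact n a u)) -> forall u, P u.
Variable L : {linear N -> N}.
Hypothesis L0 : L u0 = u0.
Hypothesis L_amode : forall n u, L (vact n a u) = (2%:R * 3%:R ^ (- n)) *: vact n a (L u).

Lemma L_monomial s : L (monomial (@vact K F N) a s u0) =
  (2%:R ^+ size s * 3%:R ^ (\sum_(n <- s) n)) *: monomial (@vact K F N) a s u0.
Proof.
elim: s => [|n s IH] /=; first by rewrite L0 big_nil expr0 expr0z mulr1 scale1r.
rewrite L_amode IH opprK linearZ_LR scalerA big_cons exprS expfzDr ?(char0 2) //.
by congr (_ *: _); ring.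
Qed.

Definition bidegree (b : K * K) (r : nat) (q : int) : Prop :=
  b.1 = S + C *+ r /\ b.2 = E + q%:~R - r%:R + D *+ r.

Lemma bidegree_inj b r q r' q' : bidegree b r q -> bidegree b r' q' -> r = r' /\ q = q'.
Proof.
move=> [b1 b2] [b1' b2'].
have rr : r = r'.
  apply: natr_inj_char0; apply: (mulfI C0).
  by rewrite !mulr_natr; apply: (addrI S); rewrite -b1 -b1'.
split=> //; apply: intr_inj_char0; apply: (addrI E).
by move: b2'; rewrite b2 -rr => /addIr /addIr.
Qed.

(** The bidegree components are eigenspaces, for distinct eigenvalues, of an
    operator scaling the monomials by 2^r 3^(n_1 + ... + n_r). *)
Lemma bideg_grading : is_grading H.
Proof.
split=> [b||].
- exact: bideg_subspace.
- move=> u; have : lspan [set w | exists2 s, True & w = monomial (@vact K F N) a s u0]%classic u.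
    apply: gen.
    + exact: lspan_subspace.
    + by apply: lspan_in; exists [::].
    + move=> n w; move: w; apply: lspan_min => [|_ [s _ ->]]; last first.
        by apply: lspan_in; exists (- n :: s) => //=; rewrite opprK.
      apply: subspace_pair => [|x y|c x].
      * by rewrite linear0; exact: subspace0 (lspan_subspace _).
      * by rewrite linearD; exact: subspaceD (lspan_subspace _).
      * by rewrite linearZ; exact: subspaceZ (lspan_subspace _).
  move=> /lspan_uniq[r [c [ur _ ->]]].
  pose bd (s : seq int) : K * K := (S + C *+ size s,
     E + (\sum_(n <- s) n)%:~R - (size s)%:R + D *+ size s).
  exists (undup (map bd r)), (fun b => \sum_(s <- r | bd s == b)
    c s *: monomial (@vact K F N) a s u0); split.
    move=> b; apply: subspace_sum => [|s /eqP <-]; first exact: bideg_subspace.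
    by apply: subspaceZ; [exact: bideg_subspace | apply: lspan_in; exists s].
  under [RHS]eq_bigr => b _ do rewrite big_mkcond /=.
  rewrite exchange_big /=; rewrite big_seq [RHS]big_seq; apply: eq_bigr => s sr.
  rewrite (bigD1_seq (bd s)) ?undup_uniq ?mem_undup ?map_f //= eqxx big1 ?addr0 // => b.
  by rewrite eq_sym => /negPf ->.
have /choice[lam lamP] : forall b : K * K, exists l : K,
    (forall r q, bidegree b r q -> l = 2%:R ^+ r * 3%:R ^ q)
    /\ ((forall r q, ~ bidegree b r q) -> l = 0).
  move=> b.
  have [[r [q bd]]|no] := pselect (exists r q, bidegree b r q).
    exists (2%:R ^+ r * 3%:R ^ q); split=> [r' q' bd'|/(_ r q) //].
    by have [-> ->] := bidegree_inj bd bd'.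
  by exists 0; split=> // r q bd; case: no; exists r, q.
have two0 : 2%:R != 0 :> K := char0 1; have three0 : 3%:R != 0 :> K := char0 2.
have lam_inj b b' r q : bidegree b r q -> lam b = lam b' -> b = b'.
  move=> bd; rewrite (proj1 (lamP b) _ _ bd).
  have [[r' [q' bd']]|no] := pselect (exists r q, bidegree b' r q).
    rewrite (proj1 (lamP b') _ _ bd') => /two_three_inj[rr qq].
    case: b b' bd bd' => b1 b2 [b1' b2'] [/= e1 e2] [/= e1' e2'].
    by rewrite e1 e2 e1' e2' rr qq.
  rewrite (proj2 (lamP b')) => [/eqP|r' q' bd']; last by apply: no; exists r', q'.
  by rewrite mulf_eq0 expf_eq0 (negPf two0) andbF expfz_eq0 (negPf three0) andbF.
have eig b u : H b u -> L u = lam b *: u.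
  move: u; apply: lspan_min => [|_ [s [-> b1 b2]]].
    apply: subspace_pair => [|x y hx hy|c x hx].
    - by rewrite linear0 scaler0.
    - by rewrite linearD hx hy scalerDr.
    - by rewrite linearZ_LR hx !scalerA [lam b * c]mulrC.
  by rewrite L_monomial (proj1 (lamP b) _ _ (conj b1 b2)).
have nz b u : H b u -> u != 0 -> exists r q, bidegree b r q.
  move=> Hu un0; apply: contrapT => no; move/eqP: un0; apply.
  move: u Hu; apply: lspan_min => [|w [s [_ b1 b2]]].
    apply: subspace_pair => [|x y -> ->|c x ->] //; first by rewrite addr0.
    by rewrite scaler0.
  by case: no; exists (size s), (\sum_(n <- s) n).
elim=> [|b s IH] y /=; first by [].
move=> /andP[bs us] Hy; rewrite big_cons => s0.
pose y' i := (lam i - lam b) *: y i.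
have Hy' i : H i (y' i) by apply: subspaceZ => //; exact: bideg_subspace.
have s0' : \sum_(i <- s) y' i = 0.
  transitivity (L (y b + \sum_(i <- s) y i) - lam b *: (y b + \sum_(i <- s) y i)).
    rewrite linearD (eig b) // scalerDr opprD addrACA subrr add0r.
    rewrite linear_sum scaler_sumr -sumrB; apply: eq_bigr => i _.
    by rewrite (eig i) // -scalerBl.
  by rewrite s0 linear0 scaler0 subr0.
have ys i : i \in s -> y i = 0.
  move=> is_; have := IH y' us Hy' s0' i is_ => /eqP.
  rewrite scaler_eq0 subr_eq0 => /orP[/eqP lE|/eqP //].
  apply/eqP/negP => /negP yn0; have [r [q bd]] := nz i _ (Hy i) yn0.
  by move: bs; rewrite -(lam_inj _ _ _ _ bd lE) is_.
move=> i; rewrite inE => /orP[/eqP ->|]; last exact: ys.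
by move: s0; rewrite big_seq big1 ?addr0.
Qed.

End Bigrading.

(** * The exact sequence *)
Section ExactSequence.
Variables (K : fieldType) (p : nat) (F : freeVA K p).
Hypothesis char0 : forall n : nat, n.+1%:R != 0 :> K.
Local Notation a := (fgen F).

Lemma fr_nonneg k m (M : freeRep F k m) (n : nat) (u : fr_res M) : vact n%:Z a u = 0.
Proof. by have [] := fr_bounded char0 n (u : fr_res M). Qed.

Lemma fr_high k m (M : freeRep F k m) (n : int) (u : fr_res M) : k <= n -> vact (- n) a u = 0.
Proof.
move=> kn; have [+ _] := fr_bounded char0 (absz (n - k)%R) u.
by have -> : - k - (absz (n - k)%R)%:Z = - n by lia.
Qed.

Lemma fr_low k m (M : freeRep F k m) (n : int) : n <= m -> vact (- n) a (fr_vec M) = 0.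
Proof.
move=> nm; have := fr_ann M (absz (m - n)%R).
by have -> : - m + (absz (m - n)%R)%:Z = - n by lia.
Qed.

(** Used with Z = 0 for the spanning part of a basis of M_k(m), and with Z the image
    of the top mode for exactness in the middle. *)
Lemma fr_standard k m (M : freeRep F k m) n (Z : set (fr_res M)) : (0 < p)%N -> is_subspace Z ->
  (forall n u, Z u -> Z (vact n a u)) ->
  (forall j u, (n <= j)%N -> Z (vact (Negz j) a u)) ->
  forall u, sum_set (standard_span (low_letter m) n (fr_vec M)) Z u.
Proof.
move=> p_gt0 Zs Zst Ztop u; set T := sum_set _ _.
have Ts : is_subspace T by apply: sum_set_subspace => //; exact: lspan_subspace.
suff /(lspan_min Ts) h : forall w, (exists s, w = word s (fr_vec M)) -> T w.
  apply: h; apply: (fr_generated (P := lspan _)) => [||q w].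
  - exact: lspan_subspace.
  - by apply: lspan_in; exists [::].
  - move: w; apply: lspan_min => [|_ [s ->]].
      apply: subspace_pair => [|x y|c x].
      + by rewrite linear0; exact: subspace0 (lspan_subspace _).
      + by rewrite linearD; exact: subspaceD (lspan_subspace _).
      + by rewrite linearZ; exact: subspaceZ (lspan_subspace _).
    case: q => q; last by apply: lspan_in; exists (q :: s).
    by rewrite fr_nonneg; exact: subspace0 (lspan_subspace _).
move=> _ [s ->]; apply: word_standard => //.
- exact: fr_nonneg.
- by move=> j t nj; exact: Ztop.
- move=> j jm; have -> : Negz j = - j.+1%:Z by [].
  rewrite fr_low; first exact: subspace0.
  by move: jm; rewrite /low_letter; lia.
Qed.

Lemma hom_word (N N' : vmodule F) (f : vmodHom N N') s u : f (word s u) = word s (f u).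
Proof. by elim: s => //= i s <-; rewrite vmodHom_vact. Qed.

Lemma standard_span_uniq (N : vmodule F) mu n (v u : N) : standard_span mu n v u ->
  exists (r : seq (seq nat)) (c : seq nat -> K),
    [/\ uniq r, {in r, forall s, standard p mu n s} & u = \sum_(s <- r) c s *: word s v].
Proof. exact: lspan_uniq. Qed.

Section Maps.
Variables (k m : int) (M' : freeRep F (k - p%:Z) m) (M : freeRep F k m)
  (M'' : freeRep F (k - 1) m).

Local Notation top := (vact (- k + 1) a : fr_res M -> fr_res M).

Definition top_image : set (fr_res M) := [set u | exists w, u = top w]%classic.

Lemma top_image_subspace : is_subspace top_image.
Proof.
apply: subspace_pair; first by exists 0; rewrite linear0.
  by move=> _ _ [u ->] [w ->]; exists (u + w); rewrite linearD.
by move=> c _ [u ->]; exists (c *: u); rewrite linearZ.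
Qed.

Lemma top_image_amode n u : top_image u -> top_image (vact n a u).
Proof.
move=> [w ->]; exists (vact n a w *~ (-1) ^+ odd p).
by rewrite [RHS]raddfMz; exact: amode_commute.
Qed.

Lemma top_image_stable n (x : F) u : top_image u -> top_image (vact n x u).
Proof.
exact: (amode_stable (N := fr_res M) top_image_subspace top_image_amode).
Qed.

Lemma top_image_graded u : top_image u -> exists u0 u1,
  [/\ vm_par false u0, vm_par true u1, top_image u0, top_image u1 & u = u0 + u1].
Proof.
move=> [w ->]; have [w0 [w1 [p0 p1 ->]]] := grading_split (vm_par_grading (fr_res M)) w.
have q0 := vact_par (- k + 1) (fgen_par F) p0; have q1 := vact_par (- k + 1) (fgen_par F) p1.
have in_top x : top_image (top x) by exists x.
rewrite linearD; case: (odd p) q0 q1 => q0 q1.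
  by exists (top w1), (top w0); split=> //; exact: addrC.
by exists (top w0), (top w1); split.
Qed.

Definition top_module : vmodule F :=
  submodule top_image_subspace top_image_stable top_image_graded.

(** As a(-n) = 0 for n >= k, the symmetry of (z - w)^(-p) Y(a, z) Y(a, w) gives
    a(-n) a(-k+1) = 0 for n >= k - p. *)
Lemma top_module_bounded : bounded (k - p%:Z) top_module.
Proof.
move=> n u; split; apply: subval_inj; last first.
  exact: fr_nonneg (subval (u : subsp top_image_subspace)).
have [w uE] := subval_in (u : subsp top_image_subspace).
rewrite -[LHS]/(vact (- (k - p%:Z) - n%:Z) a (subval (u : subsp top_image_subspace)) : fr_res M).
rewrite uE amode_commute.
have -> : - (k - p%:Z) - n%:Z = - (k - p%:Z + n%:Z) by lia.
have -> : - k + 1 = - (k - 1) by lia.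
rewrite (_ : vact _ a (vact _ a w) = 0) ?mul0rz //.
apply: (amode_lead (Z := [set u | u = 0]%classic)); last first.
- by move=> q i ki; apply: fr_high; lia.
- lia.
- by apply: subspace_pair => [|x y -> ->|c x ->]; rewrite ?addr0 ?scaler0.
Qed.

Lemma top_vec_in : top_image (top (fr_vec M)).
Proof. by exists (fr_vec M). Qed.

Lemma top_hom_exists : exists f : vmodHom (fr_res M') (fr_res M),
  f (fr_vec M') = top (fr_vec M) /\ forall u, top_image (f u).
Proof.
pose w : top_module := subin top_image_subspace top_vec_in.
have wh : vm_homogeneous w.
  have [i pi] := fr_hom M; exists (odd p (+) i).
  exact: vact_par (fgen_par F) pi.
have wa (n : nat) : vact (- m + n%:Z) a w = 0.
  apply: subval_inj; rewrite -[LHS]/(vact (- m + n%:Z) a (top (fr_vec M)) : fr_res M).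
  by rewrite amode_commute fr_ann linear0 mul0rz.
have [h hw] := fr_universal M' top_module_bounded wh wa.
pose f : {linear fr_res M' -> fr_res M} := @subval _ _ _ top_image_subspace \o h.
have f_act n x u : f (vact n x u) = vact n x (f u).
  by rewrite /= vmodHom_vact.
have f_par : exists s : bool, forall i u, vm_par i u -> vm_par (i (+) s) (f u).
  exact: vmodHom_par h.
exists (VmodHom f_act f_par); split; first by rewrite /= hw.
by move=> u; exact: subval_in.
Qed.

Lemma quotient_hom_exists : exists g : vmodHom (fr_res M) (fr_res M''),
  g (fr_vec M) = fr_vec M''.
Proof.
apply: fr_universal; [|exact: fr_hom|exact: fr_ann].
move=> n u; split; last exact: fr_nonneg.
have -> : - k - n%:Z = - (k + n%:Z) by lia.
by apply: fr_high; lia.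
Qed.

Variables (f : vmodHom (fr_res M') (fr_res M)) (g : vmodHom (fr_res M) (fr_res M'')).
Hypothesis fv : f (fr_vec M') = top (fr_vec M).
Hypothesis f_top : forall u, top_image (f u).
Hypothesis gv : g (fr_vec M) = fr_vec M''.

Lemma quotient_hom_surj w : exists u, g u = w.
Proof.
apply: (fr_generated (P := fun w => exists u, g u = w)) => [||n _ [u <-]].
- apply: subspace_pair; first by exists 0; rewrite linear0.
    by move=> _ _ [u <-] [w' <-]; exists (u + w'); rewrite linearD.
  by move=> c _ [u <-]; exists (c *: u); rewrite linearZ.
- by exists (fr_vec M).
- by exists (vact n a u); rewrite vmodHom_vact.
Qed.

Lemma top_image_im u : top_image u -> exists t, f t = u.
Proof.
move=> [w ->]; apply: (fr_generated (P := fun w => exists t, f t = top w)) => [||n x [t tE]].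
- apply: subspace_pair; first by exists 0; rewrite !linear0.
    by move=> x y [u' uE] [w' wE]; exists (u' + w'); rewrite !linearD uE wE.
  by move=> c x [u' uE]; exists (c *: u'); rewrite !linearZ uE.
- by exists (fr_vec M').
- exists (vact n a t *~ (-1) ^+ odd p).
  have -> : f (vact n a t *~ (-1) ^+ odd p) = f (vact n a t) *~ (-1) ^+ odd p
    by exact: raddfMz.
  by rewrite vmodHom_vact tE [RHS]amode_commute.
Qed.

(** Modulo the image of a(-k+1), M_k(m) is spanned by the standard words with
    letters below k - 2, whose images in M_(k-1)(m) are independent. *)
Lemma middle_exact u : (0 < p)%N -> g u = 0 <-> exists t, f t = u.
Proof.
move=> p_gt0; split=> [gu|[t <-]]; last first.
  have [w ->] := f_top t; rewrite vmodHom_vact.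
  have -> : - k + 1 = - (k - 1) by lia.
  exact: fr_high.
apply: top_image_im.
have [|y [_ [Sy [w ->] uE]]] := fr_standard (n := letter_bound (k - 1)) p_gt0 top_image_subspace
    top_image_amode _ u.
  move=> j x; rewrite /letter_bound => kj.
  case: (ltrP (j.+1%:Z) k) => jk; last first.
    have -> : Negz j = - j.+1%:Z by [].
    by rewrite fr_high //; exact: subspace0 top_image_subspace.
  by exists x; congr vact; lia.
have gtop : g (top w) = 0.
  rewrite vmodHom_vact; have -> : - k + 1 = - (k - 1) by lia.
  exact: fr_high.
have [r [c [ur rs yE]]] := standard_span_uniq Sy.
have gy : \sum_(s <- r) c s *: word s (fr_vec M'') = 0.
  rewrite -[RHS]gu uE linearD gtop addr0 yE linear_sum; apply: eq_bigr => s _.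
  by rewrite linearZ hom_word gv.
have c0 := standard_independent char0 p_gt0 ur rs gy.
exists w; rewrite uE yE big_seq big1 ?add0r // => s sr.
by rewrite c0 // scale0r.
Qed.

(** A standard word of M_(k-p)(m) has letters at most k - p - 2, so adding the letter
    k - 2 to it gives a standard word of M_k(m); f does this up to sign. *)
Lemma top_hom_inj : (0 < p)%N -> Num.max m 0 + 2 <= k -> injective f.
Proof.
move=> p_gt0 mk; have ker0 u : f u = 0 -> u = 0.
  move=> fu; pose Z : set (fr_res M') := [set u | u = 0]%classic.
  have Zs : is_subspace Z.
    by apply: subspace_pair => [|x y -> ->|c x ->]; rewrite /Z /= ?addr0 ?scaler0.
  have [||y [_ [Sy -> uE]]] := fr_standard (n := letter_bound (k - p%:Z)) p_gt0 Zs _ _ u.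
  - by move=> n x ->; rewrite /Z /= linear0.
  - move=> j x; rewrite /letter_bound => kj.
    have -> : Negz j = - j.+1%:Z by [].
    by apply: fr_high; lia.
  rewrite addr0 in uE; rewrite uE in fu *.
  have [r [c [ur rs yE]]] := standard_span_uniq Sy.
  pose e := absz (k - 2)%R.
  have eE : Negz e = - k + 1 by rewrite /e; lia.
  have emu : (low_letter m <= e)%N by rewrite /e /low_letter; lia.
  have bE : letter_bound k = e.+1 by rewrite /letter_bound /e; lia.
  have inj_e : injective (cons e) by move=> s t [].
  have rs' : {in map (cons e) r, forall s, standard p (low_letter m) (letter_bound k) s}.
    move=> _ /mapP[s sr ->]; rewrite bE; apply: standard_cons => //.
    apply: standard_widen (rs s sr); rewrite /letter_bound /e; lia.
  pose c' s := c (behead s) * (-1) ^+ (odd p * size (behead s)).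
  have sum0 : \sum_(s <- map (cons e) r) c' s *: word s (fr_vec M) = 0.
    rewrite big_map -[RHS]fu yE linear_sum; apply: eq_bigr => s _.
    rewrite linearZ hom_word fv word_commute /= eE /c' /= -scaler_int scalerA.
    by rewrite rmorphXn rmorphN rmorph1.
  have c0 := standard_independent char0 p_gt0 (r := map (cons e) r) _ rs' sum0.
  rewrite yE big_seq big1 // => s sr.
  have := c0 _ (e :: s) (map_f _ sr); rewrite map_inj_uniq // => /(_ ur) /eqP.
  rewrite /c' mulf_eq0 signr_eq0 orbF => /eqP ->; exact: scale0r.
move=> x y xy; apply/eqP; rewrite -subr_eq0; apply/eqP/ker0.
by rewrite linearB xy subrr.
Qed.

End Maps.
End ExactSequence.

(** * The bigraded exact sequence *)
Section Degrees.
Variables (K : fieldType) (p : nat) (F : freeVA K p).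
Hypothesis char0 : forall n : nat, n.+1%:R != 0 :> K.
Local Notation a := (fgen F).

(** With s = 6 and t = 3 the mode a(-n) is multiplied by 6 * 3^(n - 1) = 2 * 3^n. *)
Lemma six_twist_factor n : 6%:R * twist_factor (3%:R : K) n = 2%:R * 3%:R ^ (- n).
Proof.
have three0 : 3%:R != 0 :> K := char0 2.
rewrite /twist_factor expfzDr // -[6%N]/(2 * 3)%N natrM -!mulrA; congr (_ * _).
by rewrite mulrCA exprN1 divff // mulr1.
Qed.

Lemma free_bigraded (C D : K) : C != 0 -> is_bigraded_va (F_bideg F C D).
Proof.
move=> C0.
have [phi [pa pv pn _]] := scaling_exists (char0 2 : 3%:R != 0) F (char0 5 : 6%:R != 0).
have gen (P : set F) : is_subspace P -> P (vac F) ->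
    (forall n u, P u -> P (nprod n a u)) -> forall u, P u.
  move=> Ps P1 Pa u; rewrite -[u]nprod_vacr.
  exact: (amode_stable (N := adjoint F) Ps Pa).
have phia n u : phi (nprod n a u) = (2%:R * 3%:R ^ (- n)) *: nprod n a (phi u).
  by rewrite pn pa nprodZl scalerA mulrC six_twist_factor.
have gF : is_grading (F_bideg F C D).
  exact: (bideg_grading (N := adjoint F) char0 D 0 0 C0 gen pv phia).
have [_ gM] := bideg_bigraded (N := adjoint F) gF.
by split=> //; apply: lspan_in; exists [::]; split; rewrite //= ?big_nil; ring.
Qed.

Lemma fr_bigraded k m (M : freeRep F k m) (C D S E : K) : C != 0 ->
  is_bigraded_vmodule (F_bideg F C D) (M_bideg M C D S E).
Proof.
move=> C0.
have [L [L0 L_amode]] := fr_scaling_exists (char0 2 : 3%:R != 0) (char0 5 : 6%:R != 0) char0 M.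
apply: bideg_bigraded; apply: (bideg_grading char0 _ _ _ C0 (@fr_generated _ _ _ _ _ M) L0) => n u.
by rewrite L_amode six_twist_factor.
Qed.

Lemma hom_monomial (N N' : vmodule F) (f : vmodHom N N') s u :
  f (monomial (@vact K F N) a s u) = monomial (@vact K F N') a s (f u).
Proof. by elim: s => //= i s <-; rewrite vmodHom_vact. Qed.

Lemma bideg_hom (N N' : vmodule F) (f : vmodHom N N') v v' C D S E S' E' :
  (forall b s, b.1 = S + C *+ size s ->
     b.2 = E + (\sum_(n <- s) n)%:~R - (size s)%:R + D *+ size s ->
     bideg (@vact K F N') a v' C D S' E' b (monomial (@vact K F N') a s (f v))) ->
  grading_preserving (bideg (@vact K F N) a v C D S E)
    (bideg (@vact K F N') a v' C D S' E') f.
Proof.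
move=> fb b u; move: u; apply: lspan_min => [|_ [s [-> b1 b2]]].
  have Hs : is_subspace (bideg (@vact K F N') a v' C D S' E' b) by exact: lspan_subspace.
  apply: subspace_pair => [|x y|c x].
  - by rewrite linear0; exact: subspace0.
  - by rewrite linearD; exact: subspaceD.
  - by rewrite linearZ; exact: subspaceZ.
by rewrite hom_monomial; exact: fb.
Qed.

End Degrees.

Theorem proposition10 (R : realType) (p : nat) (hp : (0 < p)%N) (k m : int)
    (F : freeVA R[i] p)
    (M' : freeRep F (k - p%:Z) m) (M : freeRep F k m) (M'' : freeRep F (k - 1) m)
    (C D S E : R[i]) (hC : C != 0) :
  exists (f : vmodHom (fr_res M') (fr_res M))
         (g : vmodHom (fr_res M) (fr_res M'')),
    [/\ unique_hom f (fr_vec M') (vact (- k + 1) (fgen F) (fr_vec M)),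
        unique_hom g (fr_vec M) (fr_vec M''),
        (* 0 -> M_{k-p}(m) -> M_k(m) -> M_{k-1}(m) -> 0 is exact; outside the
           range of the first clause a(-k+1)v_{k,m} = 0, hence f = 0, while
           v_{k-p,m} is never 0 *)
        [/\ (Num.max m 0 + 2 <= k -> injective f),
            (forall u : fr_res M, g u = 0 <-> exists t : fr_res M', f t = u)
          & (forall w : fr_res M'', exists u : fr_res M, g u = w)],
        (* it is a sequence of bigraded F(p; C, D)-modules *)
        [/\ is_bigraded_va (F_bideg F C D),
            is_bigraded_vmodule (F_bideg F C D)
              (M_bideg M' C D (S + C) (E + k%:~R - 2 + D)),
            is_bigraded_vmodule (F_bideg F C D) (M_bideg M C D S E)
          & is_bigraded_vmodule (F_bideg F C D) (M_bideg M'' C D S E)]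
      & grading_preserving (M_bideg M' C D (S + C) (E + k%:~R - 2 + D))
          (M_bideg M C D S E) f
        /\ grading_preserving (M_bideg M C D S E) (M_bideg M'' C D S E) g].
Proof.
have char0 n : n.+1%:R != 0 :> R[i] by rewrite pnatr_eq0.
have [f [fv f_top]] := top_hom_exists char0 M' M.
have [g gv] := quotient_hom_exists char0 M M''.
exists f, g; split.
- by split=> // f' f'v; apply: fr_hom_unique; rewrite f'v fv.
- by split=> // g' g'v; apply: fr_hom_unique; rewrite g'v gv.
- split; first exact: top_hom_inj.
    by move=> u; exact: middle_exact.
  exact: quotient_hom_surj.
- by split; [exact: free_bigraded | exact: fr_bigraded | exact: fr_bigraded | exact: fr_bigraded].
- split; apply: bideg_hom => b s b1 b2; last first.
    by rewrite gv; apply: lspan_in; exists s.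
  (* f adds the factor a(-(k-1)) next to the generator *)
  rewrite fv; apply: lspan_in; exists (rcons s (k - 1)); split.
  + rewrite /monomial -cats1 foldr_cat /=; congr foldr.
    by congr vact; rewrite opprB addrC.
  + by rewrite b1 size_rcons mulrS addrA.
  + rewrite b2 -cats1 big_cat big_seq1 size_cat addn1 /= !intrD !mulrS; ring.
Qed.
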